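(* Let $\mathfrak{m}\Gamma\mathrm{Sym}$ and $\mathfrak{m}\bar\Gamma\mathrm{Sym}$ be the linearly compact $\mathbb{Z}[\beta]$-modules with pseudobases $\{GQ^{(\beta)}_\lambda\}$ and $\{GP^{(\beta)}_\lambda\}$ respectively, $\lambda$ ranging over all strict partitions, and let $\mathfrak{m}\Pi\mathrm{Sym}$ and $\mathfrak{m}\bar\Pi\mathrm{Sym}$ be the linearly compact $\mathbb{Z}[\beta]$-modules with pseudobases $\{K^{(\beta)}_\alpha\}$ and $\{\bar K^{(\beta)}_\alpha\}$ respectively, $\alpha$ ranging over all peak compositions. Then $$\mathfrak{m}\Gamma\mathrm{Sym}=\mathfrak{m}\mathrm{Sym}\cap\mathfrak{m}\Pi\mathrm{Sym}\qquad\text{and}\qquad\mathfrak{m}\bar\Gamma\mathrm{Sym}=\mathfrak{m}\mathrm{Sym}\cap\mathfrak{m}\bar\Pi\mathrm{Sym}.$$ In particular, $\mathfrak{m}\Gamma\mathrm{Sym}\subseteq\mathfrak{m}\bar\Gamma\mathrm{Sym}$.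
   Context: $\mathfrak{m}\mathrm{Sym}$ is the module of all symmetric power series (of possibly unbounded degree) in $\mathbb{Z}[\beta][[x_1,x_2,\dots]]$. The linearly compact $\mathbb{Z}[\beta]$-module with a given pseudobasis consists of all (possibly infinite) $\mathbb{Z}[\beta]$-linear combinations of its elements, here viewed inside $\mathbb{Z}[\beta][[x_1,x_2,\dots]]$ (these infinite sums converge, since $GP^{(\beta)}_\lambda,GQ^{(\beta)}_\lambda$ involve only $x$-monomials of degree $\ge|\lambda|$ and $K^{(\beta)}_\alpha,\bar K^{(\beta)}_\alpha$ only those of degree $\ge|\alpha|$). Let $\mathbb{M}=\{1'<1<2'<2<\cdots\}$, $|i'|=|i|=i$. For finite nonempty $S,T\subset\mathbb{M}$: $S\prec T$ means $\max S<\min T$, $S\preceq T$ means $\max S\le\min T$, $x^S=\prod_{i\in S}x_{|i|}$. $K$-theoretic Schur $P$- and $Q$-functions. For a strict partition $\lambda=(\lambda_1>\lambda_2>\cdots>0)$ let $\mathsf{SD}_\lambda=\{(i,i+j-1):1\le j\le\lambda_i\}$. A semistandard shifted set-valued tableau $T$ of shape $\lambda$ assigns to each box of $\mathsf{SD}_\lambda$ a finite nonempty subset of $\mathbb{M}$, weakly increasing in the sense of $\preceq$ along rows and columns, with no unprimed number appearing twice in the same column and no primed number appearing twice in the same row. With $|T|$ the sum of the entry sizes and $x^T$ the product of $x^{T(i,j)}$, $GQ^{(\beta)}_\lambda=\sum_T\beta^{|T|-|\lambda|}x^T$ over all such $T$, and $GP^{(\beta)}_\lambda$ is the same sum restricted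 to $T$ whose diagonal entries $T(i,i)$ contain only unprimed numbers. Multipeak functions. For a composition $\alpha=(\alpha_1,\dots,\alpha_k)$ (finite sequence of positive integers) let $|\alpha|=\sum\alpha_i$ and $I(\alpha)=\{\alpha_1,\alpha_1+\alpha_2,\dots,\alpha_1+\dots+\alpha_{k-1}\}$. It is a peak composition if $\alpha_i\ge2$ for $1\le i<k$. For a tuple $S=(S_1,\dots,S_N)$ put $|S|=\sum|S_i|$, $x^S=\prod x^{S_i}$. For a peak composition $\alpha$ with $|\alpha|=N$: $K^{(\beta)}_\alpha=\sum_S\beta^{|S|-N}x^S$ over $N$-tuples of finite nonempty $S_i\subset\mathbb{M}$ with $S_1\preceq\cdots\preceq S_N$, $S_i\cap S_{i+1}\subset\{1',2',\dots\}$ if $i\in I(\alpha)$, and $S_i\cap S_{i+1}\subset\{1,2,\dots\}$ if $i\notin I(\alpha)$. $\bar K^{(\beta)}_\alpha=\sum_S\beta^{|S|-N}x^S$ over $N$-tuples of finite nonempty $S_i\subset\mathbb{M}$ with $S_1\preceq\cdots\preceq S_N$, $S_i\prec S_{i+1}$ if $i\in I(\alpha)$, $S_{i+1}\subseteq\mathbb{Z}_{>0}$ if $i\in\{0\}\cup I(\alpha)$, and $S_i\cap S_{i+1}\subseteq\mathbb{Z}_{>0}$ if $i\notin I(\alpha)$. *)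

(* Defs.v *)
From mathcomp Require Import all_boot all_order all_algebra.
From mathcomp Require Import finmap.
From mathcomp Require Import boolp classical_sets functions fsbigop.
From mathcomp Require Import monalg.

Set Implicit Arguments.
Unset Strict Implicit.
Unset Printing Implicit Defensive.

Import Order.TTheory GRing.Theory Num.Theory.

Local Open Scope classical_set_scope.
Local Open Scope ring_scope.

(** * Power series in x_1, x_2, ... over Z[beta]

    Z[beta] is [{poly int}] with beta = ['X].  All indices are shifted to start
    at 0: the variable x_(i+1) has index [i : nat].  A power series is its
    family of coefficients; there is no restriction on the degree. *)

Definition pseries := {cmonom nat} -> {poly int}.

Definition mono_series (c : {poly int}) (u : {cmonom nat}) : pseries :=
  fun m => if m == u then c else 0.

(** Coefficientwise infinite sum.  The sum over [i \in D] runs over the indices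
    with nonzero summand, and is 0 when there are infinitely many of them; this
    never happens below, since a monomial occurs in x^S for only finitely many
    S, and occurs in GP_lambda, GQ_lambda (resp. K_alpha, barK_alpha) only if
    its degree is at least |lambda| (resp. |alpha|). *)
Definition psum (I : choiceType) (D : set I) (F : I -> pseries) : pseries :=
  fun m => \sum_(i \in D) F i m.

(** All infinite Z[beta]-linear combinations of the [F i], for [i] in [D]. *)
Definition pspan (I : choiceType) (D : set I) (F : I -> pseries) :
    set pseries :=
  [set f | exists c : I -> {poly int}, f = psum D (fun i m => c i * F i m)].

Definition mSym : set pseries :=
  [set f | forall s : nat -> nat, bijective s ->
     forall m m' : {cmonom nat}, (forall i, m' (s i) = m i) -> f m' = f m].

(** * The alphabet 1' < 1 < 2' < 2 < ...

    With the index shift, (i+1)' is [(i, false)] and i+1 is [(i, true)], in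
    lexicographic order. *)

Notation letter := (nat *l bool)%type.

Definition labs (a : letter) : nat := a.1.
Definition unprimed (a : letter) : bool := a.2.

(** max S < min T and max S <= min T, for nonempty S and T. *)
Definition set_lt (S T : {fset letter}) : Prop :=
  forall a b, a \in S -> b \in T -> (a < b)%O.
Definition set_le (S T : {fset letter}) : Prop :=
  forall a b, a \in S -> b \in T -> (a <= b)%O.

Section Fillings.
Variable I : finType.
Implicit Type S : {ffun I -> {fset letter}}.

Definition all_nonempty S : Prop := forall i, S i != fset0.

Definition total_size S : nat := (\sum_i #|` S i|)%N.

Definition xmon S : {cmonom nat} :=
  \big[mmul/mone]_i \big[mmul/mone]_(a <- S i) ucm (labs a).

(** The sum of beta^(|S| - N) x^S over the fillings S in A.  As the entries of S
    are nonempty and N is the number of entries, the subtraction is exact. *)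
Definition genfun (A : set {ffun I -> {fset letter}}) (N : nat) : pseries :=
  psum A (fun S => mono_series ('X^(total_size S - N)) (xmon S)).

End Fillings.

(** * K-theoretic Schur P- and Q-functions *)

Definition strict_partition (l : seq nat) : Prop :=
  sorted gtn l /\ all (leq 1) l.

(** Boxes (row, column), both counted from 0. *)
Definition SD (l : seq nat) : {fset nat * nat} :=
  [fset b in [seq (i, i + j)%N | i <- iota 0 (size l),
                                 j <- iota 0 (nth 0%N l i)]]%fset.

Section Tableaux.
Variable l : seq nat.
Implicit Type T : {ffun SD l -> {fset letter}}.

Definition row (b : SD l) : nat := (fsval b).1.
Definition col (b : SD l) : nat := (fsval b).2.

Definition shifted_tableau T : Prop :=
  [/\ all_nonempty T,
      forall b c, row b = row c -> (col b < col c)%N -> set_le (T b) (T c),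
      forall b c, col b = col c -> (row b < row c)%N -> set_le (T b) (T c),
      forall b c a, unprimed a -> col b = col c ->
        a \in T b -> a \in T c -> b = c
    & forall b c a, ~~ unprimed a -> row b = row c ->
        a \in T b -> a \in T c -> b = c].

Definition unprimed_diagonal T : Prop :=
  forall b a, row b = col b -> a \in T b -> unprimed a.

End Tableaux.

Definition GQ (l : seq nat) : pseries :=
  genfun [set T | @shifted_tableau l T] (sumn l).

Definition GP (l : seq nat) : pseries :=
  genfun [set T | @shifted_tableau l T /\ unprimed_diagonal T] (sumn l).

(** * Multipeak functions *)

Definition peak_composition (al : seq nat) : Prop :=
  all (leq 1) al /\
  forall i, (i.+1 < size al)%N -> (2 <= nth 0%N al i)%N.

(** I(alpha): the partial sums of the first k parts, 0 < k < size alpha. *)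
Definition descents (al : seq nat) : seq nat :=
  [seq sumn (take k al) | k <- iota 1 (size al).-1].

Section Tuples.
Variable al : seq nat.
Implicit Type S : {ffun 'I_(sumn al) -> {fset letter}}.

(** [S i] is S_(i+1), so when [j = i.+1] the pair (S_j, S_(j+1)) of the
    usual 1-based notation is [(S i, S j)]. *)

Definition K_tuple S : Prop :=
  all_nonempty S /\
  forall i j : 'I_(sumn al), j = i.+1 :> nat ->
    set_le (S i) (S j) /\
    forall a, a \in S i -> a \in S j -> unprimed a = (val j \notin descents al).

Definition Kbar_tuple S : Prop :=
  [/\ all_nonempty S,
      forall j : 'I_(sumn al), val j \in 0%N :: descents al ->
        forall a, a \in S j -> unprimed a
    & forall i j : 'I_(sumn al), j = i.+1 :> nat ->
        [/\ set_le (S i) (S j),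
            val j \in descents al -> set_lt (S i) (S j)
          & val j \notin descents al ->
              forall a, a \in S i -> a \in S j -> unprimed a]].

End Tuples.

Definition K (al : seq nat) : pseries :=
  genfun [set S | @K_tuple al S] (sumn al).

Definition Kbar (al : seq nat) : pseries :=
  genfun [set S | @Kbar_tuple al S] (sumn al).

(** * The four modules *)

Definition mGammaSym : set pseries := pspan [set l | strict_partition l] GQ.
Definition mGammabarSym : set pseries := pspan [set l | strict_partition l] GP.
Definition mPiSym : set pseries := pspan [set al | peak_composition al] K.
Definition mPibarSym : set pseries := pspan [set al | peak_composition al] Kbar.

(* Main.v *)
Require Import Defs.
From mathcomp Require Import all_boot all_order all_algebra.
From mathcomp Require Import finmap ring zify.
From mathcomp Require Import boolp classical_sets functions fsbigop.
From mathcomp Require Import monalg.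

(** Each of the four modules has an intrinsic description.  Call a quasisymmetric
series cancelling if, in any two adjacent variables x, y, its difference with
its value at x = y = 0 is divisible by x + y + beta x y, and even if the terms
with a given support are divisible by the product of the factors
2 + beta x_i.  Then the spans of the barK, K, GP and GQ are, respectively, the
cancelling series, the cancelling even series, the cancelling symmetric series,
and the cancelling even symmetric series; the theorem follows at once.

To see that a series in one of these classes is an infinite combination, look
at its terms of lowest degree: cancellation forces the lexicographically
largest exponent to be a peak composition (a strict partition in the symmetric
case), and evenness forces its coefficient to be divisible by the leading
coefficient 2^length of K or GQ.  Subtract and iterate.

Conversely, the four families are given by transfer matrices.  Filling in the
letters i', i acts on order ideals by U(x_i) with
  U(x) = h_n(x) ... h_1(x) k(x) h_1(x) ... h_n(x),   h_c(x) = 1 + x v_c,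
where v_c adds a box of content c, v_c^2 = beta v_c, and k is h_0^2 for K and GQ
and h_0 for barK and GP.  As U is a palindrome, U(y) U(x) - 1 is divisible by
x + y + beta x y, and for k = h_0^2 the diagonal case of the same argument
shows that U(x) - 1 is divisible by 2 x + beta x^2.  For shifted shapes, U(x)
and U(y) commute by the type B Yang-Baxter equation. *)

Set Implicit Arguments.
Unset Strict Implicit.
Unset Printing Implicit Defensive.

Import Order.TTheory GRing.Theory Num.Theory.

Local Open Scope classical_set_scope.

(** * Series with the cancellation property *)

Section Series.

Local Open Scope ring_scope.
Local Notation R := {poly int}.

(** The operators v_c come from reading a filling as a set of events (box, letter) ordered in time.
    When the last event is deleted, its box either keeps another letter, at the cost of a factor
    beta, or leaves the ideal; so v_c is multiplication by beta plus removal of the box of content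
    c. Boxes of equal content are comparable, so at most one of them is removable, and right after
    its removal none is: this is v_c^2 = beta v_c. For compositions the content is the position
    within a block, and the peak condition makes consecutive contents differ.

    Only finite objects are multiplied: the coefficient of x^a sees as many variables as [a] has
    entries and the ideals of one finite poset. Infinite sums are handled degree by degree, with
    quotients chosen anew for each degree bound.

    The obstacle to commutation is that the Yang-Baxter argument exchanges x and y through the
    parameter (x - y)/(1 + beta y), which is not a polynomial. All relations are cleared of
    denominators, and the resulting scalar is cancelled in the domain Z[beta][x][y]. *)

Definition beta : R := 'X.

(** Coefficients are indexed by exponent lists instead of monomials, so that adjacent variables are
    adjacent entries and each entry is one application of a transfer matrix. *)
Definition series := seq nat -> R.

Definition lexlt (a b : seq nat) : bool := ((a : seqlexi nat) < (b : seqlexi nat))%O.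

Lemma lexlt_cat s a b : lexlt (s ++ a) (s ++ b) = lexlt a b.
Proof. by elim: s => //= x s IH; rewrite /lexlt eqhead_ltxiE; exact: IH. Qed.

Lemma lexlt_head x y a b : (x < y)%N -> lexlt (x :: a) (y :: b).
Proof.
move=> xy; rewrite /lexlt neqhead_ltxiE ?ltEnat //.
by apply: contraL xy => /eqP ->; rewrite ltnn.
Qed.

Definition composition (a : seq nat) : bool := all (leq 1) a.

(** Neither composition is a proper prefix of the other, since the missing parts would be positive
    while the sums agree; so the two differ at a first position. *)
Lemma lexltP a b : composition a -> composition b -> sumn a = sumn b ->
  lexlt a b -> exists s x y t u, [/\ a = s ++ x :: t, b = s ++ y :: u & (x < y)%N].
Proof.
elim: a b => [|x a IH] [|y b] //=.
- move=> _ /andP[y0 _] /esym/eqP; rewrite addn_eq0 => /andP[/eqP y00].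
  by rewrite y00 in y0.
- move=> /andP[x0 pa] /andP[y0 pb].
  have [xy|xy|<-] := ltngtP x y.
  + by move=> _ _; exists [::], x, y, a, b.
  + by move=> _ /ltxi_lehead; rewrite leEnat leqNgt xy.
  + move=> /addnI sab; rewrite /lexlt eqhead_ltxiE => lab.
    have [s [x' [y' [t [u [-> -> xy']]]]]] := IH _ pa pb sab lab.
    by exists (x :: s), x', y', t, u.
Qed.

Lemma lexlt_irr a : lexlt a a = false.
Proof. exact: ltxx. Qed.

Lemma lexlt_asym a b : lexlt a b -> ~~ lexlt b a.
Proof. by move=> h; rewrite /lexlt -leNgt ltW. Qed.

Fixpoint words (n k : nat) : seq (seq nat) :=
  if k is k'.+1 then [seq x :: s | x <- iota 1 n, s <- words n k'] else [:: [::]].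

Definition comps (n : nat) : seq (seq nat) :=
  undup [seq a <- flatten [seq words n k | k <- iota 0 n.+1] | sumn a == n].

Lemma mem_words n k a : (a \in words n k) = [&& size a == k & all (fun x =>
  0 < x <= n)%N a].
Proof.
elim: k a => [|k IH] a; first by rewrite inE; case: a.
apply/allpairsP/idP => [[[x s] /= [xn]]|].
  by rewrite IH => /andP[/eqP <- h] -> /=; rewrite eqxx h andbT; move: xn;
    rewrite mem_iota; lia.
case: a => [|x a] //=; rewrite eqSS => /and3P[sa xn aa].
by exists (x, a); split => //=; rewrite ?IH ?sa // mem_iota; lia.
Qed.

Lemma mem_comps n a : (a \in comps n) = composition a && (sumn a == n).
Proof.
rewrite mem_undup mem_filter andbC; case: eqP => [<-|]; rewrite ?andbF // !andbT.
apply/flatten_mapP/idP => [[k _]|pa].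
  by rewrite mem_words => /andP[_]; apply: sub_all => x /andP[].
have h : (size a <= sumn a)%N.
  by elim: a pa => //= x a IH /andP[x0 /IH]; lia.
exists (size a); first by rewrite mem_iota /= add0n ltnS.
rewrite mem_words eqxx; elim: a pa {h} => //= x a IH /andP[x0 /IH h].
rewrite x0 leq_addr /=; apply: sub_all h => y /andP[-> /=]; lia.
Qed.

Lemma comps_uniq n : uniq (comps n).
Proof. exact: undup_uniq. Qed.

Definition nozero (a : seq nat) := [seq x <- a | x != 0%N].

Lemma nozero_comp a : composition (nozero a).
Proof. by apply/allP => x; rewrite mem_filter => /andP[]; case: x. Qed.

Lemma sumn_nozero a : sumn (nozero a) = sumn a.
Proof. by elim: a => //= x a IH; case: eqVneq => [->|_] /=; rewrite IH. Qed.

Definition quasisym (G : series) := forall a b, G (a ++ 0%N :: b) = G (a ++ b).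

Lemma quasisym_nozero G a : quasisym G -> G (nozero a) = G a.
Proof.
move=> qG; rewrite -[a in RHS]cat0s -[nozero a]cat0s.
elim: a [::] => //= x a IH b; case: eqVneq => [->|_] /=; first by rewrite qG IH.
by rewrite -!cat_rcons IH.
Qed.

Definition shl (h : nat -> nat -> R) p q : R := if p is p'.+1 then h p' q else 0.
Definition shr (h : nat -> nat -> R) p q : R := if q is q'.+1 then h p q' else 0.

(* In two adjacent variables x, y, the series minus its value at x = y = 0 is
   (x + y + beta x y) h: the K-theoretic cancellation property, truncated in
   degree d so that it passes to infinite sums. *)
Definition cancels (G : series) := forall d a b, exists h, forall p q,
  (0 < p + q <= d)%N ->
  G (a ++ p :: q :: b) = shl h p q + shr h p q + beta * shl (shr h) p q.

(* [ev H a] is the coefficient of x^a in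
   (\prod_i x_i (2 + beta x_i)) * \sum_b H b x^b, for a with no zero entry. *)
Fixpoint ev (H : series) (a : seq nat) : R :=
  match a with
  | [::] => H [::]
  | p :: a' => 2%:R * ev (fun b => H (p.-1 :: b)) a' +
      (if (1 < p)%N then beta * ev (fun b => H (p.-2 :: b)) a' else 0)
  end.

(** As in [cancels], the quotient may depend on the degree bound, so that the property passes to
    infinite sums. [ev H a] reads [H] only on lists as long as [a], so the quotients for supports of
    different sizes are unrelated. *)
Definition even (G : series) :=
  forall d, exists H, forall a, composition a -> (sumn a <= d)%N -> G a = ev H a.

Definition symm (G : series) := forall a b, perm_eq a b -> G a = G b.

(* The class containing GQ (e = s = true), GP (s), K (e) and barK (neither). *)
Definition peak_series (e s : bool) (G : series) :=
  [/\ quasisym G, cancels G, e -> even G & s -> symm G].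

Lemma evZD c H H' a : ev (fun b => H b + c * H' b) a = ev H a + c * ev H' a.
Proof.
elim: a H H' => //= p a IH H H'; rewrite !IH.
by case: ifP => _; ring.
Qed.

Lemma peak_seriesD e s c G G' : peak_series e s G -> peak_series e s G' ->
  peak_series e s (fun a => G a + c * G' a).
Proof.
move=> [qG cG eG sG] [qG' cG' eG' sG']; split.
- by move=> a b; rewrite qG qG'.
- move=> d a b; have [h hP] := cG d a b; have [h' hP'] := cG' d a b.
  exists (fun p q => h p q + c * h' p q) => p q pq; rewrite hP // hP' //.
  by case: p q {pq} => [|p] [|q] /=; ring.
- move=> ee d; have [h hP] := eG ee d; have [h' hP'] := eG' ee d.
  by exists (fun b => h b + c * h' b) => a pa da; rewrite evZD hP // hP'.
- by move=> ss a b ab; rewrite (sG ss _ _ ab) (sG' ss _ _ ab).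
Qed.

Lemma peak_series0 e s : peak_series e s (fun=> 0).
Proof.
split=> //.
- by move=> d a b; exists (fun _ _ => 0) => -[|p] [|q] _ /=; ring.
- move=> _ d; exists (fun=> 0) => a _ _.
  by elim: a => //= p a <-; case: ifP => _; ring.
Qed.

Lemma peak_series_sum e s (I : eqType) (r : seq I) (P : pred I) (c : I -> R) (F : I ->
  series) :
  (forall i, i \in r -> P i -> peak_series e s (F i)) ->
  peak_series e s (fun a => \sum_(i <- r | P i) c i * F i a).
Proof.
elim: r => [|i r IH] h.
  rewrite (_ : (fun a => _) = (fun=> 0)); first exact: peak_series0.
  by apply/funext => a; rewrite big_nil.
have hr : peak_series e s (fun a => \sum_(j <- r | P j) c j * F j a).
  by apply: IH => j jr; apply: h; rewrite inE jr orbT.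
have [Pi|nPi] := boolP (P i).
  rewrite (_ : (fun a => _) =
    (fun a => \sum_(j <- r | P j) c j * F j a + c i * F i a)).
    by apply: peak_seriesD => //; apply: h => //; rewrite inE eqxx.
  by apply/funext => a; rewrite big_cons Pi addrC.
rewrite (_ : (fun a => _) = (fun a => \sum_(j <- r | P j) c j * F j a)) //.
by apply/funext => a; rewrite big_cons (negPf nPi).
Qed.

(** Once the degree bound and the surrounding exponents are fixed, each condition concerns
    coefficients of bounded degree only, so it may be checked on a series that agrees with [G] up to
    that degree. *)
Lemma peak_series_local e s G :
  (forall d, exists2 G', peak_series e s G' & forall a, (sumn a <= d)%N -> G a = G' a) ->
  peak_series e s G.
Proof.
move=> loc; split.
- move=> a b; have [G' [qG' _ _ _] GG'] := loc (sumn (a ++ b)).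
  by rewrite !GG' ?qG' // !sumn_cat.
- move=> d a b; have [G' [_ cG' _ _] GG'] := loc (sumn a + d + sumn b)%N.
  have [h hP] := cG' d a b; exists h => p q pq.
  by rewrite -hP // GG' // !sumn_cat /=; lia.
- move=> ee d; have [G' [_ _ eG' _] GG'] := loc d.
  by have [h hP] := eG' ee d; exists h => a pa da; rewrite GG' // hP.
- move=> ss a b ab; have [G' [_ _ _ sG'] GG'] := loc (sumn a).
  have sab : sumn b = sumn a.
    by rewrite !sumnE; apply: perm_big; rewrite perm_sym.
  by rewrite !GG' ?sab //; apply: sG'.
Qed.

Definition vanish_below n (G : series) := forall a, (sumn a < n)%N -> G a = 0.

(** In lowest degree the factor x + y + beta x y acts as x + y, and no nonzero multiple of a
    monomial is divisible by x + y. *)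
Lemma cancel_lead (c h : nat -> nat -> R) N p0 q0 : (0 < N)%N ->
  (forall p q, (0 < p + q <= N)%N ->
     c p q = shl h p q + shr h p q + beta * shl (shr h) p q) ->
  (forall p q, (0 < p + q < N)%N -> c p q = 0) ->
  (p0 + q0 = N)%N -> (forall p q, (p + q = N)%N -> p != p0 -> c p q = 0) ->
  c p0 q0 = 0.
Proof.
case: N => // N _ ch low pqN other.
have hlow p q : (p + q < N)%N -> h p q = 0.
  elim: q p => [|q IH] p pq.
    by have := ch p.+1 0%N; rewrite low /=; [rewrite mulr0 !addr0 => <- //; lia|lia].
  have := ch p.+1 q.+1; rewrite low; last lia.
  rewrite /= (IH p.+1); last lia.
  by rewrite (IH p); last lia; rewrite mulr0 !addr0 => <- //; lia.
have top p q : (p + q = N.+1)%N -> c p q = shl h p q + shr h p q.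
  move=> pq; rewrite ch; last lia.
  case: p q pq => [|p] [|q] pq /=; rewrite ?mulr0 ?addr0 //.
  by rewrite (hlow p q) ?mulr0 ?addr0 //; lia.
(* The top part of c is (x + y) times the degree N part of h. Its vanishing coefficients make those
   of h vanish one after another, from both ends inwards, until the two neighbours of (p0, q0) are
   reached. *)
have right q : (q < q0)%N -> h (N - q)%N q = 0.
  elim: q => [|q IH] qq.
    have := top N.+1 0%N; rewrite addn0 other ?addn0 //; last by apply/eqP; lia.
    by move=> /(_ erefl) /=; rewrite addr0 subn0.
  have := top (N - q)%N q.+1; rewrite other; try lia.
  rewrite (_ : (N - q = (N - q.+1).+1)%N) /=; last lia.
  rewrite (_ : (N - q.+1).+1 = (N - q)%N); last lia.
  rewrite IH; last lia.
  by rewrite addr0 => <- //; lia.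
have left p : (p < p0)%N -> h p (N - p)%N = 0.
  elim: p => [|p IH] pp.
    have := top 0%N N.+1; rewrite add0n other //; last by apply/eqP; lia.
    by move=> /(_ erefl) /=; rewrite add0r subn0.
  have := top p.+1 (N - p)%N; rewrite other; try lia.
  rewrite (_ : (N - p = (N - p.+1).+1)%N) /=; last lia.
  rewrite (_ : (N - p.+1).+1 = (N - p)%N); last lia.
  rewrite IH; last lia.
  by rewrite add0r => <- //; lia.
rewrite top //; case: p0 q0 pqN left right {other} => [|p0] [|q0] //= pqN left right.
- by rewrite add0r; have := right q0 (ltnSn _); rewrite (_ : (N - q0)%N = 0%N) //; lia.
- by rewrite addr0; have := left p0 (ltnSn _); rewrite (_ : (N - p0)%N = 0%N) //; lia.
- have := right q0 (ltnSn _); rewrite (_ : (N - q0)%N = p0.+1); last lia.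
  have := left p0 (ltnSn _); rewrite (_ : (N - p0)%N = q0.+1); last lia.
  by move=> -> ->; rewrite addr0.
Qed.

(** Each choice of beta x_i^2 instead of 2 x_i reads [H] in a smaller degree, where it vanishes;
    only the product of the terms 2 x_i survives. *)
Lemma ev_lead H b : (forall b', size b' = size b -> (sumn b' < sumn b)%N -> H b' = 0) ->
  ev H (map S b) = 2%:R ^+ size b * H b.
Proof.
elim: b H => [|p b IH] H low /=; first by rewrite mul1r.
rewrite (IH (fun b => H (p :: b))); last first.
  by move=> b' sb' lb'; apply: low; rewrite /= ?sb' // ltn_add2l.
case: p low => [|p] low /=; rewrite ?addr0 ?exprS ?mulrA //.
rewrite (IH (fun b => H (p :: b))); last first.
  by move=> b' sb' lb'; apply: low; rewrite /= ?sb' //; lia.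
by rewrite (low (p :: b)) ?mulr0 ?addr0 //=; lia.
Qed.

(** The quotient vanishes below its expected lowest degree: by induction its coefficients there are
    killed by a power of 2, a nonzerodivisor in Z[beta]. Then [ev_lead] applies at [a] with every
    entry lowered by one. *)
Lemma even_lead G a : even G -> vanish_below (sumn a) G -> composition a ->
  exists c, G a = c * 2%:R ^+ size a.
Proof.
move=> eG low pa; have [H HP] := eG (sumn a).
have pred_succ b : composition b -> map S (map predn b) = b.
  by elim: b => //= x b IH /andP[x0 /IH ->]; rewrite prednK.
have compS b : composition (map S b) by elim: b.
have sumS b : sumn (map S b) = (sumn b + size b)%N by elim: b => //= x b ->; lia.
have Hlow b : size b = size a -> (sumn b + size b < sumn a)%N -> H b = 0.
  have [m] := ubnP (sumn b); elim: m b => // m IH b bm sb lb.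
  have := HP (map S b) (compS _); rewrite sumS low; last by rewrite sumS.
  move=> /(_ (ltnW lb)); rewrite ev_lead => [|b' sb' lb']; last first.
    by apply: IH; rewrite ?sb' ?sb //; lia.
  move/esym/eqP; rewrite mulf_eq0 expf_eq0 => /orP[/andP[_ h]|/eqP //].
  by move: h; rewrite -polyC_natr polyC_eq0.
exists (H (map predn a)); rewrite HP // -{1}(pred_succ a pa) ev_lead ?size_map 1?mulrC //.
move=> b' sb' lb'; apply: Hlow; rewrite ?sb' //.
have := sumS (map predn a); rewrite pred_succ // size_map; lia.
Qed.

Definition lexmax n (G : series) g :=
  forall a, composition a -> sumn a = n -> lexlt g a -> G a = 0.

Lemma lexmax_seq n G g a : quasisym G -> lexmax n G g -> sumn a = n ->
  lexlt g (nozero a) -> G a = 0.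
Proof.
by move=> qG gm an ga; rewrite -(quasisym_nozero a qG) gm ?nozero_comp ?sumn_nozero.
Qed.

Lemma nozero_cat a b : nozero (a ++ b) = nozero a ++ nozero b.
Proof. exact: filter_cat. Qed.

Lemma nozero_id a : composition a -> nozero a = a.
Proof. by move=> pa; apply/all_filterP; apply: sub_all pa; case. Qed.

(* The coefficients of x^p y^q other than (x, y) in total degree x + y all
   vanish, so the cancellation property kills the remaining one. *)
Lemma adjacent_zero n G a x y t :
  quasisym G -> cancels G -> vanish_below n G ->
  sumn (a ++ x :: y :: t) = n -> (0 < x + y)%N ->
  (forall p q, (p + q = x + y)%N -> p != x -> G (a ++ p :: q :: t) = 0) ->
  G (a ++ x :: y :: t) = 0.
Proof.
move=> qG cG low an xy other; have [h hP] := cG (x + y)%N a t.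
apply: (cancel_lead (c := fun p q => G (a ++ p :: q :: t)) xy hP) => //.
move=> p q pq; apply: low; rewrite -an !sumn_cat /=; lia.
Qed.

(** Shifting weight to the left one of two adjacent variables enlarges the exponent
    lexicographically, even when the right entry becomes 0 and is erased. *)
Lemma lead_pair_zero n G a x y t :
  quasisym G -> vanish_below n G -> lexmax n G (a ++ x :: y :: t) ->
  composition (a ++ x :: y :: t) -> sumn (a ++ x :: y :: t) = n ->
  forall p q, (p + q = x + y)%N -> (x < p)%N -> G (a ++ p :: q :: t) = 0.
Proof.
move=> qG low gm; rewrite /composition all_cat /= => /and4P[pa x0 y0 pt] an p q pq xp.
apply: (lexmax_seq (a := a ++ p :: q :: t) qG gm).
  by move: an; rewrite !sumn_cat /=; lia.
rewrite nozero_cat (nozero_id pa) lexlt_cat /= -lt0n (leq_ltn_trans _ xp) //.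
exact: lexlt_head.
Qed.

(** Suppose a part 1 is followed by y. Of the other exponents (p, q) with the same sum, those with p
    > 1 are too large, and (0, y + 1) has the same coefficient as (y + 1, 0) by quasisymmetry, which
    is too large as well. Only one coefficient is left, and [adjacent_zero] kills it. *)
Lemma lead_peak n e s G g : peak_series e s G -> vanish_below n G -> composition g ->
  sumn g = n -> lexmax n G g -> G g != 0 -> peak_composition g.
Proof.
move=> [qG cG _ _] low pg gn gm gn0; split=> // i ig.
rewrite leqNgt; apply/negP => g1; move/negP: gn0; apply; apply/eqP.
have gE : g = take i g ++ nth 0%N g i :: nth 0%N g i.+1 :: drop i.+2 g.
  by rewrite -!drop_nth ?cat_take_drop // ltnW.
move: (nth 0%N g i) g1 (nth 0%N g i.+1) (take i g) (drop i.+2 g) gE => x x1 y a t gE.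
rewrite {}gE {i ig g} in gn gm pg *.
have [x0 y0] : (0 < x /\ 0 < y)%N.
  by move: pg; rewrite /composition all_cat /= => /and4P[].
have {x0}x1 : x = 1%N by lia.
rewrite {}x1 in gn gm pg *.
have big := lead_pair_zero qG low gm pg gn.
apply: (adjacent_zero qG cG low gn) => // p q pq p1.
case: p pq p1 => [|[|p]] // pq _; last exact: big.
by rewrite qG -cat_rcons -(qG (rcons a q)) cat_rcons big //; lia.
Qed.

(** If a part x is followed by a larger y, swapping the two gives a larger exponent with the same
    coefficient. If y = x, every other pair with the same sum has an entry above x, which can be
    swapped to the front, so only the coefficient at (x, x) is left. *)
Lemma lead_strict n e G g : peak_series e true G -> vanish_below n G -> composition g ->
  sumn g = n -> lexmax n G g -> G g != 0 -> strict_partition g.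
Proof.
move=> [qG cG _ /(_ isT) sG] low pg gn gm gn0; split=> //.
apply/(sortedP 0%N) => i ig; rewrite /gtn /= ltnNge; apply/negP => xy.
move/negP: gn0; apply; apply/eqP.
have gE : g = take i g ++ nth 0%N g i :: nth 0%N g i.+1 :: drop i.+2 g.
  by rewrite -!drop_nth ?cat_take_drop // ltnW.
move: (nth 0%N g i) (nth 0%N g i.+1) xy (take i g) (drop i.+2 g) gE => x y xy a t gE.
rewrite {}gE {i ig g} in gn gm pg *.
have [x0 y0] : (0 < x /\ 0 < y)%N.
  by move: pg; rewrite /composition all_cat /= => /and4P[].
have big := lead_pair_zero qG low gm pg gn.
have swap p q : G (a ++ p :: q :: t) = G (a ++ q :: p :: t).
  by apply: sG; rewrite perm_cat2l; apply/permP => P /=; lia.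
move: xy; rewrite leq_eqVlt => /orP[/eqP xy|xy]; last by rewrite swap big // addnC.
apply: (adjacent_zero qG cG low gn) => [|p q pq px]; first lia.
have [xp|xp] := ltnP x p; first exact: big.
by rewrite swap big //; move: px xp => /eqP; lia.
Qed.

End Series.

(** * Expansion by successive subtraction of leading terms *)

Section Triangularity.

Local Open Scope ring_scope.
Local Notation R := {poly int}.

Variables (e s : bool) (D : seq nat -> Prop) (Fm : seq nat -> series).

Let lc (a : seq nat) : R := if e then 2%:R ^+ size a else 1.

Hypothesis Fm_peak_series : forall al, D al -> peak_series e s (Fm al).
Hypothesis Fm_low : forall al, D al -> vanish_below (sumn al) (Fm al).
Hypothesis Fm_lead : forall al, D al -> Fm al al = lc al.
Hypothesis Fm_lexmax : forall al, D al -> lexmax (sumn al) (Fm al) al.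
Hypothesis lead_D : forall n G g, peak_series e s G -> vanish_below n G -> composition g ->
  sumn g = n -> lexmax n G g -> G g != 0 -> D g.

(** [L] holds, in decreasing order, the exponents of degree n still to be cleared. Its head is a
    [lexmax] exponent of [G], so [lead_D] and [even_lead] make its coefficient a multiple of the
    leading one; subtracting leaves the larger, already cleared exponents alone. *)
Lemma peel_list n (L : seq (seq nat)) (G : series) :
  peak_series e s G -> vanish_below n G ->
  {subset L <= comps n} -> pairwise (fun a b => lexlt b a) L ->
  (forall a, a \in comps n -> a \notin L -> G a = 0 /\ forall b, b \in L -> lexlt b a) ->
  exists c : seq nat -> R,
    let G' := fun a => G a - \sum_(al <- L | `[< D al >]) c al * Fm al a in
    peak_series e s G' /\ vanish_below n.+1 G'.
Proof.
elim: L G => [|g L IH] G GV low sub pw out.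
  exists (fun=> 0); rewrite (_ : (fun a => _) = G); last first.
    by apply/funext => a; rewrite big_nil subr0.
  split=> // a; rewrite ltnS leq_eqVlt => /orP[/eqP an|/low //].
  have qG : quasisym G by case: GV.
  rewrite -(quasisym_nozero a qG); apply: (proj1 (out _ _ _)) => //.
  by rewrite mem_comps nozero_comp sumn_nozero an eqxx.
have gc : g \in comps n by apply: sub; rewrite inE eqxx.
move: (gc); rewrite mem_comps => /andP[pg /eqP gn].
move: pw; rewrite /= => /andP[/allP gL pw].
have gNL : g \notin L by apply/negP => /gL; rewrite lexlt_irr.
have Gmax : lexmax n G g.
  move=> a pa an ga; have ac : a \in comps n by rewrite mem_comps pa an eqxx.
  have aN : a \notin g :: L.
    rewrite inE negb_or; apply/andP; split.
      by apply: contraL ga => /eqP ->; rewrite lexlt_irr.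
    by apply/negP => /gL; apply/negP/lexlt_asym.
  by have [] := out a ac aN.
have [c0 [c0D c0N]] : exists c0, (D g -> G g = c0 * lc g) /\ (~ D g -> G g = 0).
  have [Gg0|Gg0] := eqVneq (G g) 0; first by exists 0; rewrite Gg0 mul0r.
  have Dg : D g by apply: (lead_D GV low pg gn Gmax Gg0).
  rewrite /lc; case: (boolP e) => [ee|_]; last by exists (G g); rewrite mulr1.
  have [_ _ /(_ ee) eG _] := GV.
  by have [|c cP] := even_lead eG _ pg; [rewrite gn|exists c].
(* A head outside [D] has coefficient 0 already, so nothing is subtracted for it. *)
pose d0 := if `[< D g >] then c0 else 0.
pose G1 : series := fun a => G a + (- d0) * Fm g a.
have G1E a : G1 a = if `[< D g >] then G a - c0 * Fm g a else G a.
  by rewrite /G1 /d0; case: ifP => _; rewrite mulNr // mul0r oppr0 addr0.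
have [|||a ac aN|c [cV cl]] := IH G1 _ _ _ pw.
- have [Dg|nDg] := boolP `[< D g >].
    by apply: peak_seriesD => //; apply: Fm_peak_series; apply/asboolP.
  by rewrite (_ : G1 = G) //; apply/funext => a; rewrite G1E (negPf nDg).
- move=> a an; rewrite G1E low //; case: asboolP => // Dg.
  by rewrite (Fm_low Dg) ?gn // mulr0 subr0.
- by move=> a aL; apply: sub; rewrite inE aL orbT.
- have [->|ag] := eqVneq a g.
    split; last by move=> b /gL.
    rewrite G1E; case: asboolP => [Dg|nDg]; last exact: c0N.
    by rewrite Fm_lead // c0D ?subrr.
  have aN' : a \notin g :: L by rewrite inE negb_or ag.
  have [Ga ab] := out a ac aN'; split; last by move=> b bL; apply: ab; rewrite inE bL orbT.
  rewrite G1E Ga; case: asboolP => // Dg.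
  move: ac; rewrite mem_comps => /andP[pa /eqP an].
  by rewrite (Fm_lexmax Dg) ?an ?gn ?mulr0 ?subr0 // ab // inE eqxx.
exists (fun al => if al == g then c0 else c al).
rewrite (_ : (fun a => _) =
  (fun a => G1 a - \sum_(al <- L | `[< D al >]) c al * Fm al a)) //.
apply/funext => a; rewrite big_cons eqxx.
have -> : \sum_(j <- L | `[< D j >]) (if j == g then c0 else c j) * Fm j a =
   \sum_(j <- L | `[< D j >]) c j * Fm j a.
  rewrite big_seq_cond [RHS]big_seq_cond; apply: eq_bigr => j /andP[jL _].
  by rewrite (negPf (_ : j != g)) //; apply: contraNneq gNL => <-.
by rewrite G1E; case: ifP => // _; ring.
Qed.

Lemma peel_degree n (G : series) : peak_series e s G -> vanish_below n G ->
  exists c : seq nat -> R,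
    let G' := fun a => G a - \sum_(al <- comps n | `[< D al >]) c al * Fm al a in
    peak_series e s G' /\ vanish_below n.+1 G'.
Proof.
move=> GV low; pose ge_lex (a b : seq nat) := ((b : seqlexi nat) <= (a : seqlexi nat))%O.
have geT : total ge_lex by move=> a b; apply: le_total.
have ge_tr : transitive ge_lex by move=> a b c ba cb; apply: le_trans ba.
have [|||c cP] := @peel_list n (sort ge_lex (comps n)) G GV low.
- by move=> a; rewrite mem_sort.
- have : pairwise ge_lex (sort ge_lex (comps n)).
    by rewrite -sorted_pairwise //; apply: sort_sorted.
  have : uniq (sort ge_lex (comps n)) by rewrite sort_uniq comps_uniq.
  rewrite uniq_pairwise => h1 h2.
  have := conj h1 h2 => /andP; rewrite -pairwise_relI.
  apply: sub_pairwise => a b /= /andP[ab ba].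
  by rewrite /lexlt lt_def ab.
- by move=> a ac; rewrite mem_sort ac.
exists c; move: cP => /=.
rewrite (_ : (fun a => _ - \sum_(al <- sort _ _ | _) _) = (fun a =>
  G a - \sum_(al <- comps n | `[< D al >]) c al * Fm al a)) //.
apply/funext => a; congr (_ - _); apply: perm_big.
by rewrite perm_sort.
Qed.

(** The coefficients used in one degree are chosen as a function of the degree and the current
    remainder, so the remainders can be defined by recursion. After degree [sumn a] is cleared, the
    remainder vanishes at [a], which is why the sum stops there. *)
Lemma peel (G : series) : peak_series e s G ->
  exists c : seq nat -> R, forall a,
    G a = \sum_(0 <= m < (sumn a).+1) \sum_(al <- comps m | `[< D al >]) c al * Fm al a.
Proof.
move=> GV.
have /choice[cc ccP] : forall p : nat * series, exists c : seq nat -> R,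
    peak_series e s p.2 -> vanish_below p.1 p.2 ->
    let G' := fun a => p.2 a - \sum_(al <- comps p.1 | `[< D al >]) c al * Fm al a in
    peak_series e s G' /\ vanish_below p.1.+1 G'.
  move=> [n H] /=; have [HV|] := pselect (peak_series e s H); last by exists (fun=> 0).
  have [Hl|] := pselect (vanish_below n H); last by exists (fun=> 0).
  by have [c cP] := peel_degree HV Hl; exists c.
pose Gs := fix Gs n : series := if n is m.+1 then
  fun a => Gs m a - \sum_(al <- comps m | `[< D al >]) cc (m, Gs m) al * Fm al a
  else G.
have GsP n : peak_series e s (Gs n) /\ vanish_below n (Gs n).
  by elim: n => [|n [IH1 IH2]]; [split|exact: (ccP (n, Gs n))].
pose c al := cc (sumn al, Gs (sumn al)) al.
have GsE n a : Gs n a =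
    G a - \sum_(0 <= m < n) \sum_(al <- comps m | `[< D al >]) c al * Fm al a.
  elim: n => [|n IH]; first by rewrite big_nil subr0.
  rewrite big_nat_recr //= IH opprD addrA; congr (_ - _).
  rewrite big_seq_cond [RHS]big_seq_cond; apply: eq_bigr => al /andP[].
  by rewrite mem_comps => /andP[_ /eqP <-].
exists c => a; apply/eqP; rewrite -subr_eq0 -GsE; apply/eqP.
by have [_] := GsP (sumn a).+1; apply.
Qed.

End Triangularity.

(** * Coefficients of power series *)

Section Coefficients.

Local Open Scope ring_scope.
Local Notation R := {poly int}.

Definition mon (a : seq nat) : {cmonom nat} :=
  mkcmonom [fsfun i in seq_fset tt (iota 0 (size a)) => nth 0%N a i | 0%N].

Lemma monE a i : mon a i = nth 0%N a i.
Proof.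
rewrite cmE fsfunE seq_fsetE mem_iota add0n /=.
by case: ltnP => // ai; rewrite nth_default.
Qed.

Lemma mon_eq a b : (forall i, nth 0%N a i = nth 0%N b i) -> mon a = mon b.
Proof. by move=> ab; apply/eqP/cmP => i; rewrite !monE ab. Qed.

Definition bounded_supp (m : {cmonom nat}) n := forall i, (n <= i)%N -> m i = 0%N.

Lemma bounded_suppP (m : {cmonom nat}) : exists n, bounded_supp m n.
Proof.
exists (\max_(i <- finsupp m) i.+1) => i im.
apply/eqP; rewrite cmE_eq0; apply/negP => im0.
have := @leq_bigmax_seq _ (enum_fset (finsupp m)) xpredT S i im0 isT.
by rewrite leqNgt ltnS im.
Qed.

Lemma mon_mkseq (m : {cmonom nat}) n : bounded_supp m n -> mon (mkseq m n) = m.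
Proof.
move=> mn; apply/eqP/cmP => i; rewrite monE.
have [ni|ni] := ltnP i n; first by rewrite nth_mkseq.
by rewrite nth_default ?size_mkseq // mn.
Qed.

Lemma mon_surj (m : {cmonom nat}) : exists a, mon a = m.
Proof. by have [n mn] := bounded_suppP m; exists (mkseq m n); apply: mon_mkseq. Qed.

Definition hat (f : pseries) : series := fun a => f (mon a).

Lemma hat_inj f g : (forall a, hat f a = hat g a) -> f = g.
Proof. by move=> fg; apply/funext => m; have [a <-] := mon_surj m; apply: (fg a). Qed.

(** A bijection may move infinitely many indices, but a monomial has finite support; on a long
    enough initial segment the exponent list of one monomial is a permutation of that of the other,
    padded with zeros. Conversely a permutation of a list extends by the identity. *)
Lemma mSymP f : mSym f <-> symm (hat f).
Proof.
split=> [sf a b ab | sf s [s' sK s'K] m m' mm'].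
  have /(perm_iotaP 0%N)[Is pI aE] := ab.
  have sI : size Is = size b by rewrite (perm_size pI) size_iota.
  have uI : uniq Is by rewrite (perm_uniq pI) iota_uniq.
  have mI j : (j \in Is) = (j < size b)%N by rewrite (perm_mem pI) mem_iota.
  pose s i := if (i < size b)%N then nth 0%N Is i else i.
  pose s' i := if (i < size b)%N then index i Is else i.
  have sP i : (s i < size b)%N = (i < size b)%N.
    by rewrite /s; case: ifP => // ib; rewrite -mI mem_nth ?sI.
  have s'P i : (s' i < size b)%N = (i < size b)%N.
    by rewrite /s'; case: ifP => // ib; rewrite -sI index_mem mI.
  apply/esym/(sf s).
    exists s' => i.
      by rewrite /s' sP /s; case: (ltnP i (size b)) => // ib; rewrite index_uniq ?sI.
    by rewrite /s s'P /s'; case: (ltnP i (size b)) => // ib; rewrite nth_index // mI.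
  move=> i; rewrite !monE aE /s; case: ifP => ib.
    by rewrite (nth_map 0%N) ?sI.
  by rewrite !nth_default // ?size_map ?sI leqNgt ib.
have [n mn] := bounded_suppP m; have [n' mn'] := bounded_suppP m'.
(* Large enough for the support of [m'] and for the images under [s] of the indices below [n]. *)
pose N := maxn n' (\max_(i < n) (s i).+1).
have sN i : (i < n)%N -> (s i < N)%N.
  move=> ni; rewrite leq_max; apply/orP; right.
  by apply: (@leq_bigmax _ (fun i : 'I_n => (s i).+1) (Ordinal ni)).
pose rest := [seq j <- iota 0 N | j \notin map s (iota 0 n)].
have pN : perm_eq (iota 0 N) (map s (iota 0 n) ++ rest).
  apply: uniq_perm; rewrite ?iota_uniq //.
    rewrite cat_uniq map_inj_uniq ?iota_uniq ?filter_uniq ?iota_uniq ?andbT //=.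
      by rewrite -all_predC; apply/allP => j; rewrite mem_filter => /andP[].
    exact: can_inj sK.
  move=> j; rewrite mem_cat mem_filter mem_iota /= add0n.
  case: (boolP (j \in _)) => //= /mapP[i]; rewrite mem_iota /= add0n => ni ->.
  by rewrite sN.
(* An index outside the image of the first [n] ones comes from an index beyond the support of
   [m]. *)
have restE : map m' rest = nseq (size rest) 0%N.
  rewrite -[X in nseq X](size_map m'); apply/all_pred1P/allP => x /mapP[j];
    rewrite mem_filter => /andP[jN _] ->.
  apply/eqP; rewrite -(s'K j) mm' mn // leqNgt; apply/negP => jn.
  move/negP: jN; apply; apply/mapP; exists (s' j); rewrite ?s'K //.
  by rewrite mem_iota.
have -> : m' = mon (mkseq m' N).
  by rewrite mon_mkseq // => i iN; apply: mn'; apply: leq_trans iN; apply: leq_maxl.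
have -> : m = mon (map m (iota 0 n) ++ nseq (size rest) 0%N).
  rewrite -[LHS](mon_mkseq mn); apply: mon_eq => i; rewrite nth_cat size_mkseq.
  case: ifP => // /negbT; rewrite -leqNgt => ni; rewrite nth_default ?size_mkseq //.
  by rewrite nth_nseq if_same.
apply: sf; rewrite -restE (_ : map m _ = map m' (map s (iota 0 n))).
  by rewrite -map_cat; apply: perm_map.
by rewrite -map_comp; apply: eq_map => i /=; rewrite mm'.
Qed.

Section Span.

Variables (e s : bool) (D : seq nat -> Prop) (F : seq nat -> pseries).

Hypothesis D_comp : forall al, D al -> composition al.
Hypothesis F_peak_series : forall al, D al -> peak_series e s (hat (F al)).
Hypothesis F_low : forall al, D al -> vanish_below (sumn al) (hat (F al)).

(** Members of degree above d vanish at [a], so the coefficientwise sum has finite support and never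
    falls back on its default value 0. *)
Lemma hat_psum c d a : (sumn a <= d)%N ->
  hat (psum [set al | D al] (fun al m => c al * F al m)) a =
  \sum_(0 <= m < d.+1) \sum_(al <- comps m | `[< D al >]) c al * hat (F al) a.
Proof.
move=> ad; pose r := [seq al <- flatten [seq comps m | m <- iota 0 d.+1] | `[< D al >]].
have mem_r al : (al \in r) = `[< D al >] && (sumn al <= d)%N.
  rewrite mem_filter; case: asboolP => // Dal; rewrite andTb.
  apply/flatten_mapP/idP => [[m]|ald].
    by rewrite mem_iota mem_comps => md /andP[_ /eqP ->]; move: md => /=; lia.
  exists (sumn al); first by rewrite mem_iota; lia.
  by rewrite mem_comps eqxx andbT; apply: D_comp.
have ur : uniq r.
  apply: filter_uniq.
  elim: (iota _ _) (iota_uniq 0 d.+1) => //= m ms IH /andP[mms /IH uf].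
  rewrite cat_uniq comps_uniq uf andbT; apply/hasPn => al /flatten_mapP[m' m'ms].
  rewrite !mem_comps => /andP[_ /eqP am']; rewrite am' negb_and; apply/orP; right.
  by apply: contraNneq mms => <-.
rewrite /hat /psum (@fsbigE _ _ _ _ _ r) //.
- rewrite (eq_bigl (fun al => `[< D al >])) => [|al]; last by [].
  rewrite /r -big_filter filter_id big_filter big_flatten big_map.
  by rewrite /index_iota subn0.
- by move=> al /=; rewrite mem_r => /andP[/asboolP].
- move=> al Dal; rewrite mem_r asboolT //= -ltnNge => dal.
  by rewrite [F al _](F_low Dal) ?mulr0 //; apply: leq_ltn_trans dal.
Qed.

Lemma pspan_peak_series f : pspan [set al | D al] F f -> peak_series e s (hat f).
Proof.
move=> [c ->]; apply: peak_series_local => d.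
exists (fun a => \sum_(m <- iota 0 d.+1 | true) 1 *
  \sum_(al <- comps m | `[< D al >]) c al * hat (F al) a).
  apply: (@peak_series_sum e s _ (iota 0 d.+1) xpredT (fun=> 1) (fun m a =>
    \sum_(al <- comps m | `[< D al >]) c al * hat (F al) a)) => m _ _.
  by apply: peak_series_sum => al _ /asboolP; apply: F_peak_series.
move=> a ad; rewrite (hat_psum c ad) /index_iota subn0.
by apply: eq_bigr => m _; rewrite mul1r.
Qed.

Hypothesis F_lead : forall al, D al ->
  hat (F al) al = if e then 2%:R ^+ size al else 1.
Hypothesis F_lexmax : forall al, D al -> lexmax (sumn al) (hat (F al)) al.
Hypothesis lead_D : forall n G g, peak_series e s G -> vanish_below n G -> composition g ->
  sumn g = n -> lexmax n G g -> G g != 0 -> D g.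

Lemma pspanP f : pspan [set al | D al] F f <-> peak_series e s (hat f).
Proof.
split; first exact: pspan_peak_series.
move=> fV; have [c cP] := peel F_peak_series F_low F_lead F_lexmax lead_D fV.
exists c; apply: hat_inj => a; rewrite cP.
by rewrite (hat_psum c (leqnn (sumn a))).
Qed.

End Span.

End Coefficients.

(** * Transfer matrices *)

Section Factors.

Local Open Scope ring_scope.

Variables (S : comNzRingType) (n : nat) (b : S).
Local Notation A := 'M[S]_n.
Implicit Types (g : seq A) (v Z : A) (x y : S).

Definition hfac x v : A := 1%:M + x *: v.

(* The head of [g] acts first, on column vectors. *)
Fixpoint prodh g x : A := if g is v :: g' then prodh g' x *m hfac x v else 1%:M.

Lemma prodh_cat g g' x : prodh (g ++ g') x = prodh g' x *m prodh g x.
Proof. by elim: g => [|v g IH] /=; rewrite ?mulmx1 // IH mulmxA. Qed.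

Lemma prodh_rcons g v x : prodh (rcons g v) x = hfac x v *m prodh g x.
Proof. by rewrite -cats1 prodh_cat /= mul1mx. Qed.

Definition idem v := v *m v = b *: v.

Lemma hfacM x y v : idem v -> hfac x v *m hfac y v = hfac (x + y + b * x * y) v.
Proof.
move=> vv; rewrite /hfac mulmxDl mul1mx !mulmxDr mulmx1 -scalemxAl -scalemxAr vv !scalerA.
rewrite -addrA; congr (_ + _); rewrite -!scalerDl; congr (_ *: _); ring.
Qed.

(** Put s = x + y + b x y. The two innermost factors multiply to 1 + s v, so modulo s the product
    collapses from the middle outwards. The arbitrary [Z] is the quotient accumulated so far, which
    the induction needs. *)
Lemma prodh_cancel g x y Z : (forall v, v \in g -> idem v) ->
  exists Z', prodh g y *m (1%:M + (x + y + b * x * y) *: Z) *m prodh (rev g) x =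
    1%:M + (x + y + b * x * y) *: Z'.
Proof.
elim: g Z => [|v g IH] Z gid; first by exists Z; rewrite mul1mx mulmx1.
have vv : idem v by apply: gid; rewrite inE eqxx.
have [Z' Z'P] := IH (v + hfac y v *m Z *m hfac x v)
  (fun w wg => gid w (mem_behead (s := v :: g) wg)).
exists Z'; rewrite -Z'P rev_cons prodh_rcons /= !mulmxA; congr (_ *m _).
rewrite -!mulmxA; congr (_ *m _).
rewrite mulmxA mulmxDr mulmx1 mulmxDl hfacM // -scalemxAr -scalemxAl mulmxA.
rewrite {1}/hfac scalerDr addrA; congr (_ + _).
by rewrite (_ : y + x + b * y * x = x + y + b * x * y) //; ring.
Qed.

End Factors.

(** * Coefficients of products of transfer factors *)

Section Extract.

Local Open Scope ring_scope.

Variables (R : comNzRingType) (n : nat).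
Local Notation A := 'M[R]_n.
Local Notation S := {poly {poly R}}.
Local Notation B := 'M[S]_n.

(** The coefficient of x^k in [prodh g x], kept as a matrix over the base ring. *)
Fixpoint Uc (g : seq A) k : A :=
  if g is v :: g' then Uc g' k + (if k is k'.+1 then Uc g' k' *m v else 0)
  else if k is 0%N then 1%:M else 0.

Definition iota2 : A -> B := map_mx (fun c : R => (c%:P)%:P).
(** Two variables: x is the inner polynomial variable and y the outer one, so [cf] takes the
    y-coefficient first. *)
Definition px : S := 'X%:P.
Definition py : S := 'X.
Definition cf p q (M : B) : A := map_mx (fun e : S => e`_q`_p) M.

Lemma cfD p q M N : cf p q (M + N) = cf p q M + cf p q N.
Proof. by apply/matrixP => i j; rewrite !mxE !coefD. Qed.

Lemma cf1 p q : cf p q 1%:M = if (p == 0%N) && (q == 0%N) then 1%:M else 0.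
Proof.
apply/matrixP => i j; rewrite !mxE.
case: eqP => ij; rewrite ?mulr0n ?mulr1n ?coef0 ?coef0 ?coef1 /=.
  by case: q => [|q]; rewrite ?coef0 ?coef1 ?andbT ?andbF ?mxE //; case: p => [|p];
    rewrite ?mxE ?eqxx ?ij ?eqxx.
by case: ifP => _; rewrite !mxE // (introF eqP ij).
Qed.

Lemma cfX p q M : cf p q (px *: M) = if p is p'.+1 then cf p' q M else 0.
Proof.
apply/matrixP => i j; rewrite !mxE coefCM coefXM.
by case: p => [|p]; rewrite !mxE.
Qed.

Lemma cfY p q M : cf p q (py *: M) = if q is q'.+1 then cf p q' M else 0.
Proof.
apply/matrixP => i j; rewrite !mxE coefXM.
by case: q => [|q]; rewrite !mxE // coef0.
Qed.

Lemma cfZ p q c M : cf p q ((c%:P)%:P *: M) = c *: cf p q M.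
Proof. by apply/matrixP => i j; rewrite !mxE !coefCM. Qed.

Lemma cfMr p q M v : cf p q (M *m iota2 v) = cf p q M *m v.
Proof.
apply/matrixP => i j; rewrite !mxE !coef_sum.
by apply: eq_bigr => k _; rewrite !mxE !coefMC.
Qed.

Lemma cf_prodx M Mq g p q :
  (forall p' q', cf p' q' M = if p' is 0%N then Mq q' else 0) ->
  cf p q (M *m prodh (map iota2 g) px) = Mq q *m Uc g p.
Proof.
move=> MM; elim: g p => [|v g IH] p /=.
  by rewrite mulmx1 MM; case: p => [|p]; rewrite ?mulmx1 ?mulmx0.
rewrite mulmxA mulmxDr mulmx1 cfD IH -scalemxAr cfX mulmxDr; congr (_ + _).
by case: p => [|p]; rewrite ?mulmx0 // cfMr IH mulmxA.
Qed.

Lemma cf_prody M Mp g p q :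
  (forall p' q', cf p' q' M = if q' is 0%N then Mp p' else 0) ->
  cf p q (M *m prodh (map iota2 g) py) = Mp p *m Uc g q.
Proof.
move=> MM; elim: g q => [|v g IH] q /=.
  by rewrite mulmx1 MM; case: q => [|q]; rewrite ?mulmx1 ?mulmx0.
rewrite mulmxA mulmxDr mulmx1 cfD IH -scalemxAr cfY mulmxDr; congr (_ + _).
by case: q => [|q]; rewrite ?mulmx0 // cfMr IH mulmxA.
Qed.

Lemma cf_prodx1 g p q : cf p q (prodh (map iota2 g) px) = if q is 0%N then Uc g p else 0.
Proof.
rewrite -[prodh _ _]mul1mx (@cf_prodx _ (fun q => if q is 0%N then 1%:M else 0)).
  by case: q => [|q]; rewrite ?mul1mx ?mul0mx.
by move=> p' q'; rewrite cf1; case: p'; case: q'.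
Qed.

Lemma cf_prody1 g p q : cf p q (prodh (map iota2 g) py) = if p is 0%N then Uc g q else 0.
Proof.
rewrite -[prodh _ _]mul1mx (@cf_prody _ (fun q => if q is 0%N then 1%:M else 0)).
  by case: p => [|p]; rewrite ?mul1mx ?mul0mx.
by move=> p' q'; rewrite cf1; case: p'; case: q'.
Qed.

Lemma cf_xy g g' p q :
  cf p q (prodh (map iota2 g) py *m prodh (map iota2 g') px) = Uc g q *m Uc g' p.
Proof. exact/(cf_prodx (Mq := Uc g))/cf_prody1. Qed.

Lemma cf_yx g g' p q :
  cf p q (prodh (map iota2 g) px *m prodh (map iota2 g') py) = Uc g p *m Uc g' q.
Proof. exact/(cf_prody (Mp := Uc g))/cf_prodx1. Qed.

Lemma Uc0 g : Uc g 0 = 1%:M.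
Proof. by elim: g => //= v g ->; rewrite addr0. Qed.

Lemma Uc_rcons g v k :
  Uc (rcons g v) k = Uc g k + (if k is k'.+1 then v *m Uc g k' else 0).
Proof.
elim: g k => [|w g IH] [|k] /=; rewrite ?addr0 // ?IH ?addr0 //.
  by case: k => [|k]; rewrite ?mul1mx ?mulmx1 ?mul0mx ?mulmx0.
rewrite mulmxDl mulmxDr !addrA; congr (_ + _).
  by rewrite addrAC.
by case: k => [|k]; rewrite ?mulmx0 ?mul0mx // mulmxA.
Qed.

Lemma Uc_zero g g' k : Uc (g ++ 0 :: g') k = Uc (g ++ g') k.
Proof.
elim: g k => [|w g IH] k /=; last by rewrite !IH; case: k => // k; rewrite IH.
by case: k => [|k]; rewrite ?mulmx0 addr0.
Qed.

Variable b : R.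

Definition mshl (Z : nat -> nat -> A) p q : A := if p is p'.+1 then Z p' q else 0.
Definition mshr (Z : nat -> nat -> A) p q : A := if q is q'.+1 then Z p q' else 0.

Lemma iota2_idem v : idem b v -> idem ((b%:P)%:P) (iota2 v).
Proof.
rewrite /idem => vv; pose f := [the {rmorphism R -> S} of (polyC \o polyC)].
have fE w : iota2 w = map_mx f w by [].
by rewrite !fE -map_mxM vv map_mxZ.
Qed.

Lemma Uc_cancel g : (forall v, v \in g -> idem b v) -> rev g = g ->
  exists Z, forall p q, Uc g q *m Uc g p =
    (if (p == 0%N) && (q == 0%N) then 1%:M else 0) +
    (mshl Z p q + mshr Z p q + b *: mshl (mshr Z) p q).
Proof.
move=> gid gpal.
have [|Z ZP] := @prodh_cancel S n ((b%:P)%:P) (map iota2 g) px py 0.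
  by move=> v /mapP[w wg ->]; apply/iota2_idem/gid.
exists (fun p q => cf p q Z) => p q.
move: ZP; rewrite scaler0 addr0 mulmx1 -map_rev gpal => ZP.
rewrite -cf_xy ZP cfD cf1; congr (_ + _).
rewrite !scalerDl !cfD cfX cfY -mulrA -scalerA cfZ -scalerA cfX; congr (_ + _ *: _).
by case: p => [|p] //=; rewrite cfY.
Qed.

Lemma Uc_even g : (forall v, v \in g -> idem b v) ->
  exists Z : nat -> A, forall p, Uc (rev g ++ g) p.+1 =
    2%:R *: Z p + (if p is p'.+1 then b *: Z p' else 0).
Proof.
move=> gid.
have [|Z ZP] := @prodh_cancel S n ((b%:P)%:P) (map iota2 g) px px 0.
  by move=> v /mapP[w wg ->]; apply/iota2_idem/gid.
exists (fun p => cf p 0 Z) => p.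
have -> : Uc (rev g ++ g) p.+1 = cf p.+1 0 (prodh (map iota2 (rev g ++ g)) px).
  by rewrite cf_prodx1.
rewrite map_cat prodh_cat map_rev.
move: ZP; rewrite scaler0 addr0 mulmx1 => ->.
rewrite cfD cf1 add0r !scalerDl !cfD cfX -mulrA -scalerA cfZ -scalerA cfX cfX.
rewrite !scale1r; congr (_ + _).
by case: p => [|p] //; rewrite scaler0.
Qed.

End Extract.

(** * Series given by entries of transfer products *)

Section TransferSeries.

Local Open Scope ring_scope.
Local Notation R := {poly int}.

Variables (n : nat) (g : seq 'M[R]_n) (d : 'cV[R]_n) (p0 : 'I_n).

Definition vecU (a : seq nat) : 'cV[R]_n := foldl (fun w k => Uc g k *m w) d a.

Definition entryU : series := fun a => vecU a p0 0.

Fixpoint matU (a : seq nat) : 'M[R]_n :=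
  if a is k :: a' then matU a' *m Uc g k else 1%:M.

Lemma vecUE a : vecU a = matU a *m d.
Proof.
rewrite /vecU; elim: a d => [|k a IH] w /=; first by rewrite mul1mx.
by rewrite IH mulmxA.
Qed.

Lemma matU_cat a b : matU (a ++ b) = matU b *m matU a.
Proof. by elim: a => [|k a IH] /=; rewrite ?mulmx1 // IH mulmxA. Qed.

Let rho (M : 'M[R]_n) := (M *m d) p0 0.

Let rhoD M N : rho (M + N) = rho M + rho N.
Proof. by rewrite /rho mulmxDl mxE. Qed.

Let rhoZ c M : rho (c *: M) = c * rho M.
Proof. by rewrite /rho -scalemxAl mxE. Qed.

Let rho0 : rho 0 = 0.
Proof. by rewrite /rho mul0mx mxE. Qed.

Let entryUE a : entryU a = rho (matU a).
Proof. by rewrite /entryU vecUE. Qed.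

Lemma entryU_quasisym : quasisym entryU.
Proof.
by move=> a b; rewrite !entryUE !matU_cat /= Uc0 mulmx1.
Qed.

(** A second word with the same coefficients is allowed, because a zero matrix kept in [g] as a
    placeholder may spoil the palindrome. *)
Lemma entryU_cancels (g' : seq 'M[R]_n) : (forall k, Uc g k = Uc g' k) ->
  (forall v, v \in g' -> idem beta v) -> rev g' = g' -> cancels entryU.
Proof.
move=> gg' gid gpal D a b; have [Z ZP] := Uc_cancel gid gpal.
exists (fun p q => rho (matU b *m Z p q *m matU a)) => p q pq.
rewrite entryUE matU_cat /= -(mulmxA (matU b)) !gg' ZP.
have -> : (p == 0%N) && (q == 0%N) = false by lia.
rewrite add0r mulmxDr mulmxDl rhoD mulmxDr mulmxDl rhoD -scalemxAr -scalemxAl rhoZ.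
by case: p {pq} => [|p]; case: q => [|q]; rewrite /= ?mulmx0 ?mul0mx ?rho0.
Qed.

Lemma entryU_even (g' : seq 'M[R]_n) : g = rev g' ++ g' ->
  (forall v, v \in g' -> idem beta v) -> even entryU.
Proof.
move=> gE gid D; have [Z ZP] := Uc_even gid.
pose matZ := fix matZ (a : seq nat) : 'M[R]_n :=
  if a is k :: a' then matZ a' *m Z k else 1%:M.
exists (fun a => rho (matZ a)) => a pa _; rewrite entryUE.
(* [matU] puts later variables on the left, while [ev] peels off the first entry; the factor peeled
   off stays on the right, hence the generalisation over [M]. *)
suff gen M : rho (matU a *m M) = ev (fun c => rho (matZ c *m M)) a.
  rewrite -[matU a]mulmx1 gen; congr (ev _ _); apply/funext => c.
  by rewrite mulmx1.
elim: a pa M => [|k a IH] //= /andP[k0 pa] M.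
case: k k0 => // k _; rewrite -mulmxA IH // gE ZP /= ltnS.
have evE (X : nat -> 'M[R]_n) k' : ev (fun c => rho (matZ c *m (X k' *m M))) a =
    ev (fun c => rho (matZ c *m X k' *m M)) a.
  by congr (ev _ _); apply/funext => c; rewrite mulmxA.
rewrite (_ : (fun c => _) = (fun c => (2%:R * rho (matZ c *m Z k *m M) +
   (if k is k'.+1 then beta else 0) * rho (matZ c *m Z k.-1 *m M)))); last first.
  apply/funext => c; rewrite mulmxDl mulmxDr rhoD -scalemxAl -scalemxAr rhoZ mulmxA.
  case: k => [|k] /=; first by rewrite mul0mx mulmx0 mul0r rho0.
  by rewrite -scalemxAl -scalemxAr rhoZ mulmxA.
rewrite (evZD _ (fun c => 2%:R * rho (matZ c *m Z k *m M))).
rewrite (_ : (fun c => 2%:R * _) = (fun c => 0 + 2%:R * rho (matZ c *m Z k *m M)));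
  last first.
  by apply/funext => c; rewrite add0r.
rewrite (evZD _ (fun c => 0)).
have -> : ev (fun=> 0) a = 0.
  by elim: (a) => //= k' a' ->; case: ifP => _; ring.
by rewrite add0r; case: k => [|k] /=; rewrite ?mul0r.
Qed.

Lemma entryU_symm : (forall p q, Uc g p *m Uc g q = Uc g q *m Uc g p) -> symm entryU.
Proof.
move=> comm a b ab; rewrite !entryUE; congr rho.
have swap k c c' : matU (c ++ k :: c') = matU (k :: c ++ c').
  by elim: c => //= j c ->; rewrite -!mulmxA comm.
elim: a b ab => [|k a IH] b ab.
  by have := perm_size ab; case: b {ab}.
have kb : k \in b by rewrite -(perm_mem ab) inE eqxx.
have [c [c' bE]] : exists c c', b = c ++ k :: c'.
  by case/splitPr: kb => c c'; exists c, c'.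
rewrite bE swap /=; congr (_ *m _); apply: IH.
by rewrite -(perm_cons k) (perm_trans ab) // bE -cat1s perm_catCA.
Qed.

End TransferSeries.

(** * The Yang-Baxter equation *)

Section Commutation.

Local Open Scope ring_scope.

Variables (S : comNzRingType) (n : nat) (b : S) (v : nat -> 'M[S]_n).
Implicit Types x y : S.

(* The polynomial substitute for (1 + b y) h_v((x - y) / (1 + b y)). *)
Definition gfac x y (w : 'M[S]_n) : 'M[S]_n := (1 + b * y)%:M + (x - y) *: w.

Hypothesis v_idem : forall k, idem b (v k).
Hypothesis v_far : forall i j, (i.+1 < j)%N -> v i *m v j = v j *m v i.

Lemma hfac_gfac x y k : hfac y (v k) *m gfac x y (v k) = (1 + b * y) *: hfac x (v k).
Proof.
rewrite /hfac /gfac mulmxDl mul1mx mulmxDr mul_mx_scalar -scalemxAr -scalemxAl.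
rewrite v_idem scalerDr !scalerA scale_scalar_mx mulr1 -!addrA; congr (_ + _).
rewrite -!scalerDl; congr (_ *: _); ring.
Qed.

(** The parameters (x - y)/(1 + b y) and (y - x)/(1 + b x) are inverse to each other for the law x +
    y + b x y. *)
Lemma gfacM x y k : gfac x y (v k) *m gfac y x (v k) = ((1 + b * x) * (1 + b * y))%:M.
Proof.
rewrite /gfac mulmxDl !mulmxDr !mul_mx_scalar !mul_scalar_mx -!scalemxAl -!scalemxAr.
rewrite v_idem scale_scalar_mx !scalerA -!addrA -!scalerDl.
rewrite [X in _ + X *: _](_ : _ = 0) ?scale0r ?addr0; last by ring.
by congr (_%:M); ring.
Qed.

(** [downA k m x] stands for h_(k+m-1)(x) ... h_k(x), and [upA k m x] for the same factors in the
    opposite order. *)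
Variables downA upA : nat -> nat -> S -> 'M[S]_n.
Hypothesis downA0 : forall k x, downA k 0 x = 1%:M.
Hypothesis upA0 : forall k x, upA k 0 x = 1%:M.
Hypothesis downAS : forall k m x, downA k m.+1 x = downA k.+1 m x *m hfac x (v k).
Hypothesis upAS : forall k m x, upA k m.+1 x = hfac x (v k) *m upA k.+1 m x.

Lemma hfac_far x y i j : (i.+1 < j)%N ->
  hfac x (v i) *m hfac y (v j) = hfac y (v j) *m hfac x (v i).
Proof.
move=> ij; rewrite /hfac !mulmxDl !mulmxDr !mul1mx !mulmx1 -!scalemxAl -!scalemxAr.
rewrite (v_far ij) !scalerA mulrC -!addrA; congr (_ + _).
by rewrite !addrA [x *: _ + _]addrC.
Qed.

Lemma downA_far x y i k m : (i.+1 < k)%N ->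
  hfac x (v i) *m downA k m y = downA k m y *m hfac x (v i).
Proof.
elim: m k => [|m IH] k ik; first by rewrite downA0 mulmx1 mul1mx.
by rewrite downAS mulmxA IH ?(ltn_trans ik) // -!mulmxA hfac_far.
Qed.

Lemma upA_far x y i k m : (i.+1 < k)%N ->
  hfac x (v i) *m upA k m y = upA k m y *m hfac x (v i).
Proof.
elim: m k => [|m IH] k ik; first by rewrite upA0 mulmx1 mul1mx.
by rewrite upAS -mulmxA -IH ?(ltn_trans ik) // !mulmxA hfac_far.
Qed.

(** [YBr] and [YBl] are instances of this relation in which one parameter is (x - y)/(1 + b y),
    multiplied by 1 + b y. *)
Hypothesis YB : forall k x y,
  hfac x (v k.+1) *m hfac (x + y + b * x * y) (v k.+2) *m hfac y (v k.+1) =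
  hfac y (v k.+2) *m hfac (x + y + b * x * y) (v k.+1) *m hfac x (v k.+2).
Hypothesis YBr : forall k x y,
  gfac x y (v k.+2) *m hfac x (v k.+1) *m hfac y (v k.+2) =
  hfac y (v k.+1) *m hfac x (v k.+2) *m gfac x y (v k.+1).
Hypothesis YBl : forall k x y,
  hfac y (v k.+2) *m hfac x (v k.+1) *m gfac x y (v k.+2) =
  gfac x y (v k.+1) *m hfac x (v k.+2) *m hfac y (v k.+1).

(** Exchanging x and y in two descending products leaves a factor [gfac] at the lowest content;
    [YBr] moves it down by one content in each step of the induction. *)
Lemma downA_swap k m x y :
  (1 + b * y) *: (downA k.+1 m.+1 x *m downA k.+2 m y) =
  downA k.+1 m.+1 y *m downA k.+2 m x *m gfac x y (v k.+1).
Proof.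
elim: m k => [|m IH] k; first by rewrite !downAS !downA0 !mul1mx !mulmx1 hfac_gfac.
rewrite (downAS k.+1 m.+1 x) (downAS k.+2 m y) mulmxA -(mulmxA (downA k.+2 _ _)).
rewrite (downA_far x y) // mulmxA -(mulmxA (_ *m _)) scalemxAl IH.
rewrite -(mulmxA (_ *m _)) (mulmxA (gfac _ _ _)) YBr !mulmxA.
rewrite -(mulmxA _ (downA k.+3 m x)) -(downA_far y x) //.
by rewrite (downAS k.+1 m.+1 y) (downAS k.+2 m x) !mulmxA.
Qed.

Lemma upA_swap k m x y :
  (1 + b * x) *: (upA k.+2 m x *m upA k.+1 m.+1 y) =
  gfac y x (v k.+1) *m upA k.+2 m y *m upA k.+1 m.+1 x.
Proof.
elim: m k => [|m IH] k.
  rewrite !upAS !upA0 !mul1mx !mulmx1.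
  rewrite /hfac /gfac mulmxDl mul_scalar_mx mulmxDr mulmx1 -!scalemxAr -!scalemxAl.
  rewrite v_idem !scalerDr !scalerA scale_scalar_mx mulr1 -!addrA; congr (_ + _).
  rewrite -!scalerDl; congr (_ *: _); ring.
rewrite (upAS k.+1 m.+1 y) (upAS k.+2 m x) !mulmxA -(mulmxA _ (upA k.+3 m x)).
rewrite -(upA_far y x) // mulmxA -(mulmxA _ (upA k.+3 m x)) scalemxAr IH.
rewrite !mulmxA YBl -(mulmxA _ (hfac x (v k.+1))) (upA_far x y) //.
by rewrite (upAS k.+1 m.+1 x) (upAS k.+2 m y) !mulmxA.
Qed.

(** [YB] turns the inner triple of factors inside out, so that the descending product in y passes to
    the left and one factor in x + y + b x y remains between. *)
Lemma upA_downA k m x y :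
  upA k.+1 m.+1 x *m downA k.+1 m.+1 y =
  downA k.+2 m y *m hfac (x + y + b * x * y) (v k.+1) *m upA k.+2 m x.
Proof.
elim: m k => [|m IH] k.
  by rewrite upAS downAS !upA0 !downA0 !mul1mx !mulmx1 (hfacM _ _ (v_idem _)).
rewrite (upAS k.+1 m.+1 x) (downAS k.+1 m.+1 y) mulmxA -(mulmxA (hfac x _)) IH !mulmxA (downA_far x y) //.
rewrite -[LHS]mulmxA -(upA_far y x) // !mulmxA -(mulmxA (downA k.+3 m y)).
rewrite -(mulmxA (downA k.+3 m y)) YB.
by rewrite (upAS k.+2 m x) (downAS k.+2 m y) !mulmxA.
Qed.

(** The parameter of the middle factor k: x for h_0, and x + x + b x x for h_0^2. *)
Variable kap : S -> S.

Let k0 x : 'M[S]_n := 1%:M + kap x *: v 0.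

Hypothesis YB0 : forall x y,
  gfac x y (v 1) *m k0 x *m hfac (x + y + b * x * y) (v 1) *m k0 y =
  k0 y *m hfac (x + y + b * x * y) (v 1) *m k0 x *m gfac x y (v 1).

Definition bothA m x := downA 1 m x *m k0 x *m upA 1 m x.

(** After [upA_downA] the product is a descending pair, a middle k0 h_1 k0, and an ascending pair.
    Swapping the outer pairs leaves [gfac x y] before the middle and [gfac y x] after it; [YB0]
    carries the first through, exchanging the variables, and the two combine to a scalar. That
    scalar stays on both sides, as the ring need not be a domain. *)
Lemma bothA_comm m x y :
  ((1 + b * x) * (1 + b * y)) *: (bothA m x *m bothA m y) =
  ((1 + b * x) * (1 + b * y)) *: (bothA m y *m bothA m x).
Proof.
rewrite /bothA; case: m => [|m].
  congr (_ *: _); rewrite !downA0 !upA0 !mul1mx !mulmx1 /k0 !mulmxDl !mulmxDr.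
  rewrite !mul1mx !mulmx1 -!scalemxAl -!scalemxAr !scalerA mulrC -!addrA.
  by congr (_ + _); rewrite !addrA [kap x *: _ + _]addrC.
have k0_down z w : k0 z *m downA 2 m w = downA 2 m w *m k0 z.
  exact: (downA_far (kap z) w).
have k0_up z w : k0 z *m upA 2 m w = upA 2 m w *m k0 z.
  exact: (upA_far (kap z) w).
have expand z w : bothA m.+1 z *m bothA m.+1 w =
    (downA 1 m.+1 z *m downA 2 m w) *m
    (k0 z *m hfac (z + w + b * z * w) (v 1) *m k0 w) *m
    (upA 2 m z *m upA 1 m.+1 w).
  rewrite /bothA !mulmxA -(mulmxA _ (upA 1 m.+1 z)) upA_downA !mulmxA.
  by rewrite -(mulmxA _ (k0 z)) k0_down -(mulmxA _ (upA 2 m z) (k0 w)) -k0_up !mulmxA.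
have {}expand z w : downA 1 m.+1 z *m k0 z *m upA 1 m.+1 z *m
  (downA 1 m.+1 w *m k0 w *m upA 1 m.+1 w) = _ := expand z w.
have distr (DD KK UU : 'M[S]_n) : ((1 + b * x) * (1 + b * y)) *: (DD *m KK *m UU) =
    ((1 + b * y) *: DD) *m KK *m ((1 + b * x) *: UU).
  by rewrite -!scalemxAl -scalemxAr scalerA mulrC.
rewrite expand distr downA_swap upA_swap expand -(mulmxA _ (gfac x y _)).
set H := hfac _ _; have -> : gfac x y (v 1) *m (k0 x *m H *m k0 y) =
    k0 y *m H *m k0 x *m gfac x y (v 1) by rewrite !mulmxA YB0.
rewrite !mulmxA -(mulmxA _ (gfac x y _)) gfacM mul_mx_scalar -!scalemxAl.
congr (_ *: _); rewrite /H (_ : y + x + b * y * x = x + y + b * x * y) //; ring.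
Qed.

End Commutation.

(** * Matrices acting on functions of states *)

Section States.

Local Open Scope ring_scope.

Variables (S : comNzRingType) (b : S) (St : finType).
Implicit Types (pat : pred St) (tgt : St -> St) (f : St -> S).

(** Columns are functions f of the state: the new value at s is b f(s) + f(tgt s) where [pat] holds,
    and 0 elsewhere. Adding a box thus appears as reading f at the state with the box removed. *)
Definition vmx pat tgt : 'M[S]_#|St| :=
  \matrix_(i, j) ((pat (enum_val i))%:R *
    (b * (enum_val j == enum_val i)%:R + (enum_val j == tgt (enum_val i))%:R)).

Definition colv f : 'cV[S]_#|St| := \col_i f (enum_val i).

Lemma sum_delta f s : \sum_(j < #|St|) (enum_val j == s)%:R * f (enum_val j) = f s.
Proof.
rewrite (bigD1 (enum_rank s)) //= enum_rankK eqxx mul1r big1 ?addr0 // => j js.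
have -> : (enum_val j == s) = false; last by rewrite mul0r.
by apply: contraNF js => /eqP <-; rewrite enum_valK.
Qed.

Lemma aff_col c d pat tgt f : (c%:M + d *: vmx pat tgt) *m colv f =
  colv (fun s => c * f s + (if pat s then d * (b * f s + f (tgt s)) else 0)).
Proof.
apply/matrixP => i k; rewrite !mxE.
under eq_bigr => j _ do rewrite !mxE mulrDl.
rewrite big_split /=; congr (_ + _).
  rewrite (bigD1 i) //= eqxx mulr1n big1 ?addr0 // => j ji.
  by rewrite eq_sym (negPf ji) mulr0n mul0r.
case: ifP => _; last by rewrite big1 // => j _; rewrite mul0r mulr0 mul0r.
under eq_bigr => j _ do rewrite mul1r -mulrA mulrDl -mulrA.
by rewrite -mulr_sumr big_split /= -mulr_sumr !sum_delta.
Qed.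

Lemma vmx_col pat tgt f : vmx pat tgt *m colv f =
  colv (fun s => if pat s then b * f s + f (tgt s) else 0).
Proof.
have := aff_col 0 1 pat tgt f; rewrite -scalemx1 scale0r add0r scale1r => ->.
by apply/matrixP => i k; rewrite !mxE mul0r add0r mul1r.
Qed.

Lemma mx_ext (M N : 'M[S]_#|St|) : (forall f, M *m colv f = N *m colv f) -> M = N.
Proof.
move=> MN; apply/matrixP => i j.
have colE (L : 'M[S]_#|St|) :
    (L *m colv (fun s => (s == enum_val j)%:R)) i 0 = L i j.
  rewrite mxE (bigD1 j) //= !mxE eqxx mulr1 big1 ?addr0 // => k kj.
  by rewrite !mxE (inj_eq enum_val_inj) (negPf kj) mulr0.
by rewrite -colE MN colE.
Qed.

Lemma colv_eq f f' : (forall s, f s = f' s) -> colv f = colv f'.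
Proof. by move=> ff; apply/matrixP => i k; rewrite !mxE ff. Qed.

Lemma vmx_idem pat tgt : (forall s, pat s -> ~~ pat (tgt s)) -> idem b (vmx pat tgt).
Proof.
move=> pt; rewrite /idem; apply: mx_ext => f; rewrite -mulmxA !vmx_col -scalemxAl vmx_col.
apply/matrixP => i k; rewrite !mxE; case: ifP => ps; rewrite ?ps; last by rewrite mulr0.
by rewrite (negPf (pt _ ps)) addr0.
Qed.

End States.

Lemma vmx_map (S T : comNzRingType) (h : {rmorphism S -> T}) (b : S) (St : finType)
  (pat : pred St) tgt : map_mx h (vmx b pat tgt) = vmx (h b) pat tgt.
Proof. by apply/matrixP => i j; rewrite !mxE rmorphM rmorphD rmorphM !rmorph_nat. Qed.

(** * Strict partitions as particle configurations *)

Section Particles.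

Local Open Scope ring_scope.

Variable m : nat.

(* A strict partition is recorded by its set of parts: site k is occupied when
   k.+1 is a part.  Adding a box of content c > 0 moves a particle from site
   c.-1 to site c; adding a box of content 0 creates one at site 0. *)
Definition sites := {ffun 'I_m.+1 -> bool}.
Implicit Type s : sites.

Definition occ s k := if insub k is Some i then s i else false.

Definition hop_back k s : sites := [ffun i : 'I_m.+1 =>
  if i == k :> nat then true else if i == k.+1 :> nat then false else s i].

Definition vacate0 s : sites := [ffun i : 'I_m.+1 => (i != 0%N :> nat) && s i].

Lemma occ_ord s (i : 'I_m.+1) : occ s i = s i.
Proof. by rewrite /occ valK. Qed.

Lemma occ_lt s k : occ s k -> (k < m.+1)%N.
Proof. by rewrite /occ; case: insubP. Qed.

Lemma occ_hop s k j : occ (hop_back k s) j =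
  if j == k then (k < m.+1)%N else (j != k.+1) && occ s j.
Proof.
rewrite /occ; case: insubP => [i _ <-|]; rewrite ?ffunE.
  by case: eqP => [<-|_]; [rewrite ltn_ord|case: eqP].
by rewrite andbF; case: eqP => [<- /negPf|].
Qed.

Lemma occ_vacate s j : occ (vacate0 s) j = (j != 0%N) && occ s j.
Proof. by rewrite /occ; case: insubP => [i _ <-|]; rewrite ?ffunE ?andbF. Qed.

Lemma sites_eq s s' : (forall k, occ s k = occ s' k) -> s = s'.
Proof. by move=> ss; apply/ffunP => i; rewrite -!occ_ord. Qed.

(** Removability of a box of content c and the effect of removing it, that is, the moves above
    reversed. *)
Definition rmv c s := if c is k.+1 then ~~ occ s k && occ s k.+1 else occ s 0.
Definition rmt c s := if c is k.+1 then hop_back k s else vacate0 s.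

Lemma rmv_rmt c s : rmv c s -> ~~ rmv c (rmt c s).
Proof.
case: c => [|c] /=; first by rewrite occ_vacate.
by move=> /andP[_ /occ_lt/ltnW cm]; rewrite occ_hop eqxx cm.
Qed.

Section YangBaxter.

Variables (S : comNzRingType) (b : S).

Definition vp c : 'M[S]_#|{: sites}| := vmx b (rmv c) (rmt c).

Lemma vp_idem c : idem b (vp c).
Proof. exact/vmx_idem/rmv_rmt. Qed.

Lemma vp_far i j : (i.+1 < j)%N -> vp i *m vp j = vp j *m vp i.
Proof.
case: j => // j ij; apply: mx_ext => f; rewrite -!mulmxA /vp !vmx_col.
apply: colv_eq => s.
have [e1 e2] : rmv j.+1 (rmt i s) = rmv j.+1 s /\ rmv i (rmt j.+1 s) = rmv i s.
  case: i ij => [|i] ij /=; rewrite ?occ_vacate !occ_hop.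
    have -> : (j == 0%N) = false by lia.
    by have -> : (0%N == j) = false by lia.
  have -> : (j == i) = false by lia.
  have -> : (j == i.+1) = false by lia.
  have -> : (j.+1 == i) = false by lia.
  have -> : (j.+1 == i.+1) = false by lia.
  have -> : (i == j) = false by lia.
  have -> : (i == j.+1) = false by lia.
  have -> : (i.+1 == j) = false by lia.
  by have -> : (i.+1 == j.+1) = false by lia.
have e3 : rmt i (rmt j.+1 s) = rmt j.+1 (rmt i s).
  apply: sites_eq => k; case: i ij {e1 e2} => [|i] ij /=.
    rewrite occ_vacate !occ_hop occ_vacate; case: eqP => [->|_]; last by rewrite andbCA.
    by case: j ij.
  rewrite !occ_hop; have [->|ki] := eqVneq k i.
    have -> : (i == j) = false by lia.
    by have -> : (i == j.+1) = false by lia.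
  have [kj|kj] := eqVneq k j; last by rewrite andbCA.
  by have -> : (k == i.+1) = false by lia.
rewrite e1 e2 e3; case: (rmv i s); case: (rmv j.+1 s); ring.
Qed.

(** Only the sites k, k+1, k+2 matter. In each of the eight occupancies the reachable configurations
    form a single chain, so both sides are polynomial combinations of the same values of [f]. *)
Lemma vp_YB k x y :
  [/\ hfac x (vp k.+1) *m hfac (x + y + b * x * y) (vp k.+2) *m hfac y (vp k.+1) =
     hfac y (vp k.+2) *m hfac (x + y + b * x * y) (vp k.+1) *m hfac x (vp k.+2),
     gfac b x y (vp k.+2) *m hfac x (vp k.+1) *m hfac y (vp k.+2) =
     hfac y (vp k.+1) *m hfac x (vp k.+2) *m gfac b x y (vp k.+1)
   & hfac y (vp k.+2) *m hfac x (vp k.+1) *m gfac b x y (vp k.+2) =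
     gfac b x y (vp k.+1) *m hfac x (vp k.+2) *m hfac y (vp k.+1)].
Proof.
have e01 : (k == k.+1) = false by lia.
have e10 : (k.+1 == k) = false by lia.
have e12 : (k.+1 == k.+2) = false by lia.
have e21 : (k.+2 == k.+1) = false by lia.
have e02 : (k == k.+2) = false by lia.
have e20 : (k.+2 == k) = false by lia.
split; apply: mx_ext => f; rewrite -!mulmxA /vp /gfac /hfac !aff_col;
  apply: colv_eq => s; have l1 := @occ_lt s k.+1; have l2 := @occ_lt s k.+2;
  rewrite /= !occ_hop ?eqxx ?(e01, e10, e12, e21, e02, e20) /=;
  case: (occ s k) l1 l2; case: (occ s k.+1); case: (occ s k.+2) => //= l1 l2;
  try have {}l1 := l1 isT; try have {}l2 := l2 isT;
  try have lk : (k < m.+1)%N = true by lia.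
all: try have lk1 : (k.+1 < m.+1)%N = true by lia.
all: rewrite ?occ_hop ?eqxx ?(e01, e10, e12, e21, e02, e20) /= ?lk ?lk1 /=; ring.
Qed.

Lemma vp_YB0 (kap : S -> S) x y :
  (kap = id \/ kap = fun x => x + x + b * x * x) ->
  gfac b x y (vp 1) *m (1%:M + kap x *: vp 0) *m
    hfac (x + y + b * x * y) (vp 1) *m (1%:M + kap y *: vp 0) =
  (1%:M + kap y *: vp 0) *m hfac (x + y + b * x * y) (vp 1) *m
    (1%:M + kap x *: vp 0) *m gfac b x y (vp 1).
Proof.
move=> kapE; apply: mx_ext => f; rewrite -!mulmxA /vp /gfac /hfac !aff_col.
apply: colv_eq => s /=.
have l1 := @occ_lt s 1; rewrite !(occ_hop, occ_vacate) /=.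
case: (occ s 0) l1; case: (occ s 1) => //= l1; try have {}l1 := l1 isT;
  rewrite ?(occ_hop, occ_vacate) /=; case: kapE => kapE; rewrite ?kapE /=; ring.
Qed.

End YangBaxter.

End Particles.

(** * The word of a single variable *)

Section Words.

Local Open Scope ring_scope.

Variables (S : comNzRingType) (n : nat) (b : S) (e : bool) (v : nat -> 'M[S]_n).

(* Contents in decreasing order for a primed letter, then in increasing order
   for the unprimed one; for GP and barK no diagonal entry is primed. *)
Definition word m : seq 'M[S]_n :=
  rev (map v (iota 1 m)) ++ (if e then v 0 else 0) :: v 0 :: map v (iota 1 m).

Lemma size_word m : size (word m) = (m.+1).*2.
Proof. by rewrite size_cat size_rev /= !size_map !size_iota; lia. Qed.

(** The first m + 1 slots belong to the primed letter, with contents m, ..., 0, the others to the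
    unprimed one, with contents 0, ..., m. Slot m is primed on the diagonal; the zero matrix placed
    there when [e] is false keeps one slot per letter and content. *)
Lemma nth_word m i : (i < (m.+1).*2)%N -> nth 0 (word m) i =
  if (i < m.+1)%N then (if e || (i != m) then v (m - i)%N else 0) else v (i - m.+1)%N.
Proof.
move=> im; rewrite nth_cat size_rev size_map size_iota.
have [li|li|->] := ltngtP i m.
- rewrite orbT (ltn_trans li) // nth_rev size_map size_iota //.
  by rewrite (nth_map 0%N) ?size_iota ?nth_iota; try lia; congr v; lia.
- rewrite ltnNge li /=; case E : (i - m)%N => [|[|k]] /=; first lia.
    by congr v; lia.
  by rewrite (nth_map 0%N) ?size_iota ?nth_iota; try lia; congr v; lia.
- by rewrite subnn /= ltnSn orbF.
Qed.

End Words.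

Section WordSeries.

Local Open Scope ring_scope.
Local Notation R := {poly int}.

Variables (n : nat) (e : bool) (v : nat -> 'M[R]_n) (m : nat) (d : 'cV[R]_n) (p0 : 'I_n).
Hypothesis v_idem : forall k, idem beta (v k).

Lemma word_peak_series (s : bool) :
  (s -> forall p q, Uc (word e v m) p *m Uc (word e v m) q =
                    Uc (word e v m) q *m Uc (word e v m) p) ->
  peak_series e s (entryU (word e v m) d p0).
Proof.
move=> comm; split; first exact: entryU_quasisym.
(* Dropping the placeholder makes the word a palindrome in both cases. *)
- have [g [gE gid gpal]] : exists g, [/\ forall k, Uc (word e v m) k = Uc g k,
    forall w, w \in g -> idem beta w & rev g = g].
    exists (rev (map v (iota 1 m)) ++ (if e then [:: v 0] else [::]) ++ v 0 :: map v (iota 1 m)).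
    split.
    + by rewrite /word; case: (e) => // k; rewrite Uc_zero.
    + move=> w; rewrite mem_cat mem_rev => /orP[/mapP[k _ ->] //|].
      rewrite mem_cat => /orP[|].
        by case: (e); rewrite ?inE // => /eqP ->.
      by rewrite inE => /orP[/eqP -> //|/mapP[k _ ->]].
    + by case: (e); rewrite !rev_cat /= ?rev_cons revK -?cats1 -?catA.
  exact: (@entryU_cancels _ _ _ _ g gE gid gpal).
- move=> ee; have gE : word e v m = rev (map v (iota 0 m.+1)) ++ map v (iota 0 m.+1).
    by rewrite /word ee /= rev_cons cat_rcons.
  by apply: (@entryU_even _ _ _ _ _ gE) => w /mapP[k _ ->].
- by move=> /comm; apply: entryU_symm.
Qed.

End WordSeries.

Lemma prodh_word (R S : comNzRingType) n (h : 'M[R]_n -> 'M[S]_n) (b : S) (e : bool)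
    (v : nat -> 'M[R]_n) (w : nat -> 'M[S]_n) m (x : S) : h 0%R = 0%R ->
    (forall k, h (v k) = w k) -> idem b (w 0) ->
  (prodh (map h (word e v m)) x = prodh (map w (iota 1 m)) x *m
    (1%:M + (if e then x + x + b * x * x else x) *: w 0) *m
    prodh (rev (map w (iota 1 m))) x)%R.
Proof.
move=> h0 hE w_idem; rewrite /word map_cat prodh_cat map_rev -map_comp.
have mE : map (h \o v) (iota 1 m) = map w (iota 1 m) by apply: eq_map => k /=.
rewrite mE; congr (_ *m _)%R; rewrite /= -map_comp mE hE -mulmxA; congr (_ *m _)%R.
by case: e; rewrite ?hE ?(hfacM _ _ w_idem) // h0 /hfac scaler0 addr0 mulmx1.
Qed.

Lemma scale_neq0 (R : idomainType) (b : R) :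
  ((1 + (b%:P)%:P * px R) * (1 + (b%:P)%:P * py R) != 0)%R.
Proof.
apply/eqP => /(congr1 (fun P : {poly {poly R}} => P.[0].[0]))%R/eqP.
by rewrite /px /py !hornerE oner_eq0.
Qed.

Section ParticleWord.

Local Open Scope ring_scope.
Local Notation R := {poly int}.
Local Notation S := {poly {poly R}}.

(** The identity is proved for the generating polynomials in x and y, where the scalar left by
    [bothA_comm] is a nonzero element of a domain; coefficients are compared afterwards. *)
Lemma particle_word_comm (e : bool) m p q :
  let g := word e (vp m beta) m in Uc g p *m Uc g q = Uc g q *m Uc g p.
Proof.
move=> g; pose bS : S := (beta%:P)%:P.
pose f := [the {rmorphism R -> S} of (polyC \o polyC)].
have vE k : iota2 (vp m beta k) = vp m bS k by rewrite /vp -(vmx_map f).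
pose kap (x : S) := if e then x + x + bS * x * x else x.
pose down k j (x : S) := prodh (map (vp m bS) (iota k j)) x.
pose up k j (x : S) := prodh (rev (map (vp m bS) (iota k j))) x.
have upS k j x : up k j.+1 x = hfac x (vp m bS k) *m up k.+1 j x.
  by rewrite /up /= rev_cons prodh_rcons.
have prodhE x : prodh (map (@iota2 _ _) g) x =
    down 1 m x *m (1%:M + kap x *: vp m bS 0) *m up 1 m x.
  apply: prodh_word; [|exact: vE|exact: vp_idem].
  by apply/matrixP => i j; rewrite !mxE !polyC0.
have kapE : kap = id \/ kap = fun x => x + x + bS * x * x.
  by rewrite /kap; case: (e); [right|left].
rewrite -cf_yx -cf_xy !prodhE; congr cf.
pose sc := (1 + bS * px R) * (1 + bS * py R).
have sc0 : sc != 0 by apply: scale_neq0.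
have := @bothA_comm S _ bS (vp m bS) (@vp_idem m S bS) (@vp_far m S bS) down up
  (fun _ _ => erefl) (fun _ _ => erefl) (fun _ _ _ => erefl) upS
  (fun k x y => let: And3 h _ _ := @vp_YB m S bS k x y in h)
  (fun k x y => let: And3 _ h _ := @vp_YB m S bS k x y in h)
  (fun k x y => let: And3 _ _ h := @vp_YB m S bS k x y in h)
  kap (fun x y => @vp_YB0 m S bS kap x y kapE) m (px R) (py R).
rewrite /bothA -/sc => commE; apply/matrixP => i j.
have := congr1 (fun M : 'M_ _ => M i j) commE.
rewrite mxE [RHS]mxE => /(mulfI sc0).
by [].
Qed.

End ParticleWord.

(** * Fillings as sequences of events *)

Section Bridge.

Local Open Scope ring_scope.
Local Notation R := {poly int}.

Variables (P : finType) (lt : rel P) (cont : P -> nat) (C : nat) (e : bool) (n : nat).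

Hypothesis lt_irr : irreflexive lt.
Hypothesis cont_lt : forall b, (cont b < C)%N.
Hypothesis cont_eq : forall b c, cont b = cont c -> [\/ b = c, lt b c | lt c b].

Local Notation event := (P * 'I_n.*2)%type.
Implicit Types (p q : event) (T : {set event}) (J : {set P}).

(* The letter (k, unprimed) has index 2 k + unprimed.  Letter after letter, the
   events "box b receives letter l" are performed by increasing content for
   unprimed letters and by decreasing content for primed ones. *)
Definition tau q := (q.2 * C + if odd q.2 then cont q.1 else C.-1 - cont q.1)%N.
Definition allowed q := [|| e, odd q.2 | cont q.1 != 0%N].

Definition valid T := [forall p in T, forall q in T, lt p.1 q.1 ==> (tau p < tau q)%N]
  && [forall p in T, allowed p].
Definition esupp T : {set P} := [set q.1 | q in T].
Definition count_value T (v : 'I_n) := #|[set q in T | (q.2)./2 == v]|.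
Definition has_counts (f : nat -> nat) T := [forall v : 'I_n, count_value T v == f v].
Definition before t T := [forall q in T, (tau q < t)%N].

(** A partial filling: the events before time t fill exactly the boxes of [J], and [f] prescribes
    the exponents. The power of beta counts the surplus events. *)
Definition Wsum t f J : R :=
  \sum_(T | [&& valid T, before t T, has_counts f T & esupp T == J]) 'X^(#|T| - #|J|).

Definition ideal J := [forall c in J, forall b, lt b c ==> (b \in J)].
Definition maximal b J := (b \in J) && [forall c in J, ~~ lt b c].
Definition decr (f : nat -> nat) k := fun u => if u == k then (f u).-1 else f u.

Lemma tau_inj p q : tau p = tau q -> p.2 = q.2 /\ cont p.1 = cont q.1.
Proof.
have cp := cont_lt p.1; have cq := cont_lt q.1.
have C0 : (0 < C)%N by lia.
have bound q' : ((if odd q'.2 then cont q'.1 else C.-1 - cont q'.1) < C)%N.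
  by have := cont_lt q'.1; case: ifP => _; lia.
move=> pq; have l2 : p.2 = q.2.
  have := congr1 (fun k => k %/ C)%N pq.
  rewrite /tau !divnMDl // !divn_small ?addn0 ?bound //; exact: val_inj.
split=> //; move: pq; rewrite /tau l2 => /addnI; case: ifP => _ //; lia.
Qed.

Lemma validP T : reflect
  ((forall p q, p \in T -> q \in T -> lt p.1 q.1 -> (tau p < tau q)%N) /\
   (forall p, p \in T -> allowed p)) (valid T).
Proof.
apply: (iffP andP) => [[/forall_inP h1 /forall_inP h2]|[h1 h2]].
  by split=> // p q pT qT pq; apply: (implyP (forall_inP (h1 p pT) q qT)).
split; apply/forall_inP => p pT; last exact: h2.
by apply/forall_inP => q qT; apply/implyP; apply: h1.
Qed.

Lemma maximalP b J : reflect (b \in J /\ forall c, c \in J -> ~~ lt b c) (maximal b J).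
Proof.
by apply: (iffP andP) => -[bJ /= h]; split=> //; apply/forall_inP.
Qed.

(** Simultaneous events lie in boxes of equal content, which coincide or are comparable; comparable
    boxes have events at different times. So each moment carries at most one event. *)
Lemma valid_inj T p q : valid T -> p \in T -> q \in T -> tau p = tau q -> p = q.
Proof.
move=> /validP[vT _] pT qT pq; have [l2 c1] := tau_inj pq.
have [b1|b1|b1] := cont_eq c1.
- by case: p q b1 l2 {pT qT pq c1} => [? ?] [? ?] /= -> ->.
- by have := vT _ _ pT qT b1; rewrite pq ltnn.
- by have := vT _ _ qT pT b1; rewrite pq ltnn.
Qed.

Lemma card_esupp T : (#|esupp T| <= #|T|)%N.
Proof. exact: leq_imset_card. Qed.

Definition halfo q : 'I_n := Ordinal (etrans (ltn_half_double _ _) (ltn_ord q.2)).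

Section Step.

Variables (t : nat) (f : nat -> nat) (J : {set P}) (q : event).
Hypothesis qt : tau q = t.

Let b := q.1.
Let f' := decr f q.2./2.

Let cond T := [&& valid T, before t.+1 T, has_counts f T & esupp T == J].
Let condt J' T := [&& valid T, before t T, has_counts f' T & esupp T == J'].

Lemma cond_needs T : cond T -> q \in T ->
  [&& allowed q, maximal b J & 0 < f q.2./2]%N.
Proof.
move=> /and4P[vT /forall_inP bT /forallP hT /eqP sT] qT; have [vT1 vT2] := validP _ vT.
apply/and3P; split; first exact: vT2.
- apply/maximalP; split; first by rewrite -sT; apply/imsetP; exists q.
  move=> c; rewrite -sT => /imsetP[p pT ->]; apply/negP => bp.
  by have := vT1 _ _ qT pT bp; have := bT _ pT; rewrite qt; lia.
- have /eqP <- := hT (halfo q); rewrite card_gt0; apply/set0Pn; exists q.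
  by rewrite inE qT /=.
Qed.

Lemma count_value_add T v : q \notin T ->
  count_value (q |: T) v = (count_value T v + (q.2./2 == v))%N.
Proof.
move=> qT; rewrite /count_value.
have -> : [set p in q |: T | (p.2)./2 == v] =
    (if q.2./2 == v then q |: [set p in T | (p.2)./2 == v] else [set p in T | (p.2)./2 == v]).
  apply/setP => p; rewrite !inE; case: (eqVneq p q) => [->|pq] /=.
    by case: ifP => qv; rewrite !inE ?eqxx // (negPf qT) qv.
  by case: ifP => qv; rewrite !inE ?(negPf pq).
case: ifP => _; last by rewrite addn0.
by rewrite cardsU1 inE (negPf qT) addnC.
Qed.

(** Deleting the last event q leaves its box b in the support if b holds another letter, and takes
    it out otherwise. Conversely b is maximal and q is the latest event, so adding q violates no
    order condition. *)
Lemma condE T : [&& allowed q, maximal b J & 0 < f q.2./2]%N ->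
  [&& cond (q |: T), q \in q |: T & (q |: T) :\ q == T] =
  condt J T || condt (J :\ b) T.
Proof.
move=> /and3P[aq /maximalP[bJ bmax] fq].
rewrite setU11 /=.
apply/andP/orP => [[/and4P[vT /forall_inP bT /forallP hT /eqP sT] /eqP TE]|].
  have qT : q \notin T by rewrite -TE setD11.
  have [vT1 vT2] := validP _ vT.
  have v' : valid T.
    by apply/validP; split=> [p p' pT p'T|p pT]; [apply: vT1|apply: vT2];
      rewrite inE ?pT ?p'T orbT.
  have b' : before t T.
    apply/forall_inP => p pT; have := bT p; rewrite inE pT orbT ltnS leq_eqVlt => /(_ isT).
    case/orP => // /eqP pt; have : p = q.
      by apply: (valid_inj vT); rewrite ?setU11 ?inE ?pT ?orbT ?pt.
    by move=> pq; rewrite -pq pT in qT.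
  have h' : has_counts f' T.
    apply/forallP => v; have /eqP := hT v; rewrite count_value_add //
      /f' /decr (eq_sym (v : nat)).
    case: (eqVneq (q.2)./2 v) => [_|_] /=; last by rewrite addn0 => ->.
    by rewrite addn1 => <-.
  have sJ : b |: esupp T = J by rewrite -sT /esupp imsetU1.
  rewrite /condt v' b' h' /=; case: (boolP (b \in esupp T)) => bT'.
    by left; rewrite -sJ; apply/eqP/esym/finset.setUidPr; rewrite finset.sub1set.
  by right; rewrite -sJ finset.setU1K.
have main J' : condt J' T -> J' \subset J -> b |: J' = J ->
    cond (q |: T) /\ (q |: T) :\ q == T.
  move=> /and4P[vT /forall_inP bT /forallP hT /eqP sT] J'J bJ'.
  have [vT1 vT2] := validP _ vT.
  have qT : q \notin T by apply/negP => /bT; rewrite qt ltnn.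
  have pJ p : p \in T -> p.1 \in J.
    by move=> pT; apply: (fintype.subsetP J'J); rewrite -sT; apply/imsetP; exists p.
  split; last by rewrite finset.setU1K.
  apply/and4P; split.
  - apply/validP; split=> [p p'|p]; rewrite !inE.
      move=> /orP[/eqP ->|pT] /orP[/eqP ->|p'T]; last exact: vT1.
      + by rewrite lt_irr.
      + by rewrite (negPf (bmax _ (pJ _ p'T))).
      + by move=> _; rewrite qt; apply: bT.
    by move=> /orP[/eqP ->|/vT2].
  - apply/forall_inP => p; rewrite !inE => /orP[/eqP ->|/bT]; rewrite ?qt //; exact: ltnW.
  - apply/forallP => v; rewrite count_value_add //
    (eqP (hT v)) /f' /decr (eq_sym (v : nat)).
    by case: (eqVneq (q.2)./2 v) => [<-|_] /=; rewrite ?addn0 // addn1 prednK.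
  - by rewrite /esupp imsetU1 -/(esupp T) sT bJ'.
case=> h; apply: (main _ h).
- exact: subxx.
- by apply/finset.setUidPr; rewrite finset.sub1set.
- exact: finset.subD1set.
- exact: finset.setD1K.
Qed.

(** The term with beta is the case where b stays in the support: one event is lost but no box. The
    two terms are the action of v_c. *)
Lemma Wsum_event :
  \sum_(T | cond T && (q \in T)) 'X^(#|T| - #|J|) =
  (if [&& allowed q, maximal b J & 0 < f q.2./2]%N
   then beta * Wsum t f' J + Wsum t f' (J :\ b) else 0) :> R.
Proof.
case: ifPn => [need|nneed]; last first.
  by apply: big_pred0 => T; apply: contraNF nneed => /andP[cT qT]; apply: cond_needs qT.
have /and3P[_ /maximalP[bJ _] _] := need.
rewrite (reindex_onto (fun T => q |: T) (fun T => T :\ q)) /=; last first.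
  by move=> T /andP[_ qT]; rewrite finset.setD1K.
rewrite (eq_bigl (fun T => condt J T || condt (J :\ b) T)) => [|T]; last first.
  by rewrite -andbA condE.
have qN T J' : condt J' T -> q \notin T.
  by move=> /and4P[_ /forall_inP bT _ _]; apply/negP => /bT; rewrite qt ltnn.
rewrite (bigID (condt J)) /=; congr (_ + _).
  rewrite /Wsum mulr_sumr; apply: eq_big => T; first by rewrite -/(condt J T);
    case: (condt J T); rewrite ?andbT ?andbF.
  rewrite andbC => /andP[cT _]; rewrite cardsU1 (qN _ _ cT) /beta -exprS.
  have /and4P[_ _ _ /eqP <-] := cT; have := card_esupp T => le.
  by rewrite subSn.
rewrite /Wsum; apply: eq_big => T.
  rewrite -/(condt (J :\ b) T); case cT : (condt J T) => /=; last by rewrite andbT.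
  symmetry; apply/negP => /and4P[_ _ _ /eqP sT].
  move: cT; rewrite /condt sT => /and4P[_ _ _ /eqP JE].
  by move: bJ; rewrite -JE setD11.
case cT : (condt J T) => /=; rewrite ?andbF // andbT => cT'.
rewrite cardsU1 (qN _ _ cT') (cardsD1 b J) bJ.
by rewrite subnDl.
Qed.

End Step.

Lemma Wsum_step t f J : Wsum t.+1 f J = Wsum t f J +
  \sum_(q | [&& tau q == t, allowed q, maximal q.1 J & 0 < f (q.2)./2]%N)
    (beta * Wsum t (decr f (q.2)./2) J + Wsum t (decr f (q.2)./2) (J :\ q.1)).
Proof.
rewrite {1}/Wsum (bigID (before t)) /=; congr (_ + _).
  apply: eq_bigl => T; case: (boolP (before t T)) => bT; rewrite ?andbF ?andbT //=.
  have -> // : before t.+1 T.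
  by apply/forall_inP => q qT; apply: ltnW; apply: (forall_inP bT).
transitivity (\sum_(q | tau q == t)
    \sum_(T | [&& valid T, before t.+1 T, has_counts f T & esupp T == J] && (q \in T))
      'X^(#|T| - #|J|) : R); last first.
  rewrite [RHS]big_mkcondr /= -[RHS]big_mkcondr /=.
  rewrite [RHS](eq_bigl (fun q => (tau q == t) &&
    [&& allowed q, maximal q.1 J & 0 < f (q.2)./2]%N)) //.
  by rewrite [RHS]big_mkcondr /=; apply: eq_bigr => q /eqP qt; apply: Wsum_event.
rewrite (exchange_big_dep (fun T =>
  [&& valid T, before t.+1 T, has_counts f T & esupp T == J])) /=;
    last by move=> ? ? _ /andP[].
rewrite big_mkcondr /=; apply: eq_bigr => T /and4P[vT /forall_inP bT1 hT sT].
case: (boolP (before t T)) => bT /=.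
  rewrite big_pred0 // => q; rewrite vT hT sT /=.
  have [qT|] := boolP (q \in T); rewrite ?andbF //.
  by have := forall_inP bT q qT; rewrite ltn_neqAle => /andP[/negPf ->].
move: bT; rewrite negb_forall_in => /existsP[q /andP[qT qt]].
have {}qt : tau q = t by have := bT1 _ qT; lia.
rewrite (big_pred1 q) // => p /=; apply/idP/eqP => [/and3P[/eqP pt _ pT]|->].
  by apply: (valid_inj vT) => //; rewrite pt.
by rewrite qt eqxx vT hT sT qT andbT /=; apply/andP; split=> //; apply/forall_inP.
Qed.

End Bridge.

(** * Event sums as products of transfer matrices *)

Section Transfer.

Local Open Scope ring_scope.
Local Notation R := {poly int}.

Variables (P : finType) (lt : rel P) (cont : P -> nat) (m : nat) (e : bool) (n : nat).
Local Notation C := m.+1.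

Hypothesis lt_irr : irreflexive lt.
Hypothesis cont_lt : forall b, (cont b < C)%N.
Hypothesis cont_eq : forall b c, cont b = cont c -> [\/ b = c, lt b c | lt c b].

Variables (St : finType) (cfg : {set P} -> St).
Variables (rm : nat -> pred St) (rt : nat -> St -> St).

(** Ideals enter through their states only: the state tells which contents are removable, follows
    each removal, and recognises the empty ideal. *)
Hypothesis cfg_rm : forall J c, ideal lt J ->
  reflect (exists2 b, maximal lt b J & cont b = c) (rm c (cfg J)).
Hypothesis cfg_rt : forall J b, ideal lt J -> maximal lt b J ->
  rt (cont b) (cfg J) = cfg (J :\ b).
Hypothesis cfg0 : forall J, ideal lt J -> cfg J = cfg finset.set0 -> J = finset.set0.

Local Notation v := (fun c => vmx beta (rm c) (rt c)).
Local Notation w := (word e v m).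
Local Notation W := (@Wsum P lt cont C e n).

Definition vacuum : 'cV[R]_#|St| := colv (fun s => (s == cfg finset.set0)%:R).

Lemma colvK (X : 'cV[R]_#|St|) : colv (fun s => X (enum_rank s) 0) = X.
Proof. by apply/matrixP => i j; rewrite mxE enum_valK ord1. Qed.

Lemma colv_rank (f : St -> R) s : colv f (enum_rank s) 0 = f s.
Proof. by rewrite mxE enum_rankK. Qed.

(** Each variable takes 2 (m + 1) units of time; time i within the span of variable k is slot i of
    its word. *)
Lemma tau_eq k i (q : P * 'I_n.*2) : (i < C.*2)%N ->
  (tau cont C q == k * C.*2 + i)%N =
  (q.2 == (k.*2 + (C <= i))%N :> nat) && (cont q.1 == if i < C then (m - i) else (i - C))%N.
Proof.
move=> iC; have cq := cont_lt q.1; rewrite /tau.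
case: (ltnP i C) => ci /=.
  apply/eqP/andP => [h|[/eqP -> /eqP ->]]; last first.
    by rewrite addn0 odd_double /=; lia.
  have l2 : q.2 = (k.*2 + 0)%N :> nat.
    have := congr1 (fun x => x %/ C)%N h.
    have -> : (k * C.*2 + i = (k.*2 + 0) * C + i)%N by lia.
    rewrite divnMDl // [X in _ = X]divnMDl // !divn_small; try lia.
    by case: ifP; lia.
  split; apply/eqP; first exact: l2.
  by move: h; rewrite l2 addn0 odd_double /=; lia.
apply/eqP/andP => [h|[/eqP -> /eqP ->]]; last first.
  by rewrite addn1 /= odd_double /=; lia.
have iE : (i = C + (i - C))%N by lia.
have l2 : q.2 = (k.*2 + 1)%N :> nat.
  have := congr1 (fun x => x %/ C)%N h.
  have -> : (k * C.*2 + i = (k.*2 + 1) * C + (i - C))%N by lia.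
  rewrite divnMDl // [X in _ = X]divnMDl // !divn_small; try lia.
  by case: ifP; lia.
split; apply/eqP; first exact: l2.
by move: h; rewrite l2 addn1 /= odd_double /=; lia.
Qed.

(** Slot i of variable k acts by the i-th matrix of the word, provided that the sum with one
    occurrence less depends on the ideal through its state, as recorded by [psi]. *)
Lemma Wsum_word_step k i (f : nat -> nat) (psi : St -> R) : (k < n)%N -> (i < C.*2)%N ->
  (forall J, ideal lt J -> W (k * C.*2 + i) (decr f k) J = psi (cfg J)) ->
  forall J, ideal lt J -> W (k * C.*2 + i).+1 f J = W (k * C.*2 + i) f J +
    (if (0 < f k)%N then (nth 0 w i *m colv psi) (enum_rank (cfg J)) 0 else 0).
Proof.
move=> kn iC psiE J idJ.
rewrite Wsum_step //; congr (_ + _).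
have half (q : P * 'I_n.*2) : tau cont C q == (k * C.*2 + i)%N -> (q.2)./2 = k.
  by rewrite tau_eq // => /andP[/eqP -> _]; rewrite halfD odd_double doubleK;
    case: leqP => /=; rewrite ?andbF ?addn0.
case: ifPn => fk; last first.
  rewrite big_pred0 // => q; apply/negP => /and4P[/half -> _ _ fk'].
  by rewrite fk' in fk.
rewrite nth_word //; set c := (if (i < C)%N then (m - i)%N else (i - C)%N).
have odd_q (q : P * 'I_n.*2) : tau cont C q == (k * C.*2 + i)%N -> odd q.2 = (C <= i)%N.
  by rewrite tau_eq // => /andP[/eqP -> _]; rewrite oddD odd_double; case: leqP.
have -> : (if (i < C)%N then if e || (i != m) then v (m - i)%N else 0 else v (i - C)%N) =
   (if [|| e, (C <= i)%N | c != 0%N] then v c else 0).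
  rewrite /c; case: (ltnP i C) => ic /=; last by rewrite orbT.
  by congr (if e || ~~ _ then _ else _); apply/eqP/eqP; lia.
case: ifPn => [al|nal]; last first.
  rewrite mul0mx mxE big_pred0 // => q; apply/negP => /and4P[tq aq _ _].
  move/negP: nal; apply; move: aq; rewrite /allowed (odd_q _ tq).
  by move: tq; rewrite tau_eq // => /andP[_ /eqP ->].
rewrite vmx_col colv_rank; case: cfg_rm => // [[b bJ bc]|nb]; last first.
  rewrite big_pred0 // => q; apply/negP => /and4P[tq _ mq _]; apply: nb.
  by exists q.1 => //; move: tq; rewrite tau_eq // => /andP[_ /eqP].
have ln : (k.*2 + (C <= i) < n.*2)%N by case: (C <= i)%N; lia.
have tb : tau cont C (b, Ordinal ln) == (k * C.*2 + i)%N.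
  by rewrite tau_eq //= bc !eqxx.
rewrite (big_pred1 (b, Ordinal ln)) => [|q /=].
  rewrite (half _ tb) /= !psiE //; first by rewrite -bc cfg_rt.
  have /maximalP[bJ' bmax] := bJ.
  apply/forall_inP => c' /finset.setD1P[c'b c'J]; apply/forallP => b'; apply/implyP => b'c'.
  rewrite finset.in_setD1 (implyP (forallP (forall_inP idJ c' c'J) b') b'c') andbT.
  by apply: contraTneq b'c' => ->; apply: bmax.
apply/idP/eqP => [/and4P[tq _ mq _]|->].
  move: tq; rewrite tau_eq // => /andP[/eqP l2 /eqP cq].
  case: q l2 cq mq => [b' l] /= l2 cq mq; congr (_, _); last exact: val_inj.
  have /maximalP[bJ1 bm1] := bJ; have /maximalP[bJ2 bm2] := mq.
  have /cont_eq[//|h|h] : cont b' = cont b by rewrite cq bc.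
    by have := bm2 _ bJ1; rewrite h.
  by have := bm1 _ bJ2; rewrite h.
by rewrite tb bJ (half _ tb) fk /allowed (odd_q _ tb) /= bc al.
Qed.

Lemma Wsum_early k t (f : nat -> nat) J : (k < n)%N -> (t <= k * C.*2)%N ->
  (0 < f k)%N -> W t f J = 0.
Proof.
move=> kn tk fk; rewrite /Wsum big_pred0 // => T; apply/negP.
move=> /and4P[_ /forall_inP bT /forallP hT _].
have := hT (Ordinal kn);
  rewrite /count_value /= (_ : [set q in T | _] = finset.set0) ?cards0.
  by move=> /eqP fk0; rewrite -fk0 in fk.
apply/setP => q; rewrite !inE; apply/negP => /andP[qT /eqP qk].
have := bT _ qT; have := cont_lt q.1; rewrite /tau.
have := odd_double_half q.2; rewrite qk /= => l2.
have : (k * C.*2 <= q.2 * C)%N by rewrite -l2; lia.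
by case: ifP; lia.
Qed.

Lemma Wsum_vecU k (f : nat -> nat) J : (k <= n)%N -> ideal lt J ->
  (forall u, (k <= u < n)%N -> f u = 0%N) ->
  W (k * C.*2) f J = vecU w vacuum (mkseq f k) (enum_rank (cfg J)) 0.
Proof.
elim: k f J => [|k IHk] f J kn idJ fu.
  rewrite mul0n /vecU /= /vacuum colv_rank /Wsum.
  have [JE|J0] := eqVneq (cfg J) _.
    rewrite (cfg0 idJ JE) (big_pred1 finset.set0) => [|T]; first by rewrite !cards0.
    apply/idP/eqP => [/and4P[_ /forall_inP bT _ _]|->].
      by apply/setP => q; rewrite inE; apply/negP => /bT.
    apply/and4P; split; rewrite /esupp ?imset0 //.
    - by apply/validP; split=> [p q|p]; rewrite inE.
    - by apply/forall_inP => p; rewrite inE.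
    - apply/forallP => u; rewrite fu ?ltn_ord // /count_value cards_eq0;
      apply/eqP/setP => q.
      by rewrite !inE.
  rewrite big_pred0 // => T; apply/negP => /and4P[_ /forall_inP bT _ /eqP TJ].
  move/eqP: J0; apply; congr cfg; rewrite -TJ (_ : T = finset.set0) /esupp ?imset0 //.
  by apply/setP => q; rewrite inE; apply/negP => /bT.
(* Inner induction over the slots of variable k: after i slots the first i matrices of the word have
   acted. *)
have main i (g : nat -> nat) J' : (i <= C.*2)%N -> ideal lt J' ->
  (forall u, (k < u < n)%N -> g u = 0%N) ->
  W (k * C.*2 + i) g J' =
    (Uc (take i w) (g k) *m vecU w vacuum (mkseq g k)) (enum_rank (cfg J')) 0.
  elim: i g J' => [|i IHi] g J' iC idJ' gu.
    rewrite addn0 take0 /=; case gk : (g k) => [|a].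
      by rewrite mul1mx IHk ?(ltnW kn) // => u /andP[ku un]; case: (ltngtP k u) ku =>
        [ku _|//|<- _] //; apply: gu; rewrite ku.
    by rewrite mul0mx mxE (@Wsum_early k) // gk.
  rewrite addnS (@Wsum_word_step k i g
    (fun s => (Uc (take i w) (g k).-1 *m vecU w vacuum (mkseq g k)) (enum_rank s) 0)) //.
    rewrite IHi ?(ltnW iC) // colvK (take_nth 0) ?size_word // Uc_rcons mulmxDl [RHS]mxE.
    congr (_ + _); case: (g k) => [|a] /=; first by rewrite mul0mx mxE.
    by rewrite mulmxA.
  move=> J'' idJ''; rewrite IHi ?(ltnW iC) //; last first.
    by move=> u /andP[ku un]; rewrite /decr (gtn_eqF ku) gu // ku.
  rewrite {1}/decr eqxx (_ : mkseq (decr g k) k = mkseq g k) //.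
  by apply/eq_in_map => u; rewrite mem_iota /decr add0n => /andP[_ /ltn_eqF ->].
rewrite mulSn addnC main //.
rewrite take_oversize ?size_word //.
by rewrite /vecU mkseqS foldl_rcons.
Qed.

Lemma Wsum_entryU (f : nat -> nat) :
  W (n * C.*2) f finset.setT = entryU w vacuum (enum_rank (cfg finset.setT)) (mkseq f n).
Proof.
rewrite Wsum_vecU //; last by move=> u; lia.
by apply/forall_inP => c _; apply/forallP => b; rewrite inE implybT.
Qed.

Lemma before_all (T : {set P * 'I_n.*2}) : before cont C (n * C.*2) T.
Proof.
apply/forall_inP => q _; rewrite /tau; have := cont_lt q.1; have := ltn_ord q.2.
move=> qn cq; have : (q.2.+1 * C <= n.*2 * C)%N by rewrite leq_mul2r qn orbT.
have -> : (n * C.*2 = n.*2 * C)%N by lia.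
rewrite mulSn; move: (q.2 * C)%N (n.*2 * C)%N => x y h; apply: leq_trans h.
by rewrite addnC ltn_add2r; case: ifP => // _; rewrite ltnS leq_subr.
Qed.

End Transfer.

(** * Set-valued fillings as event sets *)

Section FillingSums.

Local Open Scope ring_scope.
Local Notation R := {poly int}.

Definition code (a : letter) : nat := (labs a).*2 + unprimed a.

Definition letter_of (l : nat) : letter := (l./2, odd l).

Lemma code_letter_of l : code (letter_of l) = l.
Proof. by rewrite /code /= addnC odd_double_half. Qed.

Lemma letter_of_code a : letter_of (code a) = a.
Proof.
case: a => k u; rewrite /letter_of /code /labs /unprimed /=.
by rewrite halfD oddD odd_double doubleK /=; case: u; rewrite ?addn0.
Qed.

Lemma letter_leE a b : (a <= b)%O = (code a <= code b)%N.
Proof.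
case: a b => [k u] [k' u']; rewrite lexi_pair !leEnat /code /labs /unprimed /=.
by case: u; case: u'; rewrite /Order.le /=; lia.
Qed.

Lemma letter_ltE a b : (a < b)%O = (code a < code b)%N.
Proof. by rewrite ltNge letter_leE ltnNge. Qed.

Variables (P : finType) (lt : rel P) (cont : P -> nat) (m : nat) (e : bool).
Local Notation C := m.+1.
Implicit Type S : {ffun P -> {fset letter}}.

Hypothesis cont_lt : forall b, (cont b < C)%N.

Definition ltau (b : P) (a : letter) : nat :=
  (code a * C + if unprimed a then cont b else C.-1 - cont b)%N.

(** Strict time order states all monotonicity rules at once: letters increase weakly, and a letter
    is shared by comparable boxes only in the direction of increasing content if unprimed, of
    decreasing content if primed. *)
Definition valid_filling S : Prop :=
  [/\ all_nonempty S,
      forall b c, lt b c -> forall a a', a \in S b -> a' \in S c -> (ltau b a < ltau c a')%N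
    & forall b a, a \in S b -> [|| e, unprimed a | cont b != 0%N]].

Section Events.

Variable n : nat.
Implicit Type T : {set P * 'I_n.*2}.

Let letter_ord (l : 'I_n.*2) : letter := letter_of l.

Definition filling_of T : {ffun P -> {fset letter}} :=
  [ffun b => [fset letter_ord l | l in [set l : 'I_n.*2 | (b, l) \in T]%SET]%fset].

Lemma letter_of_inj (l l' : 'I_n.*2) : letter_of l = letter_of l' -> l = l'.
Proof. by move=> /(congr1 code); rewrite !code_letter_of; apply: val_inj. Qed.

Lemma filling_ofP T b a :
  reflect (exists2 l : 'I_n.*2, (b, l) \in T & a = letter_of l) (a \in filling_of T b).
Proof.
rewrite ffunE; apply: (iffP (imfsetP _ _ _ _)) => -[l].
  by rewrite /= inE => lT ->; exists l.
by move=> lT ->; exists l; rewrite //= inE.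
Qed.

Lemma mem_filling_of T b (l : 'I_n.*2) : (letter_of l \in filling_of T b) = ((b, l) \in T).
Proof.
apply/filling_ofP/idP => [[l' l'T /letter_of_inj ->] //|lT]; by exists l.
Qed.

Lemma filling_of_inj : injective filling_of.
Proof.
move=> T T' TT'; apply/setP => -[b l].
by rewrite -!mem_filling_of TT'.
Qed.

Lemma sum_filling_of T (g : letter -> nat) :
  (\sum_b \sum_(a <- filling_of T b) g a)%N = (\sum_(q in T) g (letter_of q.2))%N.
Proof.
rewrite (eq_bigr (fun b => \sum_(l | (b, l) \in T) g (letter_of l))%N) => [|b _].
  by rewrite pair_big_dep /=; apply: eq_big => -[].
rewrite ffunE big_imfset /=; last by move=> l l' _ _ /letter_of_inj.
rewrite big_uniq ?enum_uniq //=; apply: eq_bigl => l.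
by rewrite mem_enum inE.
Qed.

Lemma total_size_filling_of T : total_size (filling_of T) = #|T|.
Proof.
rewrite /total_size -sum1_card -(sum_filling_of T (fun=> 1%N)).
by apply: eq_bigr => b _; rewrite sum1_size.
Qed.

Lemma xmonE S k : xmon S k = (\sum_b \sum_(a <- S b) (labs a == k))%N.
Proof.
rewrite /xmon (big_morph (fun u : {cmonom nat} => u k) (fun u u' => cmM k u u') (cm1 k)).
apply: eq_bigr => b _.
rewrite (big_morph (fun u : {cmonom nat} => u k) (fun u u' => cmM k u u') (cm1 k)).
by apply: eq_bigr => a _; rewrite cmU.
Qed.

Lemma xmon_filling_of T k :
  xmon (filling_of T) k = #|[set q in T | (q.2)./2 == k]%SET|.
Proof.
rewrite xmonE (sum_filling_of T (fun a =>
  labs a == k)) -sum1_card big_mkcond [RHS]big_mkcond.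
by apply: eq_bigr => q _; rewrite inE /=; case: (q \in T) => //=; case: eqP.
Qed.

Lemma xmon_eq_mon T a : size a = n ->
  (xmon (filling_of T) = mon a) <-> has_counts (nth 0%N a) T.
Proof.
move=> an; split=> [xT|/forallP hT].
  by apply/forallP => v; rewrite -monE -xT xmon_filling_of.
apply/eqP/cmP => k; rewrite monE xmon_filling_of.
have [kn|kn] := ltnP k n; first by rewrite -(eqP (hT (Ordinal kn))).
rewrite nth_default ?an //; apply/eqP; rewrite cards_eq0; apply/eqP/setP => q.
rewrite !inE; apply/negP => /andP[_ /eqP qk].
by have := ltn_ord q.2; have := odd_double_half q.2; rewrite qk; lia.
Qed.

Lemma valid_filling_of T :
  valid_filling (filling_of T) <-> valid lt cont C e T /\ esupp T = [set: P]%SET.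
Proof.
have tauE (b : P) (l : 'I_n.*2) : ltau b (letter_of l) = tau cont C (b, l).
  by rewrite /ltau code_letter_of.
split=> [[ne vT aT]|[/validP[vT aT] sT]].
  split.
    apply/validP; split=> [[b l] [c l'] qT q'T bc|[b l] qT].
      by rewrite -!tauE; apply: vT bc _ _ _ _; rewrite mem_filling_of.
    by apply: (aT b (letter_of l)); rewrite mem_filling_of.
  apply/setP => b; rewrite inE; have := ne b => /fset0Pn[a /filling_ofP[l lT _]].
  by apply/imsetP; exists (b, l).
split.
- move=> b; have : b \in esupp T by rewrite sT inE.
  move=> /imsetP[[b' l] lT /= ->]; apply/fset0Pn; exists (letter_of l).
  by rewrite mem_filling_of.
- move=> b c bc a a' /filling_ofP[l lT ->] /filling_ofP[l' l'T ->].
  by rewrite !tauE; apply: vT.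
- by move=> b a /filling_ofP[l lT ->]; apply: (aT (b, l)).
Qed.

End Events.

Lemma genfun_Wsum a : genfun [set S | valid_filling S] #|P| (mon a) =
  Wsum lt cont C e (size a) (size a * C.*2) (nth 0%N a) [set: P]%SET.
Proof.
set n := size a.
pose D := [set T : {set P * 'I_n.*2} | [&& valid lt cont C e T,
  before cont C (n * C.*2) T, has_counts (nth 0%N a) T & esupp T == [set: P]%SET]]%SET.
pose r := [seq filling_of T | T <- enum D].
have DP T : T \in D -> valid_filling (filling_of T) /\ xmon (filling_of T) = mon a.
  rewrite inE => /and4P[vT _ hT /eqP sT]; split; first exact/valid_filling_of.
  exact/xmon_eq_mon.
rewrite /genfun /psum (fsbigE r).
- rewrite big_map big_enum_cond /= /Wsum cardsT.
  apply: eq_big => T.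
    rewrite inE; case: (boolP (T \in D)) => TD; rewrite -?/n.
      by move: (TD); rewrite inE => ->; apply/mem_set; have [] := DP _ TD.
    by move: TD; rewrite inE => /negPf ->.
  by move=> /andP[TD _]; rewrite /mono_series (DP _ TD).2 eqxx total_size_filling_of.
- by rewrite map_inj_uniq ?enum_uniq //; apply: filling_of_inj.
- by move=> S /= /mapP[T]; rewrite mem_enum => /DP[vT _] ->.
- move=> S vS; rewrite /mono_series; case: eqP => // xS /mapP[].
  pose T := [set q : P * 'I_n.*2 | letter_of q.2 \in S q.1]%SET.
  have ST : S = filling_of T.
    apply/ffunP => b; apply/fsetP => x; apply/idP/filling_ofP => [xb|[l lT ->]]; last first.
      by move: lT; rewrite inE.
    (* A letter of larger value would give x^a a variable beyond the entries of [a]. *)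
    have xn : (labs x < n)%N.
      rewrite ltnNge; apply/negP => nx.
      have := monE a (labs x); rewrite xS xmonE nth_default // => /eqP.
      rewrite sum_nat_eq0 => /forallP/(_ b) /=; rewrite sum_nat_seq_eq0 => /allP/(_ x xb).
      by rewrite /= eqxx.
    have cn : (code x < n.*2)%N by rewrite /code; case: (unprimed x); lia.
    by exists (Ordinal cn); rewrite ?inE /= letter_of_code.
  exists T => //; rewrite mem_enum inE before_all //=.
  have [vT ->] : valid lt cont C e T /\ esupp T = [set: P]%SET.
    by apply/valid_filling_of; rewrite -ST.
  rewrite vT eqxx andbT /=; apply/xmon_eq_mon => //.
  by rewrite -ST -xS.
Qed.

End FillingSums.

(** * Leading terms *)

Section LeadingTerms.

Local Open Scope ring_scope.
Local Notation R := {poly int}.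

Variables (P : finType) (lt : rel P) (row cont : P ->
  nat) (m : nat) (e : bool) (al : seq nat).
Local Notation C := m.+1.

Hypothesis al_peak : peak_composition al.
Hypothesis cont_lt : forall b, (cont b < C)%N.
Hypothesis row_lt : forall b, (row b < size al)%N.
Hypothesis cont_row : forall b, (cont b < nth 0%N al (row b))%N.
Hypothesis box_ex : forall i j, (i < size al)%N -> (j < nth 0%N al i)%N ->
  exists2 b, row b = i & cont b = j.
Hypothesis box_inj : forall b c, row b = row c -> cont b = cont c -> b = c.
Hypothesis lt_row : forall b c, lt b c -> (row b <= row c)%N.
Hypothesis lt_same : forall b c, row b = row c -> lt b c = (cont b < cont c)%N.
(** In a shifted shape the first two boxes of a row lie weakly above and to the left of the diagonal
    boxes of all later rows; in a chain every earlier row precedes. *)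
Hypothesis lt_next : forall b c, (row b < row c)%N -> cont c = 0%N ->
  (cont b <= 1)%N -> lt b c.

Lemma card_row i : (i < size al)%N -> #|[set b | row b == i]%SET| = nth 0%N al i.
Proof.
move=> il; rewrite -[RHS](size_iota 0) cardE -(size_map cont).
apply/perm_size/uniq_perm; rewrite ?iota_uniq //.
  rewrite map_inj_in_uniq ?enum_uniq // => b c.
  by rewrite !mem_enum !inE => /eqP rb /eqP rc; apply: box_inj; rewrite rb.
move=> j; rewrite mem_iota /= add0n; apply/mapP/idP => [[b]|jl].
  by rewrite mem_enum inE => /eqP <- ->.
have [b rb cb] := box_ex il jl.
by exists b => //; rewrite mem_enum inE rb.
Qed.

Lemma card_boxes : #|P| = sumn al.
Proof.
rewrite -cardsT -sum1_card (partition_big (fun b => Ordinal (row_lt b)) xpredT) //=.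
rewrite sumnE (big_nth 0%N) big_mkord; apply: eq_bigr => i _.
rewrite -(card_row (ltn_ord i)) -sum1_card; apply: eq_bigl => b.
by rewrite !inE.
Qed.

Section Counts.

Variable n : nat.
Implicit Type T : {set P * 'I_n.*2}.

Lemma card_counts f T : has_counts f T -> #|T| = (\sum_(v < n) f v)%N.
Proof.
move=> /forallP hT; rewrite -sum1_card (partition_big (@halfo P n) xpredT) //=.
apply: eq_bigr => v _; rewrite -(eqP (hT v)) /count_value -sum1_card; apply: eq_bigl => q.
by rewrite inE.
Qed.

Lemma tau_lt (p q : P * 'I_n.*2) : (tau cont C p < tau cont C q)%N ->
  (p.2 < q.2)%N \/ p.2 = q.2 :> nat /\
    if odd p.2 then (cont p.1 < cont q.1)%N else (cont q.1 < cont p.1)%N.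
Proof.
have := cont_lt p.1; have := cont_lt q.1; rewrite /tau => cq cp.
have [pq|qp|pq] := ltngtP p.2 q.2; first by left.
  have : (q.2.+1 * C <= p.2 * C)%N by rewrite leq_mul2r qp orbT.
  by rewrite mulSn; case: ifP => _; case: ifP => _; lia.
rewrite pq ltn_add2l => h; right; split=> //.
by move: h; case: ifP => _; lia.
Qed.

Lemma tau_le2 (p q : P * 'I_n.*2) : (tau cont C p <= tau cont C q)%N -> (p.2 <= q.2)%N.
Proof.
have := cont_lt p.1; have := cont_lt q.1; rewrite /tau => cq cp.
move=> h; rewrite leqNgt; apply/negP => qp.
have : (q.2.+1 * C <= p.2 * C)%N by rewrite leq_mul2r qp orbT.
by rewrite mulSn; move: h; case: ifP => _; case: ifP => _; lia.
Qed.

Lemma tau_letter (p q : P * 'I_n.*2) : (p.2 < q.2)%N -> (tau cont C p < tau cont C q)%N.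
Proof. by rewrite !ltnNge; apply: contra => /tau_le2. Qed.

Section Tableau.

Variables (f : nat -> nat) (T : {set P * 'I_n.*2}).
Hypothesis vT : valid lt cont C e T.
Hypothesis hT : has_counts f T.
Hypothesis sT : esupp T = finset.setT.
Hypothesis cT : #|T| = #|P|.

Lemma event_ex b : exists2 q, q \in T & q.1 = b.
Proof.
have : b \in esupp T by rewrite sT inE.
by move=> /imsetP[q qT ->]; exists q.
Qed.

Lemma event_inj : {in T &, injective fst}.
Proof. by apply/imset_injP; rewrite -/(esupp T) sT cardsT cT. Qed.

(** The four letters all lie between i' and i, so they change at most once. *)
Lemma letter_squeeze (l1 l2 ld l i : nat) : l./2 = i -> (i <= l1./2)%N ->
  (l1 <= l2)%N -> (l2 <= ld)%N -> (ld <= l)%N ->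
  ((l1 < l2)%N -> l2 = ld /\ odd l2) /\ ((l2 < ld)%N -> l1 = l2 /\ ~~ odd l2).
Proof.
have := odd_double_half l; have := odd_double_half l1; have := odd_double_half l2.
move: (l./2) (l1./2) (l2./2) => k k1 k2.
by case: (odd l); case: (odd l1); case: (odd l2) => /= *; split=> ?; split=> //; lia.
Qed.

(** Suppose value i occurs in a later row. Row i then has at least two boxes; these and the first
    box d of that later row carry i' or i. Passing from content 0 to 1 forces the second box to be
    unprimed i, and then d, of content 0 and later in time, would need a larger letter. *)
Lemma tableau_row i : (i < size al)%N ->
  (forall q, q \in T -> ((q.2)./2 < i)%N = (row q.1 < i)%N) ->
  forall q, q \in T -> (q.2)./2 = i -> row q.1 = i.
Proof.
move=> il IH q qT qi; have [vT1 _] := validP _ _ _ _ _ vT.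
have ir : (i <= row q.1)%N by rewrite leqNgt -IH // qi ltnn.
apply/eqP; rewrite eqn_leq ir andbT leqNgt; apply/negP => {}ir.
have [al1 al2] := al_peak.
have al_i : (1 < nth 0%N al i)%N by apply: al2; apply: leq_ltn_trans ir (row_lt _).
have al_r : (0 < nth 0%N al (row q.1))%N by apply: leq_ltn_trans (cont_row _).
have [b1 rb1 cb1] := box_ex il (ltnW al_i).
have [b2 rb2 cb2] := box_ex il al_i.
have [d rd cd] := box_ex (row_lt _) al_r.
have [q1 q1T q1b] := event_ex b1; have [q2 q2T q2b] := event_ex b2.
have [qd qdT qdb] := event_ex d.
have t12 : (tau cont C q1 < tau cont C q2)%N.
  by apply: vT1 => //; rewrite q1b q2b lt_same ?rb1 ?rb2 // cb1 cb2.
have t2d : (tau cont C q2 < tau cont C qd)%N.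
  by apply: vT1 => //; rewrite q2b qdb; apply: lt_next; rewrite ?rb2 ?rd ?cb2.
have tdq : (tau cont C qd <= tau cont C q)%N.
  have [c0|c0] := posnP (cont q.1).
    by rewrite (event_inj qdT qT) // qdb; apply: box_inj; rewrite ?rd ?cd.
  by apply/ltnW/vT1 => //; rewrite qdb lt_same ?rd // cd.
have i1 : (i <= (q1.2)./2)%N by rewrite leqNgt IH // q1b rb1 ltnn.
have l12 := tau_le2 (ltnW t12); have l2d := tau_le2 (ltnW t2d); have ldq := tau_le2 tdq.
have [h1 h2] := letter_squeeze qi i1 l12 l2d ldq.
have odd2 : odd q2.2.
  case: (tau_lt t12) => [/h1[_ //]|[h12]].
  by rewrite q1b q2b cb1 cb2 h12; case: ifP.
case: (tau_lt t2d) => [/h2[_]|[_]]; rewrite odd2 //.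
by rewrite q2b qdb cb2 cd.
Qed.

Lemma tableau_count i (iN : (i < n)%N) : f i = #|[set q.1 | q in [set q in T | (q.2)./2 == i]%SET]%SET|.
Proof.
have /eqP <- := forallP hT (Ordinal iN).
rewrite card_in_imset // => q q'; rewrite !inE => /andP[qT _] /andP[q'T _].
exact: event_inj.
Qed.

(** Value i lies inside row i by [tableau_row] and occurs as often as the row has boxes, so it fills
    the row. *)
Lemma tableau_prefix i : (i <= size al)%N -> (i <= n)%N ->
  (forall j, (j < i)%N -> f j = nth 0%N al j) ->
  forall q, q \in T -> ((q.2)./2 < i)%N = (row q.1 < i)%N.
Proof.
elim: i => // i IH il iN fi.
have {}IH : forall q, q \in T -> ((q.2)./2 < i)%N = (row q.1 < i)%N.
  by apply: IH; [apply: ltnW|apply: ltnW|move=> j ji; apply: fi; apply: ltnW].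
have sub := tableau_row il IH.
have imE : [set q.1 | q in [set q in T | (q.2)./2 == i]%SET]%SET = [set b | row b == i]%SET.
  apply/eqP; rewrite eqEcard; apply/andP; split.
    by apply/fintype.subsetP => b /imsetP[q]; rewrite !inE => /andP[qT /eqP qi] ->;
      rewrite (sub q qT qi).
  by rewrite card_row // -fi // tableau_count.
have step x : (x < i.+1)%N = (x == i) || (x < i)%N by rewrite ltnS leq_eqVlt.
move=> q qT; rewrite !step IH //; congr (_ || _).
apply/eqP/eqP => [qi|ri]; first exact: sub.
have : q.1 \in [set b | row b == i]%SET by rewrite inE ri.
rewrite -imE => /imsetP[q']; rewrite inE => /andP[q'T /eqP <-] qq'.
by rewrite (event_inj qT q'T).
Qed.

Lemma tableau_bound i : (i < size al)%N -> (i < n)%N ->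
  (forall j, (j < i)%N -> f j = nth 0%N al j) -> (f i <= nth 0%N al i)%N.
Proof.
move=> il iN fi; rewrite (tableau_count iN) -(card_row il); apply: subset_leq_card.
apply/fintype.subsetP => b /imsetP[q]; rewrite !inE => /andP[qT /eqP qi] ->.
apply/eqP; apply: (tableau_row il _ qT qi).
by apply: tableau_prefix; try exact: ltnW.
Qed.

End Tableau.

End Counts.

Local Notation E a := (Wsum lt cont C e (size a) (size a * C.*2) (nth 0%N a) finset.setT).

Lemma sumn_counts a : sumn a = (\sum_(v < size a) nth 0%N a v)%N.
Proof. by rewrite sumnE (big_nth 0%N) big_mkord. Qed.

Lemma lead_low a : (sumn a < sumn al)%N -> E a = 0.
Proof.
move=> aal; rewrite /Wsum big_pred0 // => T; apply/negP => /and4P[_ _ hT /eqP sT].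
have := card_esupp T; rewrite sT cardsT card_boxes (card_counts hT) -sumn_counts.
by rewrite leqNgt aal.
Qed.

Lemma lead_lex s x y t u : al = s ++ x :: t -> sumn (s ++ y :: u) = sumn al -> (x < y)%N ->
  E (s ++ y :: u) = 0.
Proof.
set a := s ++ y :: u => alE aal xy.
rewrite /Wsum big_pred0 // => T; apply/negP => /and4P[vT _ hT /eqP sT].
have cT : #|T| = #|P| by rewrite card_boxes (card_counts hT) -sumn_counts.
have := tableau_bound vT hT sT cT (i := size s).
rewrite alE /a !size_cat /= !nth_cat !ltnn subnn /= => h.
suff : (y <= x)%N by rewrite leqNgt xy.
by apply: h; try lia; move=> j js; rewrite !nth_cat js.
Qed.

Section Top.

Local Notation n := (size al).

(* Row i of the leading tableaux carries only the letters i' and i; [g] says in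
   which rows the first box is unprimed. *)
Definition top_letter (g : {ffun 'I_n -> bool}) b : nat :=
  (row b).*2 + ((0 < cont b)%N || g (Ordinal (row_lt b))).

Lemma top_letter_lt g b : (top_letter g b < n.*2)%N.
Proof. by have := row_lt b; rewrite /top_letter; case: (_ || _); lia. Qed.

Definition top_event g b : P * 'I_n.*2 := (b, Ordinal (top_letter_lt g b)).

Definition top_tableau g : {set P * 'I_n.*2} := [set top_event g b | b in P]%SET.

Lemma mem_top g q : (q \in top_tableau g) = (q.2 == top_letter g q.1 :> nat).
Proof.
apply/imsetP/eqP => [[b _ ->] //|qE]; exists q.1 => //.
by case: q qE => b l /= lE; congr (_, _); apply: val_inj.
Qed.

Lemma half_top g b : (top_letter g b)./2 = row b.
Proof. by rewrite /top_letter halfD odd_double doubleK; case: (_ || _); rewrite addn0. Qed.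

Lemma odd_top g b : odd (top_letter g b) = (0 < cont b)%N || g (Ordinal (row_lt b)).
Proof. by rewrite /top_letter oddD odd_double; case: (_ || _). Qed.

Lemma card_top g : #|top_tableau g| = #|P|.
Proof. by rewrite card_imset // => b c [->]. Qed.

Lemma top_ok (g : {ffun 'I_n -> bool}) : e || [forall i, g i] ->
  [&& valid lt cont C e (top_tableau g),
  before cont C (n * C.*2) (top_tableau g), has_counts (nth 0%N al) (top_tableau g)
  & esupp (top_tableau g) == finset.setT].
Proof.
move=> eg; apply/and4P; split.
- apply/validP; split=> [p q|p].
    rewrite !mem_top => /eqP pE /eqP qE pq.
    have := lt_row pq; rewrite leq_eqVlt => /orP[/eqP rr|rr].
      have cc : (cont p.1 < cont q.1)%N by rewrite -lt_same.
      have cq0 : (0 < cont q.1)%N := leq_ltn_trans (leq0n _) cc.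
      have oq : odd q.2 by rewrite qE odd_top cq0.
      have lpq : (p.2 <= q.2)%N.
        by rewrite pE qE /top_letter cq0; case: (_ || g _); move: rr => /=; lia.
      move: lpq; rewrite leq_eqVlt => /orP[/eqP lpq|]; last exact: tau_letter.
      by rewrite /tau lpq oq ltn_add2l.
    apply: tau_letter; rewrite pE qE /top_letter.
    move: rr; rewrite -leq_double doubleS; move: (_.*2) (_.*2) => x y.
    by case: (_ || g _); case: (_ || g _); rewrite ?addn0 ?addn1 => /ltnW //;
      apply: leq_trans.
  rewrite mem_top => /eqP pE; rewrite /allowed pE odd_top; case: (posnP (cont p.1)) =>
    //=; last by rewrite orbT.
  by move: eg => /orP[->|/forallP gP] //; rewrite gP orbT.
- exact: before_all.
- apply/forallP => v; rewrite /count_value -(card_row (ltn_ord v)).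
  rewrite -(card_imset _ (f := top_event g)); last by move=> b c [->].
  apply/eqP/eq_card => q; rewrite inE mem_top; apply/andP/imsetP => [[/eqP qE qv]|[b]].
    exists q.1; first by rewrite inE -(half_top g) -qE.
    by case: q qE {qv} => b l /= lE; congr (_, _); apply: val_inj.
  by rewrite inE => /eqP <- ->; rewrite /= half_top !eqxx.
- apply/eqP/setP => b; rewrite inE; apply/imsetP; exists (top_event g b) => //.
  by rewrite mem_top.
Qed.

Lemma top_inj : injective top_tableau.
Proof.
move=> g g' gg'; apply/ffunP => i.
have [_ al2] := al_peak; have [al1 _] := al_peak.
have ai : (0 < nth 0%N al i)%N by apply: (allP al1); apply: mem_nth.
have [b rb cb] := box_ex (ltn_ord i) ai.
have : top_event g b \in top_tableau g' by rewrite -gg' mem_top.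
rewrite mem_top /= => /eqP/(congr1 odd); rewrite !odd_top cb /=.
by rewrite (_ : Ordinal (row_lt b) = i) //; apply: val_inj.
Qed.

(** Row i carries only i' and i. Since i' is repeated only towards smaller content, every box but
    the first of the row is unprimed, and the first one is a free choice if [e] holds and unprimed
    otherwise. *)
Lemma top_all (T : {set P * 'I_n.*2}) :
  [&& valid lt cont C e T, before cont C (n * C.*2) T, has_counts (nth 0%N al) T
    & esupp T == finset.setT] ->
  exists2 g : {ffun 'I_n -> bool}, T = top_tableau g & e || [forall i, g i].
Proof.
move=> /and4P[vT _ hT /eqP sT].
have cT : #|T| = #|P| by rewrite card_boxes (card_counts hT) -sumn_counts.
have [vT1 vT2] := validP _ _ _ _ _ vT.
have half q : q \in T -> (q.2)./2 = row q.1.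
  move=> qT; have pre := fun i il => tableau_prefix vT hT sT cT (i :=
    i) il il (fun j _ => erefl).
  have h1 := pre (row q.1) (ltnW (row_lt _)) q qT.
  have h2 := pre (row q.1).+1 (row_lt _) q qT.
  by apply/eqP; rewrite eqn_leq -ltnS h2 ltnSn leqNgt h1 ltnn.
pose g : {ffun 'I_n -> bool} := [ffun i : 'I_n =>
  [exists q in T, [&& row q.1 == i, cont q.1 == 0%N & odd q.2]]].
exists g; last first.
  case: (boolP e) => //= ne; apply/forallP => i; rewrite ffunE.
  have [al1 _] := al_peak.
  have ai : (0 < nth 0%N al i)%N by apply: (allP al1); apply: mem_nth.
  have [b rb cb] := box_ex (ltn_ord i) ai.
  have [q qT qb] := event_ex sT b; apply/exists_inP; exists q => //.
  by have := vT2 q qT; rewrite /allowed qb rb cb !eqxx (negPf ne) /= orbF => ->.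
have sub : T \subset top_tableau g.
  apply/fintype.subsetP => q qT;
    rewrite mem_top /top_letter -[X in X == _]odd_double_half half //.
  rewrite [X in X == _]addnC eqn_add2l; apply/eqP/esym; congr nat_of_bool.
  have [c0|c0] /= := posnP (cont q.1).
    rewrite ffunE; apply/exists_inP/idP => [[q' q'T /and3P[/eqP rr /eqP cc oq']]|oq].
      by rewrite -(event_inj sT cT q'T qT) //; apply: box_inj; rewrite ?cc.
    by exists q => //; rewrite eqxx c0.
  symmetry.
  have [b0 rb cb] := box_ex (row_lt q.1) (leq_ltn_trans (leq0n _) (cont_row q.1)).
  have [q0 q0T q0b] := event_ex sT b0.
  have t0 : (tau cont C q0 < tau cont C q)%N.
    by apply: vT1 => //; rewrite q0b lt_same ?rb // cb.
  have h0 := half q0 q0T; have h := half q qT; rewrite q0b rb in h0.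
  have := odd_double_half q0.2; have := odd_double_half q.2; rewrite h0 h.
  case: (tau_lt t0) => [lt0|[le0]]; last first.
    by rewrite q0b cb -le0; case: ifP.
  by case: (odd q.2); case: (odd q0.2) => //=; lia.
by apply/eqP; rewrite eqEcard sub card_top cT leqnn.
Qed.

Lemma lead_coeff : E al = if e then 2%:R ^+ size al else 1.
Proof.
rewrite /Wsum (eq_bigr (fun=> 1)) => [|T /top_all[g -> _]]; last first.
  by rewrite card_top cardsT subnn.
have [ee|ne] : e = true \/ e = false by case: (e); [left|right].
  rewrite [in RHS]ee.
  rewrite -natrX -[in RHS]card_bool -[in X in (_ ^ X)%N](card_ord n) -card_ffun -cardsT.
  rewrite -(card_imset _ top_inj) -sum1_card natr_sum; apply: eq_bigl => T.
  apply/idP/imsetP => [okT|[g _ ->]].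
    by have [g -> _] := top_all okT; exists g.
  by apply: top_ok; rewrite ee.
rewrite [in RHS]ne (big_pred1 (top_tableau [ffun=> true])) // => T.
apply/idP/eqP => [okT|->].
  have [g ->] := top_all okT.
  rewrite ne /= => /forallP gP; congr top_tableau; apply/ffunP => i.
  by rewrite ffunE gP.
by apply: top_ok; apply/orP; right; apply/forallP => i; rewrite ffunE.
Qed.

End Top.

End LeadingTerms.

(** * Multipeak functions *)

Section Family.

Local Open Scope ring_scope.

Variables (P : finType) (lt : rel P) (row cont : P ->
  nat) (m : nat) (e s : bool) (al : seq nat).
Local Notation C := m.+1.

Hypothesis al_peak : peak_composition al.
Hypothesis cont_lt : forall b, (cont b < C)%N.
Hypothesis row_lt : forall b, (row b < size al)%N.
Hypothesis cont_row : forall b, (cont b < nth 0%N al (row b))%N.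
Hypothesis box_ex : forall i j, (i < size al)%N -> (j < nth 0%N al i)%N ->
  exists2 b, row b = i & cont b = j.
Hypothesis box_inj : forall b c, row b = row c -> cont b = cont c -> b = c.
Hypothesis lt_row : forall b c, lt b c -> (row b <= row c)%N.
Hypothesis lt_same : forall b c, row b = row c -> lt b c = (cont b < cont c)%N.
Hypothesis lt_next : forall b c, (row b < row c)%N -> cont c = 0%N ->
  (cont b <= 1)%N -> lt b c.
Hypothesis cont_eq : forall b c, cont b = cont c -> [\/ b = c, lt b c | lt c b].

Variables (St : finType) (cfg : {set P} -> St).
Variables (rm : nat -> pred St) (rt : nat -> St -> St).

Hypothesis cfg_rm : forall J c, ideal lt J ->
  reflect (exists2 b, maximal lt b J & cont b = c) (rm c (cfg J)).
Hypothesis cfg_rt : forall J b, ideal lt J -> maximal lt b J ->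
  rt (cont b) (cfg J) = cfg (J :\ b).
Hypothesis cfg0 : forall J, ideal lt J -> cfg J = cfg finset.set0 -> J = finset.set0.
Hypothesis rm_rt : forall c x, rm c x -> ~~ rm c (rt c x).

Let w := word e (fun c => vmx beta (rm c) (rt c)) m.

Hypothesis comm : s -> forall p q, Uc w p *m Uc w q = Uc w q *m Uc w p.

Variable F : pseries.
Hypothesis FE : F = genfun [set S | valid_filling lt cont m e S] #|P|.

Let hatE a : hat F a =
  Wsum lt cont C e (size a) (size a * C.*2) (nth 0%N a) finset.setT.
Proof. by rewrite /hat FE genfun_Wsum. Qed.

(** All that the span criterion asks of a family member, obtained from rows, contents and states
    alone; it serves both chains and shifted shapes. *)
Lemma family_spec : [/\ peak_series e s (hat F), vanish_below (sumn al) (hat F),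
  hat F al = (if e then 2%:R ^+ size al else 1) & lexmax (sumn al) (hat F) al].
Proof.
have lt_irr : irreflexive lt by move=> b; rewrite lt_same // ltnn.
split.
- have -> : hat F = entryU w (vacuum cfg) (enum_rank (cfg finset.setT)).
    apply/funext => a;
      rewrite hatE (Wsum_entryU e (size a) lt_irr cont_lt cont_eq cfg_rm cfg_rt cfg0).
    by rewrite mkseq_nth.
  by apply: word_peak_series comm => k; apply: vmx_idem; apply: rm_rt.
- by move=> a aal; rewrite hatE; apply: (lead_low _ _ _ row_lt cont_row box_ex box_inj).
- by rewrite hatE;
  apply: (lead_coeff e al_peak cont_lt row_lt cont_row box_ex box_inj lt_row lt_same lt_next).
- move=> a pa aal; have [al1 _] := al_peak.
  move=> /(lexltP al1 pa (esym aal))[u [x [y [t [t' [alE aE xy]]]]]].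
  rewrite hatE aE; apply: (lead_lex e al_peak cont_lt row_lt cont_row box_ex box_inj
    lt_same lt_next alE _ xy).
  by rewrite -aE.
Qed.

End Family.

Lemma ltau_ltE (P : finType) (cont : P -> nat) m (b c : P) (a a' : letter) :
  (forall b, (cont b < m.+1)%N) ->
  (ltau cont m b a < ltau cont m c a')%N = (code a < code a')%N ||
    ((a == a') && if unprimed a then (cont b < cont c)%N else (cont c < cont b)%N).
Proof.
move=> cont_lt; have cb := cont_lt b; have cc := cont_lt c.
have mulD x y u v : (u < m.+1)%N -> (v < m.+1)%N ->
    (x * m.+1 + u < y * m.+1 + v)%N = (x < y)%N || ((x == y) && (u < v)%N).
  move=> um vm; have [xy|xy|->] := ltngtP x y; last by rewrite ltn_add2l.
    have : (x.+1 * m.+1 <= y * m.+1)%N by rewrite leq_mul2r xy orbT.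
    by rewrite mulSn /=; lia.
  have : (y.+1 * m.+1 <= x * m.+1)%N by rewrite leq_mul2r xy orbT.
  by rewrite mulSn /=; lia.
rewrite /ltau mulD; [|case: ifP => _; lia|case: ifP => _; lia].
have -> : (code a == code a') = (a == a').
  by apply/eqP/eqP => [|-> //] /(congr1 letter_of); rewrite !letter_of_code.
by case: eqP => // ->; case: ifP => _ //=; congr (_ || _); lia.
Qed.

(** * The chain of positions of a peak composition *)

Section Chain.

Variable al : seq nat.
Hypothesis al_peak : peak_composition al.

Local Notation P := 'I_(sumn al).
Local Notation m := (sumn al).

Definition ch_lt (b c : P) : bool := (b < c)%N.
Definition ch_row (b : P) : nat := reshape_index al b.
(** The content is the offset within the block: it rises by one inside a block and drops to 0 at a
    descent, which matches the letters that neighbours may share. *)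
Definition ch_cont (b : P) : nat := reshape_offset al b.

Lemma ch_row_lt b : (ch_row b < size al)%N.
Proof. exact: reshape_indexP. Qed.

Lemma ch_cont_row b : (ch_cont b < nth 0%N al (ch_row b))%N.
Proof. exact: reshape_offsetP. Qed.

Lemma ch_ltE b c : ch_lt b c = (ch_row b < ch_row c)%N ||
  ((ch_row b == ch_row c) && (ch_cont b < ch_cont c)%N).
Proof.
rewrite /ch_lt /ch_row /ch_cont ltnNge (reshape_leq al) /=.
by case: (ltngtP (reshape_index al b)) => //= _; rewrite -ltnNge.
Qed.

Lemma ch_cont_lt b : (ch_cont b < m.+1)%N.
Proof.
rewrite /ch_cont /reshape_offset ltnS (leq_trans (leq_subr _ _)) //.
exact/ltnW/ltn_ord.
Qed.

Lemma ch_flatten_lt i j : (i < size al)%N -> (j < nth 0%N al i)%N ->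
  (flatten_index al i j < sumn al)%N.
Proof.
move=> il jl; rewrite /flatten_index -[X in (_ < sumn X)%N](cat_take_drop i al).
by rewrite sumn_cat ltn_add2l (drop_nth 0%N) //=; apply: ltn_addr.
Qed.

Lemma ch_box_ex i j : (i < size al)%N -> (j < nth 0%N al i)%N ->
  exists2 b, ch_row b = i & ch_cont b = j.
Proof.
move=> il jl; exists (Ordinal (ch_flatten_lt il jl)).
  exact: flatten_indexKl.
exact: flatten_indexKr.
Qed.

Lemma ch_box_inj b c : ch_row b = ch_row c -> ch_cont b = ch_cont c -> b = c.
Proof.
rewrite /ch_row /ch_cont => rr cc; apply: val_inj.
by rewrite /= -(reshape_indexK al b) rr cc reshape_indexK.
Qed.

(** At a block boundary the earlier block is not the last one, so it has at least two positions and
    ends with a positive content: the drop to 0 is strict. *)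
Lemma ch_succ (b c : P) : c = b.+1 :> nat ->
  ch_cont c = 0%N /\ (0 < ch_cont b)%N \/ ch_cont c = (ch_cont b).+1.
Proof.
move=> cb; have bc : ch_lt b c by rewrite /ch_lt cb.
have nobetween d : ch_lt b d -> ch_lt d c -> False by rewrite /ch_lt cb; lia.
move: (bc); rewrite ch_ltE => /orP[rr|/andP[/eqP rr cc]]; last first.
  right; apply/eqP; rewrite eqn_leq cc andbT leqNgt; apply/negP => cc'.
  have [d dr dc] := ch_box_ex (ch_row_lt b) (j := (ch_cont b).+1)
    (ltn_trans cc' (eq_ind_r (fun r => (ch_cont c < nth 0%N al r)%N) (ch_cont_row c) rr)).
  apply: (nobetween d); rewrite ch_ltE dr dc ?rr eqxx ltnn //=.
have c0 : ch_cont c = 0%N.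
  apply/eqP; rewrite -leqn0 leqNgt; apply/negP => cc.
  have [d dr dc] := ch_box_ex (ch_row_lt c) (j :=
    0%N) (leq_ltn_trans (leq0n _) (ch_cont_row c)).
  by apply: (nobetween d); rewrite ch_ltE dr dc ?rr ?eqxx ?cc ?orbT.
left; split=> //; rewrite lt0n; apply/negP => /eqP b0.
have [_ al2] := al_peak.
have [|d dr dc] := ch_box_ex (ch_row_lt b) (j := 1%N).
  by apply: al2; apply: leq_ltn_trans rr (ch_row_lt c).
by apply: (nobetween d); rewrite ch_ltE dr dc ?rr ?b0 ?eqxx ?ltnn.
Qed.

Lemma mem_descents (j : P) : (val j \in descents al) = (0 < j)%N && (ch_cont j == 0%N).
Proof.
have [al1 _] := al_peak.
have pos k : (k < size al)%N -> (0 < nth 0%N al k)%N.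
  by move=> kl; apply: (allP al1); apply: mem_nth.
apply/mapP/andP => [[k]|[j0 /eqP c0]].
  rewrite mem_iota => /andP[k0 kl] jE.
  have kl' : (k < size al)%N by lia.
  have jE' : val j = flatten_index al k 0 by rewrite /flatten_index addn0.
  split; last by rewrite /ch_cont jE' flatten_indexKr ?pos.
  have := pos 0%N (leq_ltn_trans (leq0n _) kl').
  by rewrite -[nat_of_ord j]/(val j) jE; case: k k0 {kl kl' jE jE'} => // k _;
    case: (al) => //= x t; lia.
have jE : sumn (take (ch_row j) al) = j.
  by rewrite -[RHS](reshape_indexK al j) -/(ch_cont j) c0 /flatten_index addn0.
exists (ch_row j); last by rewrite jE.
rewrite mem_iota; have := ch_row_lt j.
have r0 : (0 < ch_row j)%N by rewrite lt0n; apply: contraTneq j0 => r0;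
  rewrite -jE r0 take0.
by rewrite r0 /=; lia.
Qed.

Lemma ch_ideal J i : ideal ch_lt J -> (i \in J) = (i < #|J|)%N.
Proof.
move=> /forall_inP idJ; have idJ' (c b : P) : c \in J -> (b < c)%N -> b \in J.
  by move=> cJ bc; apply: (implyP (forallP (idJ c cJ) b)).
have cardI k : (k <= sumn al)%N -> #|[set b : P | (b < k)%N]%SET| = k.
  move=> kl; have winj : injective (widen_ord kl) by move=> x y /(congr1 val) /= xy;
    apply: val_inj.
  rewrite -[RHS]card_ord -(card_imset _ winj).
  apply/eq_card => b; rewrite inE; apply/idP/imsetP => [bk|[j _ ->]];
    last by rewrite /= ltn_ord.
  by exists (Ordinal bk) => //; apply: val_inj.
apply/idP/idP => [iJ|].
  rewrite -(cardI i.+1) //; apply: subset_leq_card; apply/fintype.subsetP => b.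
  rewrite inE ltnS leq_eqVlt => /orP[/eqP/val_inj -> //|]; exact: idJ'.
apply: contraTT => iJ; rewrite -leqNgt -[X in (_ <= X)%N](cardI i (ltnW (ltn_ord i))).
apply: subset_leq_card; apply/fintype.subsetP => b bJ; rewrite inE ltnNge leq_eqVlt.
by apply: contra iJ => /orP[/eqP/val_inj -> //|]; exact: idJ'.
Qed.

Lemma ch_maximal J b : ideal ch_lt J -> maximal ch_lt b J = (#|J| == b.+1).
Proof.
move=> idJ; apply/maximalP/eqP => [[bJ bmax]|Jb].
  apply/eqP; rewrite eqn_leq -(ch_ideal b idJ) bJ andbT leqNgt; apply/negP => bJ'.
  have bl : (b.+1 < sumn al)%N.
    by apply: leq_trans bJ' _; rewrite -[X in (_ <= X)%N](card_ord (sumn al)) max_card.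
  have := bmax (Ordinal bl); rewrite (ch_ideal _ idJ) /= => /(_ bJ').
  by rewrite /ch_lt /= ltnSn.
split; first by rewrite (ch_ideal _ idJ) Jb.
by move=> c; rewrite (ch_ideal _ idJ) Jb /ch_lt ltnS leqNgt.
Qed.

Definition ch_cfg (J : {set P}) : 'I_(sumn al).+1 := inord #|J|.
Definition ch_rm c (x : 'I_(sumn al).+1) := (0 < x)%N && (reshape_offset al x.-1 == c).
Definition ch_rt (c : nat) (x : 'I_(sumn al).+1) : 'I_(sumn al).+1 := inord x.-1.

Lemma ch_cfgE J : ch_cfg J = #|J| :> nat.
Proof.
by rewrite inordK // ltnS -[X in (_ <= X)%N](card_ord (sumn al)) max_card.
Qed.

Lemma ch_cfg_rm J c : ideal ch_lt J ->
  reflect (exists2 b, maximal ch_lt b J & ch_cont b = c) (ch_rm c (ch_cfg J)).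
Proof.
move=> idJ; rewrite /ch_rm ch_cfgE; apply: (iffP andP) => [[J0 /eqP cE]|[b]].
  have Jl : (#|J|.-1 < sumn al)%N.
    by rewrite prednK // -[X in (_ <= X)%N](card_ord (sumn al)) max_card.
  by exists (Ordinal Jl) => //; rewrite ch_maximal //= prednK.
by rewrite ch_maximal // => /eqP -> <-.
Qed.

Lemma ch_cfg_rt J b : ideal ch_lt J -> maximal ch_lt b J ->
  ch_rt (ch_cont b) (ch_cfg J) = ch_cfg (J :\ b).
Proof.
move=> idJ bm; have /maximalP[bJ _] := bm.
by rewrite /ch_rt ch_cfgE (cardsD1 b J) bJ.
Qed.

Lemma ch_cfg0 J : ideal ch_lt J -> ch_cfg J = ch_cfg finset.set0 -> J = finset.set0.
Proof.
by move=> _ /(congr1 val); rewrite /= !ch_cfgE cards0 => /eqP; rewrite cards_eq0 => /eqP.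
Qed.

(** Consecutive positions have different contents by [ch_succ]. *)
Lemma ch_rm_rt c x : ch_rm c x -> ~~ ch_rm c (ch_rt c x).
Proof.
case: x => [[|[|x]]] xl //; rewrite /ch_rm /ch_rt /= => /eqP cE.
  by rewrite inordK.
rewrite inordK ?(ltnW xl) //=.
have xl1 : (x.+1 < sumn al)%N by [].
have := @ch_succ (Ordinal (ltnW xl1)) (Ordinal xl1) erefl.
rewrite /ch_cont /= cE => -[[-> c0]|->]; first by rewrite gtn_eqF.
by rewrite ltn_eqF.
Qed.

(** As the entries are nonempty, the conditions on neighbours propagate along the chain. For barK
    the entry after a descent has content 0 and is unprimed, while only primed letters could be
    shared there; hence the strict inequality. *)
Lemma ch_valid (e : bool) (S : {ffun P -> {fset letter}}) :
  valid_filling ch_lt ch_cont m e S <->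
  (if e then K_tuple S else Kbar_tuple S).
Proof.
have step (i j : P) a a' : j = i.+1 :> nat ->
    (ltau ch_cont m i a < ltau ch_cont m j a')%N = (a < a')%O ||
    ((a == a') && (unprimed a == (val j \notin descents al))).
  move=> ij; rewrite ltau_ltE; last exact: ch_cont_lt.
  rewrite -letter_ltE mem_descents ij /=; congr (_ || (_ && _)).
  case: (ch_succ ij) => [[-> h]|->] /=; first by rewrite h; case: (unprimed a).
  by rewrite ltnSn ltnNge leqW //; case: (unprimed a).
have chain : all_nonempty S -> (forall i j : P, j = i.+1 :> nat ->
      forall a a', a \in S i -> a' \in S j ->
        (ltau ch_cont m i a < ltau ch_cont m j a')%N) ->
    forall b c, ch_lt b c -> forall a a', a \in S b -> a' \in S c ->
      (ltau ch_cont m b a < ltau ch_cont m c a')%N.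
  move=> ne adj b [c cl]; rewrite /ch_lt /=; elim: c cl => // c IH cl.
  rewrite ltnS leq_eqVlt => /orP[/eqP bc|bc] a a' ab a'c.
    by apply: adj => //=; rewrite bc.
  have /fset0Pn[a'' a''c] := ne (Ordinal (ltnW cl)).
  by apply: ltn_trans (IH (ltnW cl) bc a a'' ab a''c) (adj _ _ _ _ _ a''c a'c).
have first (b : P) : (val b \in 0%N :: descents al) = (ch_cont b == 0%N).
  rewrite inE mem_descents; case: posnP => //= b0.
  by rewrite /ch_cont /= -[val b]/(nat_of_ord b) b0 /reshape_offset sub0n.
split=> [[ne vS aS]|].
  have adj (i j : P) a a' : j = i.+1 :> nat -> a \in S i -> a' \in S j ->
      (a < a')%O || ((a == a') && (unprimed a == (val j \notin descents al))).
    by move=> ij ai a'j; rewrite -(step i j _ _ ij); apply: vS => //; rewrite /ch_lt ij.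
  have le (i j : P) : j = i.+1 :> nat -> set_le (S i) (S j).
    move=> ij a a' ai a'j; have := adj _ _ _ _ ij ai a'j.
    by case/orP => [/ltW //|/andP[/eqP -> _]].
  have up (i j : P) a : j = i.+1 :> nat -> a \in S i -> a \in S j ->
      unprimed a = (val j \notin descents al).
    by move=> ij ai aj; have := adj _ _ _ _ ij ai aj; rewrite ltxx eqxx /= => /eqP.
  case: e aS => [_|aS]; first by split=> // i j ij; split; [exact: le|move=> a; exact: up].
  have unp (j : P) a : val j \in 0%N :: descents al -> a \in S j -> unprimed a.
    by rewrite first => j0 aj; have := aS j a aj; rewrite j0 /= orbF.
  split=> [//|j jd a|i j ij]; first exact: unp.
  split; first exact: le.
    move=> jd a a' ai a'j; have := adj _ _ _ _ ij ai a'j.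
    case/orP => // /andP[/eqP aa]; rewrite jd aa (unp j a') //.
    by rewrite inE jd orbT.
  by move=> jd a ai aj; rewrite (up i j).
case: e => [[ne adj]|[ne unp adj]]; split=> //.
- apply: chain => // i j ij a a' ai a'j; rewrite step //.
  have [le up] := adj i j ij; have := le a a' ai a'j; rewrite le_eqVlt.
  case/orP => [/eqP aa|->//]; rewrite -aa in a'j *.
  by rewrite ltxx eqxx (up a) //= eqxx.
- apply: chain => // i j ij a a' ai a'j; rewrite step //.
  have [le lts up] := adj i j ij; have := le a a' ai a'j; rewrite le_eqVlt.
  case/orP => [/eqP aa|->//]; rewrite -aa in a'j *.
  have [jd|jd] := boolP (val j \in descents al).
    by rewrite (lts jd a a ai a'j).
  by rewrite ltxx eqxx (up jd a) //.
- move=> b a ab /=; case: (boolP (ch_cont b == 0%N)); rewrite ?orbT // => b0.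
  by rewrite (unp b) // first.
Qed.

Lemma chain_spec (e : bool) (F := if e then K al else Kbar al) :
  [/\ peak_series e false (hat F), vanish_below (sumn al) (hat F),
  hat F al = (if e then 2%:R ^+ size al else 1)%R & lexmax (sumn al) (hat F) al].
Proof.
apply: (@family_spec P ch_lt ch_row ch_cont m e false al _ _ _ _ _ _ _ _ _ _
  'I_(sumn al).+1 ch_cfg ch_rm ch_rt) => //.
- exact: ch_cont_lt.
- exact: ch_row_lt.
- exact: ch_cont_row.
- exact: ch_box_ex.
- exact: ch_box_inj.
- by move=> b c; rewrite ch_ltE => /orP[/ltnW //|/andP[/eqP -> _]].
- by move=> b c rr; rewrite ch_ltE rr ltnn eqxx.
- by move=> b c rr _ _; rewrite ch_ltE rr.
- by move=> b c _; case: (ltngtP b c) => [bc|bc|/val_inj bc];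
  [apply: Or32|apply: Or33|apply: Or31].
- exact: ch_cfg_rm.
- exact: ch_cfg_rt.
- exact: ch_cfg0.
- exact: ch_rm_rt.
rewrite /F card_ord /K /Kbar; case: e {F} => /=; congr genfun; apply/seteqP; split=> S /=.
- by move/(ch_valid true S).
- by move/(ch_valid true S).
- by move/(ch_valid false S).
- by move/(ch_valid false S).
Qed.

End Chain.

(** * Shifted tableaux *)

Section Shifted.

Variable l : seq nat.
Hypothesis l_strict : strict_partition l.

Local Notation P := (SD l).
Local Notation m := (head 0%N l).
Local Notation srow := (@Defs.row l).
Local Notation scol := (@Defs.col l).

Definition sh_cont (b : P) : nat := scol b - srow b.
Definition sh_lt (b c : P) : bool :=
  [&& (srow b <= srow c)%N, (scol b <= scol c)%N & b != c].

Lemma mem_SD i c : ((i, c) \in SD l) = [&& (i < size l)%N, (i <= c)%N & (c < i + nth 0%N l i)%N].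
Proof.
rewrite in_fset /=; apply/allpairsPdep/idP => [[i' [j []]]|/and3P[il ic cl]].
  by rewrite !mem_iota !add0n => i'l jl [-> ->]; move: i'l jl => /=; lia.
by exists i, (c - i)%N; rewrite !mem_iota /= !add0n; split=> //; [lia|congr (_, _); lia].
Qed.

Lemma strict_nth i i' : (i <= i')%N -> (i' < size l)%N ->
  (nth 0%N l i' + (i' - i) <= nth 0%N l i)%N.
Proof.
have [/(sortedP 0%N) srt _] := l_strict.
elim: i' => [|i' IH] ii' il; first by move: ii'; rewrite leqn0 => /eqP ->; rewrite addn0.
move: ii'; rewrite leq_eqVlt => /orP[/eqP ->|ii']; first by rewrite subnn addn0.
by have := IH ii' (ltnW il); have := srt i' il; rewrite /gtn /=; lia.
Qed.

Lemma strict_peak : peak_composition l.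
Proof.
have [srt l1] := l_strict; split=> // i il.
have h : (0 < nth 0%N l i.+1)%N by apply: (allP l1); apply: mem_nth.
by have := strict_nth (leqnSn i) il; lia.
Qed.

Lemma box_bounds (b : P) :
  [/\ (srow b < size l)%N, (srow b <= scol b)%N & (scol b < srow b + nth 0%N l (srow b))%N].
Proof.
by have := fsvalP b; rewrite [fsval b]surjective_pairing mem_SD => /and3P[].
Qed.

Lemma box_eq (b c : P) : srow b = srow c -> scol b = scol c -> b = c.
Proof. by move=> rr cc; apply: val_inj;
  rewrite /= [LHS]surjective_pairing [RHS]surjective_pairing; congr (_, _). Qed.

Lemma box_at i c : (i, c) \in SD l -> exists2 b : P, srow b = i & scol b = c.
Proof. by move=> h; exists [` h]%fset. Qed.

Lemma SD_down i c i' c' : (i, c) \in SD l -> (i' <= i)%N -> (i' <= c')%N -> (c' <= c)%N ->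
  (i', c') \in SD l.
Proof.
rewrite !mem_SD => /and3P[il ic cl] ii ic' cc.
by have := strict_nth ii il; rewrite ic' (leq_ltn_trans ii il) /=; lia.
Qed.

Lemma nth_head i : (i < size l)%N -> (nth 0%N l i + i <= m)%N.
Proof. by move=> il; have := strict_nth (leq0n i) il; rewrite nth0; lia. Qed.

Lemma sh_cont_lt b : (sh_cont b < m.+1)%N.
Proof.
have [h1 h2 h3] := box_bounds b; have := nth_head h1.
by rewrite /sh_cont; lia.
Qed.

Definition inJ (J : {set P}) i c := [exists b in J, (srow b == i) && (scol b == c)].

Lemma inJP (J : {set P}) (b : P) : inJ J (srow b) (scol b) = (b \in J).
Proof.
apply/exists_inP/idP => [[c cJ /andP[/eqP rr /eqP cc]]|bJ].
  by rewrite -(box_eq rr cc).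
by exists b => //; rewrite !eqxx.
Qed.

Lemma inJ_box J i c : inJ J i c -> exists b, [/\ b \in J, srow b = i & scol b = c].
Proof. by move=> /exists_inP[b bJ /andP[/eqP ? /eqP ?]]; exists b. Qed.

Lemma inJ_SD J i c : inJ J i c -> (i, c) \in SD l.
Proof.
by move=> /inJ_box[b [_ <- <-]]; rewrite -surjective_pairing; apply: fsvalP.
Qed.

Lemma inJ_down J i c i' c' : ideal sh_lt J -> inJ J i c ->
  (i' <= i)%N -> (i' <= c')%N -> (c' <= c)%N -> inJ J i' c'.
Proof.
move=> idJ ic ii ic' cc; have [b [bJ rb cb]] := inJ_box ic.
have [b' rb' cb'] := box_at (SD_down (inJ_SD ic) ii ic' cc).
rewrite -rb' -cb' inJP; have [->//|bb] := eqVneq b' b.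
apply: (implyP (forallP (forall_inP idJ b bJ) b')).
by rewrite /sh_lt rb rb' cb cb' ii cc bb.
Qed.

(** A row of an ideal that ends at content k has k + 1 boxes, so the occupied sites are the row
    lengths lowered by one. *)
Definition sh_cfg (J : {set P}) : sites m :=
  [ffun k : 'I_m.+1 => [exists b in J, (sh_cont b == k) && ~~ inJ J (srow b) (scol b).+1]].

Lemma occ_cfg J k : reflect (exists2 i, inJ J i (i + k) & ~~ inJ J i (i + k).+1)
  (occ (sh_cfg J) k).
Proof.
have key (km : (k < m.+1)%N) : reflect (exists2 i, inJ J i (i + k) & ~~ inJ J i (i + k).+1)
    (sh_cfg J (Ordinal km)).
  rewrite ffunE; apply: (iffP exists_inP) => [[b bJ /andP[/eqP bk nb]]|[i ik nik]].
    have [_ h _] := box_bounds b; rewrite /sh_cont /= in bk.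
    have E : (srow b + k = scol b)%N by lia.
    by exists (srow b); rewrite E ?inJP.
  have [b [bJ rb cb]] := inJ_box ik; exists b => //.
  by rewrite /sh_cont rb cb nik andbT /= addKn.
rewrite /occ; case: insubP => [[k' km] _ /= kE|km].
  by move: km; rewrite kE => km; apply: key.
constructor => -[i ik _]; have := inJ_SD ik; rewrite mem_SD => /and3P[h1 h2 h3].
by have := nth_head h1; move: km; lia.
Qed.

Lemma sh_maximal J b : ideal sh_lt J -> maximal sh_lt b J <->
  b \in J /\ forall i c, inJ J i c -> (srow b <= i)%N -> (scol b <= c)%N ->
    (i, c) = (srow b, scol b).
Proof.
move=> idJ; split=> [/maximalP[bJ bm]|[bJ bm]].
  split=> // i c /inJ_box[d [dJ <- <-]] rr cc.
  have := bm d dJ; rewrite /sh_lt rr cc /= negbK => /eqP -> //.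
apply/maximalP; split=> // c cJ; apply/negP => /and3P[rr cc /eqP bc].
have := bm (srow c) (scol c); rewrite inJP => /(_ cJ rr cc) [r1 c1].
by apply: bc; apply: box_eq.
Qed.

Lemma sh_cfg_rm J c : ideal sh_lt J ->
  reflect (exists2 b, maximal sh_lt b J & sh_cont b = c) (rmv c (sh_cfg J)).
Proof.
move=> idJ; apply: (iffP idP) => [rc|[b bm bc]].
  have [oc nc] : occ (sh_cfg J) c /\ forall k, c = k.+1 -> ~~ occ (sh_cfg J) k.
    by case: c rc => [|k] /= => [->//|/andP[nk ->]]; split=> // k' [<-].
  have [i ic nic] := occ_cfg _ _ oc; have [b [bJ rb cb]] := inJ_box ic.
  exists b; last by rewrite /sh_cont rb cb addKn.
  apply/sh_maximal => //; split=> // r q rq; rewrite rb cb => ir iq.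
  have qE : q = (i + c)%N.
    apply/eqP; rewrite eqn_leq iq andbT leqNgt; apply/negP => iq'.
    by move/negP: nic; apply; apply: (inJ_down idJ rq); lia.
  rewrite qE; congr (_, _); apply/eqP; rewrite eqn_leq ir andbT leqNgt; apply/negP => ir'.
  have := inJ_SD rq; rewrite mem_SD => /and3P[_ rq' _].
  case: c qE {oc rc} nc ic nic iq cb => [|k] qE nc ic nic iq cb; first lia.
  (* A box of [J] below b would make row i + 1 end at content k, so site k would be occupied. *)
  move/negP: (nc k erefl); apply; apply/occ_cfg; exists i.+1.
    by apply: (inJ_down idJ rq); lia.
  apply: contra nic => h; apply: (inJ_down idJ h); lia.
have /sh_maximal -/(_ idJ) [bJ bmax] := bm.
have [h1 h2 h3] := box_bounds b;
  have cE : (srow b + c = scol b)%N by rewrite -bc /sh_cont; lia.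
have oc : occ (sh_cfg J) c.
  apply/occ_cfg; exists (srow b); rewrite cE ?inJP //.
  by apply/negP => h; have /(congr1 snd) /= := bmax _ _ h (leqnn _) (leqnSn _); lia.
case: c bc cE oc => [|k] //= bc cE ->; rewrite andbT; apply/negP => /occ_cfg[i ik nik].
have [ib|bi] := leqP i (srow b).
  move/negP: nik; apply; apply: (inJ_down idJ (i := srow b) (c := scol b));
    rewrite ?inJP //; lia.
have /(congr1 fst) /= : (i, (i + k)%N) = (srow b, scol b); last by lia.
by apply: (bmax _ _ ik (ltnW bi)); lia.
Qed.

(** Only the row of b changes, so only its last content and the one before are affected. The site of
    b becomes empty because no two rows of an ideal have the same length. *)
Lemma sh_cfg_rt J b : ideal sh_lt J -> maximal sh_lt b J ->
  rmt (sh_cont b) (sh_cfg J) = sh_cfg (J :\ b).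
Proof.
move=> idJ bm; have /sh_maximal -/(_ idJ) [bJ bmax] := bm.
have [h1 h2 h3] := box_bounds b.
have inD i c : inJ (J :\ b) i c = inJ J i c && ((i, c) != (srow b, scol b)).
  apply/idP/andP => [/inJ_box[d [/finset.setD1P[db dJ] <- <-]]|[/inJ_box[d [dJ <- <-]] h]].
    by rewrite inJP; split=> //; apply: contraNneq db => -[? ?]; apply/eqP/box_eq.
  by rewrite inJP finset.in_setD1 dJ andbT; apply: contraNneq h => ->.
have cE : (srow b + sh_cont b = scol b)%N by rewrite /sh_cont; lia.
have other j : j != sh_cont b -> j.+1 != sh_cont b ->
    occ (sh_cfg (J :\ b)) j = occ (sh_cfg J) j.
  move=> j1 j2; have E i : inJ (J :\ b) i (i + j) = inJ J i (i + j).
    rewrite inD; case: eqP => [[ri ci]|]; rewrite ?andbT //.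
    by move: j1; rewrite /sh_cont -ri -ci addKn eqxx.
  have E' i : inJ (J :\ b) i (i + j).+1 = inJ J i (i + j).+1.
    rewrite inD; case: eqP => [[ri ci]|]; rewrite ?andbT //.
    by move: j2; rewrite /sh_cont -ri -ci -addnS addKn eqxx.
  by apply/occ_cfg/occ_cfg => -[i h h']; exists i; move: h h'; rewrite ?E ?E'.
have top : occ (sh_cfg (J :\ b)) (sh_cont b) = false.
  apply/negP => /occ_cfg[i]; rewrite !inD => /andP[h hi].
  have -> : ((i, (i + sh_cont b).+1) != (srow b, scol b)) by apply/eqP => -[? ?]; lia.
  rewrite andbT => /negP; apply.
  have [ib|bi] := ltnP i (srow b).
    by apply: (inJ_down idJ (i := srow b) (c := scol b)); rewrite ?inJP //; lia.
  by move: hi; rewrite (bmax _ _ h bi) ?eqxx //; lia.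
apply: sites_eq => j; case cb : (sh_cont b) other top cE => [|k] other top cE /=.
  rewrite occ_vacate; case: j => [|j]; first by rewrite top.
  by rewrite other.
rewrite occ_hop; have [->|jk] := eqVneq j k.
  have -> : (k < m.+1)%N by have := sh_cont_lt b; rewrite cb => /ltnW.
  symmetry; apply/occ_cfg; exists (srow b); rewrite inD;
    last by rewrite -addnS cE eqxx andbF.
  apply/andP; split; last by apply/eqP => -[]; lia.
  by apply: (inJ_down idJ (i := srow b) (c := scol b)); rewrite ?inJP //; lia.
have [->|jk1] := eqVneq j k.+1; first by rewrite top.
by rewrite other.
Qed.

Lemma sh_cfg0 J : ideal sh_lt J -> sh_cfg J = sh_cfg finset.set0 -> J = finset.set0.
Proof.
move=> idJ J0; apply/setP => b; rewrite inE; apply/negP => bJ.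
have [h1 h2 h3] := box_bounds b.
have ex : exists k, inJ J (srow b) (srow b + k).
  by exists (scol b - srow b)%N; rewrite subnKC // inJP.
have bd k : inJ J (srow b) (srow b + k) -> (k <= m)%N.
  move=> /inJ_SD; rewrite mem_SD => /and3P[g1 g2 g3]; have := nth_head g1; lia.
case: (ex_maxnP ex bd) => k hk kmax.
have : occ (sh_cfg J) k.
  apply/occ_cfg; exists (srow b) => //; apply/negP; rewrite -addnS => /kmax.
  by rewrite ltnn.
by rewrite J0 => /occ_cfg[i /inJ_box[d []]]; rewrite inE.
Qed.

Lemma sh_valid (e : bool) (S : {ffun P -> {fset letter}}) :
  valid_filling sh_lt sh_cont m e S <->
  shifted_tableau S /\ (~~ e -> unprimed_diagonal S).
Proof.
have ltauE (b c : P) (x y : letter) :=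
  @ltau_ltE _ sh_cont m b c x y sh_cont_lt.
have diag (b : P) : (sh_cont b == 0%N) = (srow b == scol b).
  by have [_ h _] := box_bounds b; rewrite /sh_cont; apply/eqP/eqP; lia.
split=> [[ne vS aS]|[[ne rowS colS uS pS] dS]].
  have le b c : sh_lt b c -> set_le (S b) (S c).
    move=> bc x y xb yc; have := vS b c bc x y xb yc; rewrite ltauE letter_leE.
    by case/orP => [/ltnW //|/andP[/eqP -> _]].
  have row_lt b c : srow b = srow c -> (scol b < scol c)%N -> sh_lt b c.
    move=> rr cc; rewrite /sh_lt rr leqnn (ltnW cc) /=.
    by apply: contraTneq cc => ->; rewrite ltnn.
  have col_lt b c : scol b = scol c -> (srow b < srow c)%N -> sh_lt b c.
    move=> cc rr; rewrite /sh_lt cc leqnn (ltnW rr) /=.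
    by apply: contraTneq rr => ->; rewrite ltnn.
  split; last first.
    move=> ne' b x bd xb; have := aS b x xb; rewrite diag bd eqxx orbF.
    by rewrite (negPf ne').
  split=> //.
  - by move=> b c rr cc; apply/le/row_lt.
  - by move=> b c rr cc; apply/le/col_lt.
  - have aux b c x : unprimed x -> scol b = scol c -> x \in S b -> x \in S c ->
        (srow b < srow c)%N -> False.
      move=> ux cc xb xc rr; have := vS b c (col_lt _ _ cc rr) x x xb xc.
      have [_ hb _] := box_bounds b; have [_ hc _] := box_bounds c.
      by rewrite ltauE ltnn eqxx ux /= /sh_cont; lia.
    move=> b c x ux cc xb xc; apply: box_eq => //.
    have [rr|rr|//] := ltngtP (srow b) (srow c); first by have := aux b c x ux cc xb xc rr.
    by have := aux c b x ux (esym cc) xc xb rr.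
  - have aux b c x : ~~ unprimed x -> srow b = srow c -> x \in S b -> x \in S c ->
        (scol b < scol c)%N -> False.
      move=> ux rr xb xc cc; have := vS b c (row_lt _ _ rr cc) x x xb xc.
      have [_ hb _] := box_bounds b; have [_ hc _] := box_bounds c.
      by rewrite ltauE ltnn eqxx (negPf ux) /= /sh_cont; lia.
    move=> b c x ux rr xb xc; apply: box_eq => //.
    have [cc|cc|//] := ltngtP (scol b) (scol c); first by have := aux b c x ux rr xb xc cc.
    by have := aux c b x ux (esym rr) xc xb cc.
have same_row (b c : P) x y : srow b = srow c -> (scol b < scol c)%N -> x \in S b ->
  y \in S c ->
    (x < y)%O || ((x == y) && unprimed x).
  move=> rr cc xb yc; have := rowS b c rr cc x y xb yc.
  rewrite le_eqVlt => /orP[/eqP xy|->//]; rewrite -xy eqxx /= ltxx /=.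
  apply: contraT => ux; have bc := pS b c x ux rr xb; rewrite xy in bc.
  by move: cc; rewrite bc // ltnn.
have same_col (b c : P) x y : scol b = scol c -> (srow b < srow c)%N -> x \in S b ->
  y \in S c ->
    (x < y)%O || ((x == y) && ~~ unprimed x).
  move=> cc rr xb yc; have := colS b c cc rr x y xb yc.
  rewrite le_eqVlt => /orP[/eqP xy|->//]; rewrite -xy eqxx /= ltxx /=.
  apply/negP => ux; have bc := uS b c x ux cc xb; rewrite xy in bc.
  by move: rr; rewrite bc // ltnn.
split=> //; last first.
  move=> b x xb; have [//|ne'] := boolP e; rewrite diag /=.
  by case: eqP => [bd|_]; [rewrite (dS ne' b x bd xb)|rewrite orbT].
move=> b c /and3P[rr cc bc] x y xb yc; rewrite ltauE -letter_ltE.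
have [_ hb _] := box_bounds b; have [_ hc _] := box_bounds c.
move: rr; rewrite leq_eqVlt => /orP[/eqP rr|rr].
  have cc' : (scol b < scol c)%N.
    rewrite ltn_neqAle cc andbT; apply: contraNneq bc => cE.
    by apply/eqP/box_eq.
  case/orP: (same_row _ _ x y rr cc' xb yc) => [->//|/andP[-> ->] /=].
  by apply/orP; right; rewrite /sh_cont; lia.
move: cc; rewrite leq_eqVlt => /orP[/eqP cc|cc].
  case/orP: (same_col _ _ x y cc rr xb yc) => [->//|/andP[-> /negPf -> /=]].
  by apply/orP; right; rewrite /sh_cont; lia.
have cSD : (srow c, scol c) \in SD l by rewrite -surjective_pairing; apply: fsvalP.
(* The corner d is in the row of b and the column of c. A letter shared by b, d and c would have to
   be unprimed along the row and primed along the column, so the passage from b to c is strict. *)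
have [|d rd cd] := @box_at (srow b) (scol c).
  by apply: (SD_down cSD) => //; [apply: ltnW|lia].
have /fset0Pn[z zd] := ne d.
have bd : (scol b < scol d)%N by rewrite cd.
have dc : (srow d < srow c)%N by rewrite rd.
case/orP: (same_row b d x z (esym rd) bd xb zd) => [xz|/andP[/eqP xz uz]];
  case/orP: (same_col d c z y cd dc zd yc) => [zy|/andP[/eqP zy uz']].
- by rewrite (lt_trans xz zy).
- by rewrite -zy xz.
- by rewrite xz zy.
- by move: uz'; rewrite -xz uz.
Qed.

Lemma shifted_spec (e : bool) (F := if e then GQ l else GP l) :
  [/\ peak_series e true (hat F), vanish_below (sumn l) (hat F),
  hat F l = (if e then 2%:R ^+ size l else 1)%R & lexmax (sumn l) (hat F) l].
Proof.
have cont_row (b : P) : (sh_cont b < nth 0%N l (srow b))%N.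
  by have [h1 h2 h3] := box_bounds b; rewrite /sh_cont; lia.
have row_lt (b : P) : (srow b < size l)%N by have [] := box_bounds b.
have box_ex i j : (i < size l)%N -> (j < nth 0%N l i)%N ->
    exists2 b : P, srow b = i & sh_cont b = j.
  move=> il jl; have [|b rb cb] := @box_at i (i + j)%N.
    by rewrite mem_SD il leq_addr ltn_add2l.
  by exists b; rewrite // /sh_cont rb cb addKn.
have box_inj (b c : P) : srow b = srow c -> sh_cont b = sh_cont c -> b = c.
  move=> rr; rewrite /sh_cont rr => cc; apply: box_eq => //.
  by have [_ hb _] := box_bounds b; have [_ hc _] := box_bounds c; lia.
have cardP : #|{: P}| = sumn l by apply: (card_boxes row_lt cont_row box_ex box_inj).
apply: (@family_spec P sh_lt srow sh_cont m e true l strict_peak sh_cont_lt row_lt cont_row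
  box_ex box_inj _ _ _ _ (sites m) sh_cfg (@rmv m) (@rmt m)).
- by move=> b c /and3P[].
- move=> b c rr; have [_ hb _] := box_bounds b; have [_ hc _] := box_bounds c.
  rewrite /sh_lt rr leqnn /sh_cont rr /=; apply/andP/idP => [[cc bc]|cc].
    have : scol b != scol c by apply: contraNneq bc => cE; apply/eqP/box_eq.
    by move: cc; lia.
  by split; [lia|apply: contraTneq cc => ->; rewrite ltnn].
- move=> b c rr; have [_ hb _] := box_bounds b; have [_ hc _] := box_bounds c.
  rewrite /sh_lt /sh_cont => c0 b1; apply/and3P; split; try lia.
  by apply: contraTneq rr => ->; rewrite ltnn.
- move=> b c; have [_ hb _] := box_bounds b; have [_ hc _] := box_bounds c.
  rewrite /sh_lt /sh_cont => bc; have [rr|rr|rr] := ltngtP (srow b) (srow c).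
  + apply: Or32; apply/and3P; split; try lia.
    by apply: contraTneq rr => ->; rewrite ltnn.
  + apply: Or33; apply/and3P; split; try lia.
    by apply: contraTneq rr => ->; rewrite ltnn.
  + by apply: Or31; apply: box_eq => //; lia.
- exact: sh_cfg_rm.
- exact: sh_cfg_rt.
- exact: sh_cfg0.
- exact: rmv_rmt.
- by move=> _; apply: particle_word_comm.
rewrite /F cardP /GQ /GP; case: e {F} => /=; congr genfun; apply/seteqP; split=> S /=.
- by move=> h; apply/sh_valid.
- by move/(sh_valid true S) => [].
- by move=> [h d]; apply/sh_valid.
- by move/(sh_valid false S) => [h /(_ isT)].
Qed.

End Shifted.

(** * Intrinsic descriptions of the four spans *)

Lemma peak_comp al : peak_composition al -> composition al.
Proof. by case. Qed.

Lemma strict_comp l : strict_partition l -> composition l.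
Proof. by case. Qed.

Lemma mPiP (e : bool) f :
  pspan [set al | peak_composition al] (fun al => if e then K al else Kbar al) f <->
  peak_series e false (hat f).
Proof.
apply: pspanP => [al /peak_comp //|al pal|al pal|al pal|al pal|n G g GV low pg gn gm gn0].
- by have [] := chain_spec pal e.
- by have [] := chain_spec pal e.
- by have [] := chain_spec pal e.
- by have [] := chain_spec pal e.
- exact: lead_peak GV low pg gn gm gn0.
Qed.

Lemma mGammaP (e : bool) f :
  pspan [set l | strict_partition l] (fun l => if e then GQ l else GP l) f <->
  peak_series e true (hat f).
Proof.
apply: pspanP => [l /strict_comp //|l sl|l sl|l sl|l sl|n G g GV low pg gn gm gn0].
- by have [] := shifted_spec sl e.
- by have [] := shifted_spec sl e.
- by have [] := shifted_spec sl e.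
- by have [] := shifted_spec sl e.
- exact: lead_strict GV low pg gn gm gn0.
Qed.

Theorem theorem5p11 :
  [/\ mGammaSym = mSym `&` mPiSym,
      mGammabarSym = mSym `&` mPibarSym
    & mGammaSym `<=` mGammabarSym].
Proof.
have gp e f : peak_series e true (hat f) <-> mSym f /\ peak_series e false (hat f).
  rewrite mSymP; split=> [[qf cf ef sf]|[sf [qf cf ef _]]].
    by split; [apply: sf|split].
  by split.
split.
- apply/seteqP; split=> f /=.
    by move/(mGammaP true f)/gp => [? ?]; split=> //; apply/(mPiP true).
  by move=> [sf /(mPiP true f) pf]; apply/(mGammaP true)/gp.
- apply/seteqP; split=> f /=.
    by move/(mGammaP false f)/gp => [? ?]; split=> //; apply/(mPiP false).
  by move=> [sf /(mPiP false f) pf]; apply/(mGammaP false)/gp.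
- move=> f /(mGammaP true f)[qf cf _ sf]; apply/(mGammaP false); split=> //.
Qed.
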